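(* Let $d\in\mathbb{N}$, $d\ge 1$, let $\sigma>0$ and $\theta\in\mathbb{R}$, and put $\lambda:=\theta/\sigma^2\in\mathbb{R}$. Let $L>0$ and $x\in[0,L]$, and let $(X_t)_{t\ge 0}$ be the $d$-dimensional Ornstein--Uhlenbeck process solving $\mathrm{d}X_t=-\theta X_t\,\mathrm{d}t+\sigma\,\mathrm{d}B_t$, with initial value satisfying $\|X_0\|_2=x$ almost surely. Let $\tau_L:=\inf\{t\ge 0:\|X_t\|_2=L\}$ and denote its expectation by $\mathbb{E}^x\tau_L$. Then $$\mathbb{E}^x\tau_L=\frac{2}{\sigma^2}\int_x^L z^{1-d}e^{\lambda z^2}\left[\int_0^z t^{d-1}e^{-\lambda t^2}\,\mathrm{d}t\right]\mathrm{d}z .$$ If moreover $\lambda>0$, then $$\mathbb{E}^x\tau_L=\frac{1}{\lambda^{d/2}\sigma^2}\int_x^L z^{1-d}e^{\lambda z^2}\,\gamma\!\left(\tfrac d2,\lambda z^2\right)\mathrm{d}z,$$ where $\gamma(n,y):=\int_0^y t^{n-1}e^{-t}\,\mathrm{d}t$ is the lower incomplete Gamma function.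
   Context: $B_t$ is a standard $d$-dimensional Brownian motion, $X_0$ is independent of $B$, and $X$ is the (strong) solution of the stated It\^o SDE with initial value $X_0$. $\|\cdot\|_2$ is the Euclidean norm on $\mathbb{R}^d$. The case $\theta=0$ is $\sigma$ times a Brownian motion (started at $X_0$); the case $\theta<0$ is allowed. The superscript $x$ in $\mathbb{E}^x\tau_L$ only indicates that $\|X_0\|_2=x$ almost surely. *)

(* Defs.v *)
From mathcomp Require Import all_boot all_order all_algebra.
From mathcomp Require Import all_classical all_reals all_analysis.
Set Implicit Arguments.
Unset Strict Implicit.
Unset Printing Implicit Defensive.
Import Order.TTheory GRing.Theory Num.Theory.
Import numFieldNormedType.Exports.
Local Open Scope classical_set_scope.
Local Open Scope ring_scope.

(* The library norm on 'rV[R]_d is the sup norm, hence this definition. *)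
Definition euclidean_norm (R : realType) (d : nat) (v : 'rV[R]_d) : R :=
  Num.sqrt (\sum_(i < d) v ord0 i ^+ 2).

(* 'rV[R]_d carries no measurableType structure in the library; its Borel
   sigma-algebra is the one generated by the coordinates, so measurability,
   generated sigma-algebras and laws of random vectors are expressed
   coordinatewise. *)
Definition measurable_vector (disp : measure_display) (T : measurableType disp)
    (R : realType) (d : nat) (Y : T -> 'rV[R]_d) : Prop :=
  forall i : 'I_d, measurable_fun [set: T] (fun w => Y w ord0 i).

Definition sigma_generated (T I : Type) (R : realType) (d : nat) (K : set I)
    (Y : I -> T -> 'rV[R]_d) : set (set T) :=
  <<s \bigcup_(k in K) \bigcup_(i in [set: 'I_d])
        preimage_set_system [set: T] (fun w => Y k w ord0 i)
          (measurable : set (set R)) >>.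

Definition independent_systems (disp : measure_display)
    (T : measurableType disp) (R : realType) (P : probability T R)
    (F G : set (set T)) : Prop :=
  forall A C, F A -> G C -> P (A `&` C) = (P A * P C)%E.

(* [normal_prob] is parameterized by the standard deviation. A finite measure
   on the Borel sets of R^d is determined by its values on boxes, so the
   third clause says that [B t - B s] has law N(0, (t - s) I_d). *)
Definition standard_brownian_motion (disp : measure_display)
    (T : measurableType disp) (R : realType) (P : probability T R) (d : nat)
    (B : R -> T -> 'rV[R]_d) : Prop :=
  [/\ forall t : R, 0 <= t -> measurable_vector (B t),
      {ae P, forall w, B 0 w = 0},
      forall s t : R, 0 <= s -> s < t ->
        forall A : 'I_d -> set R, (forall i, measurable (A i)) ->
          P [set w | forall i, A i ((B t w - B s w) ord0 i)] =
          (\prod_(i < d) normal_prob 0 (Num.sqrt (t - s)) (A i))%E,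
      forall s t : R, 0 <= s -> s < t ->
        independent_systems P
          (sigma_generated [set: unit] (fun=> fun w => B t w - B s w))
          (sigma_generated `[0, s] B)
    & {ae P, forall w, {within `[0, +oo[, continuous (fun t => B t w)}}].

Definition augmented_filtration (disp : measure_display)
    (T : measurableType disp) (R : realType) (P : probability T R) (d : nat)
    (X0 : T -> 'rV[R]_d) (B : R -> T -> 'rV[R]_d) (t : R) : set (set T) :=
  <<s sigma_generated [set: unit] (fun=> X0) `|` sigma_generated `[0, t] B
      `|` [set N | P.-negligible N] >>.

(* Strong solution of dX = - theta X dt + sigma dB with initial value X 0.
   The diffusion coefficient being constant, the Ito integral of sigma over
   [0, t] is sigma (B_t - B_0), with B_0 = 0 almost surely. *)
Definition ornstein_uhlenbeck_solution (disp : measure_display)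
    (T : measurableType disp) (R : realType) (P : probability T R) (d : nat)
    (theta sigma : R) (B X : R -> T -> 'rV[R]_d) : Prop :=
  [/\ forall t : R, 0 <= t -> measurable_vector (X t),
      forall t : R, 0 <= t ->
        sigma_generated [set t] X `<=` augmented_filtration P (X 0) B t,
      {ae P, forall w, {within `[0, +oo[, continuous (fun t => X t w)}}
    & {ae P, forall w, forall t : R, 0 <= t ->
        X t w = X 0 w
                - theta *: \row_i (\int[lebesgue_measure]_(s in `[0, t])
                                     X s w ord0 i)
                + sigma *: (B t w - B 0 w)}].

(* The infimum of the empty set is +oo. *)
Definition hitting_time (T : Type) (R : realType) (d : nat)
    (X : R -> T -> 'rV[R]_d) (L : R) (w : T) : \bar R :=
  ereal_inf [set t%:E | t in [set t : R | 0 <= t /\ euclidean_norm (X t w) = L]].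

Definition lower_incomplete_gamma (R : realType) (n y : R) : R :=
  \int[lebesgue_measure]_(t in `[0, y]) (t `^ (n - 1) * expR (- t)).

(* Main.v *)
Require Import Defs.
From mathcomp Require Import all_boot all_order all_algebra.
From mathcomp Require Import all_classical all_reals all_analysis.
From mathcomp Require Import measurable_realfun.
From mathcomp Require Import ring lra.
Import Order.TTheory GRing.Theory Num.Theory.
Import numFieldNormedType.Exports.
Local Open Scope classical_set_scope.
Local Open Scope ring_scope.

(* With r = |z|^2, choose F analytic such that
   2 sigma^2 r F'' + (d sigma^2 - 2 theta r) F' = 1, i.e. the generator of X maps
   z |-> F(|z|^2) to 1; then E tau_L should be F(L^2) - F(x^2), which the
   substitution r = z^2 turns into the iterated integrals. Ito's formula is
   replaced by an Euler scheme: the chain with step h = t/n driven by the same B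
   is stopped on leaving a ball of radius l, and a second order Taylor expansion
   with independent Gaussian increments gives
   E F(|Z_(k+1)|^2) - E F(|Z_k|^2) = h P(|Z_k| < l) + O(h^(3/2)),
   so the mean discrete exit time tends to F(l^2) - F(x^2) as n, then t, grows.
   Pathwise the chain converges to X uniformly on [0, t] before exiting, so the
   discrete exit times are eventually above every s < tau_L when l = L, and
   eventually below every s slightly above tau_L when l < L. Fatou's lemma gives
   the upper bound from the first fact and, applied to t minus the exit time and
   followed by l -> L, the lower bound from the second. As tau_L is only
   almost everywhere comparable to measurable functions, its integral is handled
   as the supremum of the integrals of the simple functions below it. *)

(** * A radial solution of the generator equation *)

(** The squared norm, unlike the norm, is smooth at the origin; hence the variable r. At r = 0 the
    equation for F' degenerates, and all its solutions but one blow up like r^(-d/2); the power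
    series picks the regular one, the only one whose F can be used on paths through the origin. As F
    may grow exponentially, F(|Z|^2) need not be integrable: it is replaced by F(min(|Z|^2, l^2 +
    1)), and the cap costs only a cubic term. The chain may jump over the sphere, and it may not
    have exited by time t. The overshoot is controlled by the sum of the cubes of the jumps, which
    vanishes with the step. The missing exit has probability O(1/t) by Markov's inequality applied
    to the exit time itself, whose mean is bounded because the capped F is. This is the origin of an
    error 4 M^2 / t that disappears only with the horizon. The lower bound needs l < L because a
    path may merely touch the sphere of radius L, and nearby chains then need not exit; a path at
    distance L is strictly outside the smaller ball, which survives small perturbations. *)

Section power_series.
Context {R : realType}.
Implicit Types (c : R^nat) (C M x : R).

(** The growth of the coefficients of an exponential. It forces an infinite radius of convergence
    and is stable under [pseries_diffs], so any number of derivatives comes at no extra cost. *)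
Definition factorial_bounded c :=
  exists C M, forall n, `|c n| <= C * (M ^+ n / n`!%:R).

Lemma factorial_bounded_diffs c :
  factorial_bounded c -> factorial_bounded (pseries_diffs c).
Proof.
move=> [C [M cM]]; exists (C * M), M => n.
rewrite /pseries_diffs normrM ger0_norm//.
apply: (le_trans (ler_wpM2l _ (cM n.+1))) => //.
rewrite factS natrM exprS invfM le_eqVlt; apply/orP; left; apply/eqP.
by field; rewrite !pnatr_eq0 -lt0n fact_gt0/= addrC natr1 pnatr_eq0.
Qed.

Lemma factorial_bounded_cvg c x : factorial_bounded c -> cvgn (pseries c x).
Proof.
move=> [C [M cM]]; apply: normed_cvg.
have C0 : 0 <= C.
  by have := le_trans (normr_ge0 _) (cM 0%N); rewrite expr0 fact0 divr1 mulr1.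
have cvgE : cvgn (series (C *: exp_coeff `|M * x|)).
  by apply: is_cvg_seriesZ; exact: is_cvg_series_exp_coeff.
apply: series_le_cvg cvgE => n //=.
  by rewrite mulr_ge0// exp_coeff_ge0.
rewrite normrM -[leRHS]/(C * (`|M * x| ^+ n / n`!%:R)) !normrX normrM exprMn.
apply: (le_trans (ler_wpM2r (exprn_ge0 _ (normr_ge0 x)) (cM n))).
rewrite -!mulrA ler_wpM2l// mulrA (mulrAC _ _^-1) mulrA ler_wpM2r ?invr_ge0//.
by rewrite ler_wpM2r ?exprn_ge0// -normrX ler_norm.
Qed.

Lemma is_derive_pseries c x : factorial_bounded c ->
  is_derive x (1 : R) (fun y => limn (pseries c y)) (limn (pseries (pseries_diffs c) x)).
Proof.
move=> bc; apply: (@pseries_snd_diffs _ _ (`|x| + 1)).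
- exact: factorial_bounded_cvg.
- exact/factorial_bounded_cvg/factorial_bounded_diffs.
- exact/factorial_bounded_cvg/factorial_bounded_diffs/factorial_bounded_diffs.
- by rewrite [ltRHS]ger0_norm ?addr_ge0// ltrDl.
Qed.

End power_series.

Section radial_equation.
Context {R : realType} (d : nat) (s t : R).
Hypotheses (d_gt0 : (0 < d)%N) (s_gt0 : 0 < s).

(* The power series of [f1], obtained by comparing coefficients in [radial_equation]. *)
Fixpoint radial_coef (n : nat) : R :=
  if n is m.+1 then 2 * t / s ^+ 2 * radial_coef m / (2 * m.+1%:R + d%:R)
  else (s ^+ 2 * d%:R)^-1.

Let d_gt0R : 0 < d%:R :> R. Proof. by rewrite ltr0n. Qed.

(** The ratio of consecutive coefficients is 2t / (s^2 (2(n+1) + d)); dropping [d] from the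
    denominator bounds it by (|t| / s^2) / (n+1), hence the two constants. *)
Lemma factorial_bounded_radial_coef : factorial_bounded radial_coef.
Proof.
exists (radial_coef 0), (`|t| / s ^+ 2); elim=> [|n IH].
  by rewrite expr0 fact0 divr1 mulr1 /= ger0_norm// invr_ge0 mulr_ge0// sqr_ge0.
rewrite [X in `|X|]/= !normrM !normfV normrX (gtr0_norm s_gt0).
have n2 : 0 < 2 * n.+1%:R + d%:R :> R by rewrite addr_gt0.
rewrite (@gtr0_norm _ 2)// (gtr0_norm n2).
have ds : 0 < s ^+ 2 by rewrite exprn_gt0.
have f0 : 0 < n`!%:R :> R by rewrite ltr0n fact_gt0.
rewrite ler_pdivrMr//.
apply: (le_trans (ler_wpM2l _ IH)); first by rewrite divr_ge0 ?mulr_ge0// ltW.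
rewrite factS natrM [_ ^+ n.+1]exprS [(n.+1%:R * _)^-1]invfM.
set a0 := radial_coef 0; set y := (_ / _) ^+ n; set m := n.+1%:R.
have m0 : 0 < m by rewrite ltr0n.
have -> : a0 * (`|t| / s ^+ 2 * y * (m^-1 / n`!%:R)) * (2 * m + d%:R)
  = 2 * `|t| / s ^+ 2 * (a0 * (y / n`!%:R))
  + a0 * (`|t| / s ^+ 2 * y * (m^-1 / n`!%:R)) * d%:R.
  by field; rewrite ?gt_eqF.
have a00 : 0 <= a0 by rewrite /a0/= invr_ge0 mulr_ge0// ltW.
have y0 : 0 <= y by rewrite exprn_ge0// divr_ge0// ltW.
by rewrite lerDl !mulr_ge0// ?invr_ge0// ltW.
Qed.

Lemma radial_coefS n :
  (2 * n.+1%:R + d%:R) * s ^+ 2 * radial_coef n.+1 = 2 * t * radial_coef n.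
Proof.
have n2 : 0 < 2 * n.+1%:R + d%:R :> R by rewrite addr_gt0.
by rewrite /=; field; rewrite gt_eqF//= gt_eqF.
Qed.

Lemma radial_equation r :
  2 * s ^+ 2 * r * limn (pseries (pseries_diffs radial_coef) r) +
  (d%:R * s ^+ 2 - 2 * t * r) * limn (pseries radial_coef r) = 1.
Proof.
have a0 : radial_coef 0 = (s ^+ 2 * d%:R)^-1 by [].
move: radial_coef a0 radial_coefS factorial_bounded_radial_coef => a a0 aS ba.
have c1 := factorial_bounded_cvg a r ba.
have c2 := factorial_bounded_cvg _ r (factorial_bounded_diffs _ ba).
have d2 := pseries_diffs_equiv c2.
set A := pseries a r in c1 *.
set D := series _ in d2.
have c1S : A n.+1 @[n --> \oo] --> limn A by rewrite cvg_shiftS.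
have d2S : D n.+1 @[n --> \oo] --> limn (pseries (pseries_diffs a) r).
  by rewrite cvg_shiftS.
(* The equation holds exactly on partial sums: the last one is one term shorter because its factor r
   raises the degree, so every power of r up to n is matched and nothing is left over. *)
have E n : 2 * s ^+ 2 * r * D n.+1 + d%:R * s ^+ 2 * A n.+1 - 2 * t * r * A n = 1.
  elim: n => [|n IH].
    rewrite /D /A /pseries /series/= !big_nat1 big_geq// !mul0r expr0 a0.
    by field; rewrite ?gt_eqF.
  have DS : D n.+2 = D n.+1 + n.+1%:R * a n.+1 * r ^+ n.
    by rewrite /D /series/= big_nat_recr.
  have AS m : A m.+1 = A m + a m * r ^+ m.
    by rewrite /A /pseries /series/= big_nat_recr.
  have n2 : 0 < 2 * n.+1%:R + d%:R :> R by rewrite addr_gt0.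
  have xE : a n.+1 = 2 * t * a n / ((2 * n.+1%:R + d%:R) * s ^+ 2).
    by rewrite -aS mulrAC divff ?mul1r// gt_eqF// mulr_gt0// exprn_gt0.
  have AE : A n = A n.+1 - a n * r ^+ n by rewrite AS addrK.
  rewrite -[RHS]IH AE DS (AS n.+1) xE [r ^+ n.+1]exprS.
  by field; rewrite !gt_eqF.
pose u n := 2 * s ^+ 2 * r * D n.+1 + d%:R * s ^+ 2 * A n.+1 - 2 * t * r * A n.
have u1 : u @ \oo --> (1 : R).
  by rewrite (_ : u = cst 1); [exact: cvg_cst|exact/funext].
apply: (cvg_unique _ _ u1) => //.
rewrite mulrBl addrA.
apply: cvgB; last by apply: cvgM => //; exact: cvg_cst.
by apply: cvgD; apply: cvgM => //; exact: cvg_cst.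
Qed.

(** Derivatives up to [f4] are provided because the remainder of the second order expansion of [F]
    is controlled by [f3] on compacts, and [f4] makes [f3] continuous. The coefficients [b] are
    those of the primitive of [f1] vanishing at 0. *)
Lemma radial_solution : exists F f1 f2 f3 f4 : R -> R,
  [/\ forall r, is_derive r (1 : R) F (f1 r),
      forall r, is_derive r (1 : R) f1 (f2 r),
      forall r, is_derive r (1 : R) f2 (f3 r),
      forall r, is_derive r (1 : R) f3 (f4 r) &
      forall r, 2 * s ^+ 2 * r * f2 r + (d%:R * s ^+ 2 - 2 * t * r) * f1 r = 1].
Proof.
pose a := radial_coef.
pose b n := if n is m.+1 then a m / m.+1%:R else 0.
have ba := factorial_bounded_radial_coef.
have db : pseries_diffs b = a.
  by apply/funext => n; rewrite /pseries_diffs/= mulrC divfK.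
have bb : factorial_bounded b.
  have [C [M aM]] := ba.
  have C0 : 0 <= C.
    by have := le_trans (normr_ge0 _) (aM 0%N); rewrite expr0 fact0 divr1 mulr1.
  (* The index shift requires M^n to be bounded by the (n+1)-st power of the new base; taking that
     base at least 1 and at least |M| achieves this. *)
  exists C, (`|M| + 1); case=> [|n].
    by rewrite normr0 mulr_ge0// divr_ge0// exprn_ge0// addr_ge0.
  rewrite /b normrM normfV (@ger0_norm _ n.+1%:R)// ler_pdivrMr//.
  apply: (le_trans (aM n)); rewrite -mulrA ler_wpM2l// factS natrM invfM.
  rewrite exprS !mulrA mulrAC divfK// ler_wpM2r//.
  have h1 : M ^+ n <= (`|M| + 1) ^+ n.
    apply: (le_trans (ler_norm _)); rewrite normrX lerXn2r// ?nnegrE ?addr_ge0//.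
    by rewrite lerDl.
  apply: (le_trans h1); rewrite ler_peMl// ?lerDr// exprn_ge0// addr_ge0//.
pose p c r := limn (pseries c r) : R.
exists (p b), (p a), (p (pseries_diffs a)), (p (pseries_diffs (pseries_diffs a))),
  (p (pseries_diffs (pseries_diffs (pseries_diffs a)))); split=> r.
- by rewrite -db; exact: is_derive_pseries.
- exact: is_derive_pseries.
- by apply: is_derive_pseries; exact: factorial_bounded_diffs.
- by apply: is_derive_pseries; do 2 apply: factorial_bounded_diffs.
- exact: radial_equation.
Qed.

End radial_equation.

(** * Mean value and Taylor estimates *)

Section calculus.
Context {R : realType}.
Implicit Types (f g : R -> R) (a b r y : R).

Lemma is_derive_continuous f g :
  (forall x, is_derive x (1 : R) f (g x)) -> continuous f.
Proof.
by move=> fg x; apply: differentiable_continuous; apply/derivable1_diffP; case: (fg x).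
Qed.

Lemma integral_is_derive f g a b : a <= b ->
  (forall x, is_derive x (1 : R) f (g x)) -> continuous g ->
  (\int[lebesgue_measure]_(x in `[a, b]) (g x)%:E = (f b - f a)%:E)%E.
Proof.
move=> ab fg cg; have cf := is_derive_continuous _ _ fg.
move: ab; rewrite le_eqVlt => /predU1P[<-|ab].
  by rewrite set_itv1 integral_set1 subrr.
rewrite (@continuous_FTC2 _ g f)//.
- exact: continuous_subspaceT.
- split.
  + by move=> x _; case: (fg x).
  + by apply: cvg_at_right_filter; exact: cf.
  + by apply: cvg_at_left_filter; exact: cf.
- by move=> x _; rewrite derive1E; case: (fg x).
Qed.

Lemma is_derive_MVT f g a b : (forall x, is_derive x (1 : R) f (g x)) ->
  exists2 c, `|c - a| <= `|b - a| /\ (Num.min a b <= c <= Num.max a b) & f b - f a = g c * (b - a).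
Proof.
move=> fg; have cf := is_derive_continuous _ _ fg.
have [ab|/ltW ba] := leP a b.
  have [|c] := @MVT_segment _ f g a b ab (fun x _ => fg x).
    exact: continuous_subspaceT.
  rewrite in_itv/= => /andP[ac cb] E; exists c; last by [].
  by split; [rewrite !ger0_norm ?subr_ge0// lerD2r|exact/andP].
have [|c] := @MVT_segment _ f g b a ba (fun x _ => fg x).
  exact: continuous_subspaceT.
rewrite in_itv/= => /andP[bc ca] E; exists c.
  by split; [rewrite !ler0_norm ?subr_le0// lerN2 lerD2r|exact/andP].
by rewrite -opprB E -mulrN opprB.
Qed.

Lemma continuous_bounded f a b : continuous f ->
  exists2 M, 0 <= M & forall x, a <= x <= b -> `|f x| <= M.
Proof.
move=> cf; have [ab|ba] := leP a b; last first.
  by exists 0 => // x /andP[ax xb]; move: ba; rewrite ltNge (le_trans ax xb).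
have cnf : {within `[a, b], continuous (fun x => `|f x|)}.
  apply: continuous_subspaceT => x.
  by apply: continuous_comp; [exact: cf|exact: norm_continuous].
have [c _ fc] := EVT_max ab cnf.
by exists `|f c| => // x axb; apply: fc; rewrite in_itv.
Qed.

(** One integration step of Taylor's formula, on both sides of [r]: the intermediate point of the
    mean value theorem stays in [0, b] and is no farther from [r] than [y]. *)
Lemma is_derive_power_bound f g b M k r :
    (forall x, is_derive x (1 : R) f (g x)) -> f r = 0 -> 0 <= r <= b ->
    (forall y, 0 <= y <= b -> `|g y| <= M * `|y - r| ^+ k) -> 0 <= M ->
  forall y, 0 <= y <= b -> `|f y| <= M * `|y - r| ^+ k.+1.
Proof.
move=> fg fr0 /andP[r0 rb] gM M0 y /andP[y0 yb].
have [c [cr /andP[c1 c2]] E] := is_derive_MVT f g r y fg.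
rewrite -[f y]subr0 -fr0 E normrM exprSr mulrA ler_wpM2r//.
apply: (le_trans (gM c _)).
  apply/andP; split; first by apply: le_trans c1; rewrite le_min r0.
  by apply: (le_trans c2); rewrite ge_max rb.
by rewrite ler_wpM2l// lerXn2r// nnegrE.
Qed.

(** The remainders of [f2], [f1] and [f] at order 0, 1 and 2 are successive primitives vanishing at
    [r], so three uses of [is_derive_power_bound] raise the bound [M] on [f3] to a cubic one. *)
Lemma taylor2_bound f f1 f2 f3 f4 b :
    (forall x, is_derive x (1 : R) f (f1 x)) ->
    (forall x, is_derive x (1 : R) f1 (f2 x)) ->
    (forall x, is_derive x (1 : R) f2 (f3 x)) ->
    (forall x, is_derive x (1 : R) f3 (f4 x)) ->
  exists2 M, 0 <= M & forall r y, 0 <= r <= b -> 0 <= y <= b ->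
    `|f y - f r - f1 r * (y - r) - f2 r / 2 * (y - r) ^+ 2| <= M * `|y - r| ^+ 3.
Proof.
move=> d0 d1 d2 d3.
have [M M0 fM] := continuous_bounded f3 0 b (is_derive_continuous _ _ d3).
exists M => // r y rb yb.
have e2 : forall z, 0 <= z <= b -> `|f2 z - f2 r| <= M * `|z - r| ^+ 1.
  apply: (is_derive_power_bound (fun z => f2 z - f2 r) f3) => //.
  - by move=> z; have := d2 z => ?; apply: is_derive_eq; rewrite subr0.
  - by rewrite subrr.
  - by move=> z zb; rewrite expr0 mulr1 fM.
have e1 : forall z, 0 <= z <= b -> `|f1 z - f1 r - f2 r * (z - r)| <= M * `|z - r| ^+ 2.
  apply: (is_derive_power_bound (fun z => f1 z - f1 r - f2 r * (z - r)) (fun z => f2 z - f2 r)) => //.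
  - move=> z; have := d1 z => ?.
    by apply: is_derive_eq; rewrite /GRing.scale/=; ring.
  - by rewrite !subrr mulr0 subrr.
apply: (is_derive_power_bound (fun z => f z - f r - f1 r * (z - r) - f2 r / 2 * (z - r) ^+ 2)
   (fun z => f1 z - f1 r - f2 r * (z - r)) b) => //.
- move=> z; have := d0 z => ?.
  by apply: is_derive_eq; rewrite /GRing.scale/=; field.
- by rewrite !subrr expr0n/= !mulr0 !subrr.
Qed.

(* When the cap [b + 1] is active the increment is at least 1, so its cube
   absorbs every term. *)
Lemma capped_taylor2_bound f f1 f2 f3 f4 b :
    (forall x, is_derive x (1 : R) f (f1 x)) ->
    (forall x, is_derive x (1 : R) f1 (f2 x)) ->
    (forall x, is_derive x (1 : R) f2 (f3 x)) ->
    (forall x, is_derive x (1 : R) f3 (f4 x)) ->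
  exists2 M, 0 <= M & forall r u, 0 <= r <= b -> 0 <= r + u ->
    `|f (Num.min (r + u) (b + 1)) - f r - f1 r * u - f2 r / 2 * u ^+ 2| <= M * `|u| ^+ 3.
Proof.
move=> d0 d1 d2 d3.
have [M M0 fM] := taylor2_bound f f1 f2 f3 f4 (b + 1) d0 d1 d2 d3.
have [M1 M10 fM0] := continuous_bounded f 0 (b + 1) (is_derive_continuous _ _ d0).
have [M2 M20 fM1] := continuous_bounded f1 0 (b + 1) (is_derive_continuous _ _ d1).
have [M3 M30 fM2] := continuous_bounded f2 0 (b + 1) (is_derive_continuous _ _ d2).
exists (M + (M1 + M1 + M2 + M3)); first by rewrite !addr_ge0.
move=> r u /andP[r0 rb] ru0.
have rb1 : 0 <= r <= b + 1 by rewrite r0 (le_trans rb)// lerDl.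
have [ub|ub] := leP (r + u) (b + 1).
  have := fM r (r + u) rb1; rewrite ru0 ub => /(_ isT).
  rewrite (addrC r) addrK => /le_trans; apply.
  by rewrite ler_wpM2r ?exprn_ge0// lerDl !addr_ge0.
have u1 : 1 <= u by lra.
have u0 : 0 <= u by lra.
rewrite (ger0_norm u0).
have fb := fM0 (b + 1); rewrite lexx andbT (le_trans r0) in fb; last by lra.
have := fb isT; have := fM0 r rb1; have := fM1 r rb1; have := fM2 r rb1.
move=> h3 h2 h1 h0.
have u2 : u <= u ^+ 3 by rewrite -[leLHS]expr1 ler_weXn2l.
have u3 : u ^+ 2 <= u ^+ 3 by rewrite ler_weXn2l.
have u4 : 1 <= u ^+ 3 by rewrite -[leLHS](expr1n _ 3) lerXn2r// nnegrE.
apply: (le_trans (ler_normB _ _)).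
apply: (le_trans (lerD (ler_normB _ _) (lexx _))).
apply: (le_trans (lerD (lerD (ler_normB _ _) (lexx _)) (lexx _))).
rewrite (normrM (f1 r)) (normrM (f2 r / 2)) (normrM (f2 r)) normrX normfV (ger0_norm u0) (@ger0_norm _ 2)//.
have k1 : `|f (b + 1)| <= M1 * u ^+ 3 by apply: (le_trans h0); rewrite ler_peMr.
have k2 : `|f r| <= M1 * u ^+ 3 by apply: (le_trans h1); rewrite ler_peMr.
have k3 : `|f1 r| * u <= M2 * u ^+ 3 by exact: ler_pM.
have k4 : `|f2 r| / 2 * u ^+ 2 <= M3 * u ^+ 3.
  apply: ler_pM; rewrite ?divr_ge0 ?exprn_ge0//.
  by apply: le_trans h3; rewrite ler_pdivrMr// ler_peMr// ler1n.
have k5 : 0 <= M * u ^+ 3 by rewrite mulr_ge0// exprn_ge0.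
lra.
Qed.

End calculus.

(** * The integrals of the theorem in terms of [F] *)

Section radial_integral.
Context {R : realType} (d : nat) (s t : R) (F f1 f2 : R -> R).
Hypotheses (d_gt0 : (0 < d)%N) (s_gt0 : 0 < s).
Hypothesis dF : forall r, is_derive r (1 : R) F (f1 r).
Hypothesis df1 : forall r, is_derive r (1 : R) f1 (f2 r).
Hypothesis ode : forall r,
  2 * s ^+ 2 * r * f2 r + (d%:R * s ^+ 2 - 2 * t * r) * f1 r = 1.
Let l := t / s ^+ 2.

(** Multiplying the equation at y^2 by the integrating factor y^(d-1) e^(-l y^2) makes its left side
    the exact derivative of [q], and [q] vanishes at 0 because d > 0. *)
Lemma inner_radial_integral z : 0 <= z ->
  \int[lebesgue_measure]_(u in `[0, z]) (u ^+ (d - 1) * expR (- (l * u ^+ 2))) =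
  s ^+ 2 * (z ^+ d * expR (- (l * z ^+ 2)) * f1 (z ^+ 2)).
Proof.
move=> z0.
pose q y := s ^+ 2 * (y ^+ d * expR (- (l * y ^+ 2)) * f1 (y ^+ 2)).
have dq y : is_derive y (1 : R) q (y ^+ (d - 1) * expR (- (l * y ^+ 2))).
  have dy2 : is_derive y (1 : R) (fun y => y ^+ 2) (2 * y).
    by apply: is_derive_eq; rewrite /GRing.scale/=; ring.
  have dyd : is_derive y (1 : R) (fun y => y ^+ d) (d%:R * y ^+ (d - 1)).
    rewrite (_ : (fun y => _) = (id : R -> R) ^+ d); last by rewrite exprfctE.
    by apply: is_derive_eq; rewrite /GRing.scale/= subn1 ?mulr1.
  have dl : is_derive y (1 : R) (fun y => - (l * y ^+ 2)) (- (l * (2 * y))).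
    by apply: is_derive_eq; rewrite /GRing.scale/=; ring.
  have de := @is_derive1_comp _ expR _ _ _ _ (is_derive_expR _) dl.
  have df : is_derive y (1 : R) (f1 \o (fun y => y ^+ 2)) (f2 (y ^+ 2) * (2 * y)).
    by apply: is_derive1_comp; exact: df1.
  rewrite (_ : q = cst (s ^+ 2) * ((fun y => y ^+ d) *
    (expR \o (fun y => - (l * y ^+ 2))) * (f1 \o (fun y => y ^+ 2))))//.
  apply: is_derive_eq.
  rewrite /GRing.scale/= !mulr0 addr0 !fctE.
  have -> : y ^+ d = y * y ^+ (d - 1) by rewrite -exprS subn1 prednK.
  rewrite -[RHS]mulr1 -[X in _ = _ * X](ode (y ^+ 2)) /l.
  by field; rewrite gt_eqF.
have cg : continuous (fun u : R => u ^+ (d - 1) * expR (- (l * u ^+ 2))).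
  move=> y; apply: (@cvgM _ R) ; first exact: exprn_continuous.
  apply: continuous_comp; last exact: continuous_expR.
  apply: (@cvgN _ R); apply: cvgM; [exact: cvg_cst|exact: exprn_continuous].
rewrite /Rintegral (@integral_is_derive _ q _ _ _ z0 dq cg)/= /q.
by rewrite [in X in _ - X]expr0n gtn_eqF//= mul0r mul0r mulr0 subr0.
Qed.

Lemma radial_integrand z : 0 <= z ->
  z ^ (1 - d%:Z) * expR (l * z ^+ 2) *
    \int[lebesgue_measure]_(u in `[0, z]) (u ^+ (d - 1) * expR (- (l * u ^+ 2)))
  = s ^+ 2 * (z * f1 (z ^+ 2)).
Proof.
move=> z0; rewrite inner_radial_integral//.
have -> : 1 - d%:Z = - (d.-1)%:Z :> int by rewrite -{1}(prednK d_gt0) -addn1 PoszD opprD addrCA subrr addr0.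
rewrite -exprnN (_ : z ^+ d = z * z ^+ d.-1); last by rewrite -exprS prednK.
(* At 0 the power z^(1-d) is 1 if d = 1 and the default value 0 otherwise; either way both sides
   vanish, thanks to a factor z taken from the inner integral. *)
have [->|z_neq0] := eqVneq z 0; first by rewrite !(mul0r, mulr0).
rewrite expRN.
by field; rewrite gt_eqF ?expR_gt0// expf_neq0.
Qed.

(** The substitution r = z^2, carried out on the primitive F(z^2). The free constant [c] allows one
    lemma to serve both formulas of the theorem. *)
Lemma radial_integral c (g : R -> R) x L : 0 <= x -> x <= L ->
    (forall z, 0 <= z -> g z = c * (s ^+ 2 * (z * f1 (z ^+ 2)))) ->
  (\int[lebesgue_measure]_(z in `[x, L]) (g z)%:E =
   (c * s ^+ 2 / 2 * (F (L ^+ 2) - F (x ^+ 2)))%:E)%E.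
Proof.
move=> x0 xL gE.
have cf1 : continuous f1 by exact: is_derive_continuous df1.
pose G z := c * s ^+ 2 / 2 * F (z ^+ 2).
have dG y : is_derive y (1 : R) G (c * (s ^+ 2 * (y * f1 (y ^+ 2)))).
  have dy2 : is_derive y (1 : R) (fun y => y ^+ 2) (2 * y).
    by apply: is_derive_eq; rewrite /GRing.scale/=; ring.
  have df : is_derive y (1 : R) (F \o (fun y => y ^+ 2)) (f1 (y ^+ 2) * (2 * y)).
    by apply: is_derive1_comp; exact: dF.
  rewrite (_ : G = cst (c * s ^+ 2 / 2) * (F \o (fun y => y ^+ 2)))//.
  apply: is_derive_eq.
  by rewrite /GRing.scale/= !mulr0 addr0; field.
have cg : continuous (fun y : R => c * (s ^+ 2 * (y * f1 (y ^+ 2)))).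
  move=> y; apply: (@cvgM _ R); first exact: cvg_cst.
  apply: (@cvgM _ R); first exact: cvg_cst.
  apply: (@cvgM _ R); first exact: cvg_id.
  exact: (continuous_comp (@exprn_continuous _ 2 y) (cf1 _)).
transitivity (\int[lebesgue_measure]_(z in `[x, L]) (c * (s ^+ 2 * (z * f1 (z ^+ 2))))%:E)%E.
  apply: eq_integral => z; rewrite inE/= in_itv/= => /andP[xz zL].
  by rewrite gE// (le_trans x0).
by rewrite (@integral_is_derive _ G)// /G; congr EFin; ring.
Qed.

(* [y^(d/2) e^{-y} f1(y/l)] is, up to a constant, the primitive of the
   (possibly singular at 0) integrand that vanishes at 0. *)
Lemma lower_incomplete_gamma_radial (y : R) : 0 < l -> 0 < y ->
  lower_incomplete_gamma (d%:R / 2) y =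
  2 * s ^+ 2 * (y `^ (d%:R / 2) * (expR (- y) * f1 (y / l))).
Proof.
move=> l0 y0.
have cf1 : continuous f1 by exact: is_derive_continuous df1.
pose a : R := d%:R / 2.
have a0 : 0 < a by rewrite divr_gt0// ltr0n.
pose W u := 2 * s ^+ 2 * (u `^ a * (expR (- u) * f1 (u / l))).
pose g u := u `^ (a - 1) * expR (- u).
have dW (u : R) : 0 < u -> is_derive u (1 : R) W (g u).
  move=> u0.
  have d1 : is_derive u (1 : R) (@powR R ^~ a) (a * u `^ (a - 1)) by exact: is_derive1_powR.
  have d2 : is_derive u (1 : R) (expR \o -%R) (expR (- u) * (- 1)).
    by apply: is_derive1_comp; apply: is_derive_eq.
  have d3' : is_derive u (1 : R) (fun v => v / l) (l^-1).
    rewrite (_ : (fun v => v / l) = id * cst l^-1)//.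
    by apply: is_derive_eq; rewrite /GRing.scale/=; ring.
  have d3 : is_derive u (1 : R) (f1 \o (fun v => v / l)) (f2 (u / l) * l^-1).
    by apply: is_derive1_comp; exact: df1.
  rewrite (_ : W = cst (2 * s ^+ 2) * ((@powR R ^~ a) * ((expR \o -%R) * (f1 \o (fun v => v / l)))))//.
  apply: is_derive_eq; rewrite /GRing.scale/= !mulr0 addr0 !fctE /g /=.
  have -> : u `^ a = u * u `^ (a - 1).
    rewrite -{2}(powRr1 (ltW u0)) -powRD; first by rewrite addrC subrK.
    by rewrite (gt_eqF u0) implybT.
  rewrite -[RHS]mulr1 -[X in _ = _ * X](ode (u / l)) /a.
  have tl : t = l * s ^+ 2 by rewrite /l divfK// gt_eqF// exprn_gt0.
  by rewrite tl; field; rewrite gt_eqF.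
have cW (u : R) : 0 < u -> {for u, continuous W}.
  move=> u0; have /derivable1_diffP/differentiable_continuous//: derivable W u 1.
  by have [] := dW u u0.
have cg (u : R) : 0 < u -> {for u, continuous g}.
  move=> u0; apply: (@cvgM _ R).
    suff /derivable1_diffP/differentiable_continuous : derivable (@powR R ^~ (a - 1)) u 1 by [].
    by have [] := is_derive1_powR (a - 1) u0.
  by apply: continuous_comp; [exact: oppr_continuous|exact: continuous_expR].
have g0 (u : R) : 0 <= g u by rewrite mulr_ge0 ?powR_ge0 ?expR_ge0.
have mg : measurable_fun [set: R] (EFin \o g).
  apply/measurable_EFinP; apply: measurable_funM; first exact: measurable_powR.
  by apply: measurableT_comp => //; exact: measurableT_comp.
(* For d = 1 the integrand is singular at 0, so the fundamental theorem is applied on [v n, y] and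
   monotone convergence does the rest; n + 2 in the denominator keeps v n strictly below y. *)
pose v n : R := y / n.+2%:R.
have v0 n : 0 < v n by rewrite divr_gt0.
have vy n : v n < y by rewrite ltr_pdivrMr// ltr_pMr// ltr1n.
have ftc n : (\int[lebesgue_measure]_(x in `[v n, y]) (g x)%:E = (W y - W (v n))%:E)%E.
  rewrite (@continuous_FTC2 _ g W)//.
  - apply/continuous_in_subspaceT => u; rewrite inE/= in_itv/= => /andP[vu _].
    by apply: cg; exact: lt_le_trans vu.
  - split.
    + move=> u; rewrite in_itv/= => /andP[vu _].
      by have [] := dW u (lt_trans (v0 n) vu).
    + by apply: cvg_at_right_filter; exact: cW.
    + by apply: cvg_at_left_filter; exact: cW.
  - move=> u; rewrite in_itv/= => /andP[vu _].
    by rewrite derive1E; have [] := dW u (lt_trans (v0 n) vu).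
have W0 : (W \o v) n @[n --> \oo] --> (0 : R).
  have WR : W u @[u --> 0^'+] --> (0 : R).
    rewrite -[X in _ --> X](mulr0 (2 * s ^+ 2)); apply: (@cvgM _ R); first exact: cvg_cst.
    rewrite -[X in _ --> X](mul0r (expR (- 0) * f1 (0 / l))); apply: (@cvgM _ R).
      exact: powR_cvg0.
    apply: cvg_at_right_filter; apply: (@cvgM _ R).
      apply: continuous_comp; [exact: oppr_continuous|exact: continuous_expR].
    have cl : {for 0, continuous (fun u : R => u / l)}.
      by apply: (@cvgM _ R); [exact: cvg_id|exact: cvg_cst].
    exact: (continuous_comp cl (cf1 _)).
  apply: ((cvg_at_rightP _ _ _).1 WR); split => //.
  have harmonicS : (n.+2%:R^-1 : R) @[n --> \oo] --> (0 : R).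
    by have := @cvg_harmonic R; rewrite -cvg_shiftS.
  by rewrite -[X in _ --> X](scaler0 _ y); exact: (cvgZl_tmp harmonicS).
have lim1 : ((W y - W (v n))%:E @[n --> \oo] --> (W y)%:E)%E.
  apply: cvg_EFin; first exact: nearW.
  rewrite -[X in _ --> X](subr0 (W y)); apply: (@cvgB _ R) => //; exact: cvg_cst.
have nd : nondecreasing_seq (fun n => `[v n, y]%classic : set R).
  move=> m n mn; apply/subsetPset => u /=; rewrite !in_itv/= => /andP[vu ->].
  by rewrite (le_trans _ vu)// ler_pM2l// lef_pV2 ?posrE// ler_nat ltnS.
have U : \bigcup_n `[v n, y]%classic = `]0, y]%classic.
  apply/seteqP; split=> [u [n _]|u] /=; rewrite !in_itv/= => /andP[h uy].
    by rewrite (lt_le_trans (v0 n)).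
  exists (Num.truncn (y / u)) => //=; rewrite in_itv/= uy andbT.
  rewrite ler_pdivrMr// mulrC -ler_pdivrMr//.
  by apply: (le_trans (ltW (truncnS_gt _))); rewrite ler_nat.
have lim2 : (\int[lebesgue_measure]_(x in `[v n, y]) (g x)%:E @[n --> \oo] -->
    \int[lebesgue_measure]_(x in \bigcup_n `[v n, y]%classic) (g x)%:E)%E.
  apply: ge0_nondecreasing_set_cvg_integral => // [n|n u _].
    exact: measurable_funTS.
  by rewrite lee_fin.
have E : (\int[lebesgue_measure]_(x in `]0%R, y]) (g x)%:E = (W y)%:E)%E.
  by rewrite -U; apply: (cvg_unique _ lim2) => //; move: lim1; rewrite -(funext ftc).
rewrite /lower_incomplete_gamma /Rintegral -[RHS]/(fine (W y)%:E) -E; congr fine.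
apply/esym/integral_itv_obnd_cbnd.
by apply: measurable_funTS.
Qed.

(** No change of variables is made under the integral: both integrals are already known in terms of
    [f1] at the same point z^2 = (l z^2) / l. *)
Lemma lower_incomplete_gamma_integral (z : R) : 0 < l -> 0 <= z ->
  lower_incomplete_gamma (d%:R / 2) (l * z ^+ 2) =
  2 * l `^ (d%:R / 2) *
    \int[lebesgue_measure]_(u in `[0, z]) (u ^+ (d - 1) * expR (- (l * u ^+ 2))).
Proof.
move=> l0; rewrite le_eqVlt => /predU1P[<-|z0].
  rewrite expr0n/= mulr0 /lower_incomplete_gamma !set_itv1.
  by rewrite /Rintegral !integral_set1/= mulr0.
rewrite lower_incomplete_gamma_radial//; last by rewrite mulr_gt0// exprn_gt0.
rewrite inner_radial_integral ?ltW//.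
rewrite powRM ?ltW ?exprn_gt0// -{1}(powR_mulrn 2 (ltW z0)) -powRrM.
rewrite (_ : 2%:R * (d%:R / 2) = d%:R :> R); last by field.
rewrite powR_mulrn ?ltW//.
by rewrite (_ : l * z ^+ 2 / l = z ^+ 2); [ring|field; rewrite gt_eqF].
Qed.

End radial_integral.

(** * Independence, Gaussian moments and Brownian increments *)

Section real_integrable.
Context {disp : measure_display} {T : measurableType disp} {R : realType}.
Variable mu : {measure set T -> \bar R}.
Implicit Types f g : T -> R.
Local Notation integrableR f := (mu.-integrable [set: T] (EFin \o f)).

Lemma integrable_addR f g : integrableR f -> integrableR g ->
  integrableR (fun x => f x + g x).
Proof.
by move=> fi gi; rewrite (_ : _ \o _ = (EFin \o f) \+ (EFin \o g))%E//; exact: integrableD.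
Qed.

Lemma integrable_subR f g : integrableR f -> integrableR g ->
  integrableR (fun x => f x - g x).
Proof.
by move=> fi gi; rewrite (_ : _ \o _ = (EFin \o f) \- (EFin \o g))%E//; exact: integrableB.
Qed.

Lemma integrable_mulR (c : R) f : integrableR f -> integrableR (fun x => c * f x).
Proof.
move=> fi; rewrite (_ : _ \o _ = (fun x => c%:E * (EFin \o f) x)%E)//.
exact: integrableZl.
Qed.

Lemma integrable_sumR (I : Type) (r : seq I) (Q : pred I) (F : I -> T -> R) :
  (forall i, Q i -> integrableR (F i)) ->
  integrableR (fun x => \sum_(i <- r | Q i) F i x).
Proof.
move=> Fi; elim: r => [|i r IH].
  rewrite (_ : (fun _ => _) = cst 0); last by apply/funext => x; rewrite big_nil.
  exact: integrable0.
case: (boolP (Q i)) => Qi.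
  rewrite (_ : (fun _ => _) = (fun x => F i x + \sum_(j <- r | Q j) F j x)).
    by apply: integrable_addR => //; exact: Fi.
  by apply/funext => x; rewrite big_cons Qi.
rewrite (_ : (fun _ => _) = (fun x => \sum_(j <- r | Q j) F j x))//.
by apply/funext => x; rewrite big_cons (negbTE Qi).
Qed.

Lemma Rintegral_sum (I : Type) (r : seq I) (Q : pred I) (F : I -> T -> R) :
  (forall i, Q i -> integrableR (F i)) ->
  \int[mu]_x (\sum_(i <- r | Q i) F i x) = \sum_(i <- r | Q i) \int[mu]_x F i x.
Proof.
move=> Fi; elim: r => [|i r IH].
  rewrite big_nil -[RHS](mul0r (fine (mu setT))) -[RHS]Rintegral_cst//.
  by apply: eq_Rintegral => x _; rewrite big_nil.
rewrite big_cons; case: ifPn => Qi; last first.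
  by rewrite -IH; apply: eq_Rintegral => x _; rewrite big_cons (negbTE Qi).
rewrite -IH -RintegralD//; [|exact: Fi|exact: integrable_sumR].
by apply: eq_Rintegral => x _; rewrite big_cons Qi.
Qed.

Lemma le_integrableR f g : measurable_fun [set: T] f ->
  (forall x, `|f x| <= g x) -> integrableR g -> integrableR f.
Proof.
move=> mf fg gi; apply: le_integrable gi => //; first exact/measurable_EFinP.
by move=> x _ /=; rewrite lee_fin (le_trans (fg x))// ler_norm.
Qed.

End real_integrable.

Lemma bounded_integrableR {disp : measure_display} {T : measurableType disp}
    {R : realType} (P : probability T R) (f : T -> R) (M : R) :
  measurable_fun [set: T] f -> (forall x, `|f x| <= M) ->
  P.-integrable [set: T] (EFin \o f).
Proof.
move=> mf fM; apply: measurable_bounded_integrable => //.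
  by rewrite ltey_eq fin_num_measure.
by exists M; split; [exact: num_real|move=> x Mx w _ /=; rewrite (le_trans (fM w))// ltW].
Qed.

Section independence.
Context {disp : measure_display} {T : measurableType disp} {R : realType}.
Variable P : probability T R.
Implicit Types (Y Z : T -> R).

Definition independent_rv Y Z :=
  forall A C, measurable A -> measurable C ->
  P (Y @^-1` A `&` Z @^-1` C) = (P (Y @^-1` A) * P (Z @^-1` C))%E.

(** By uniqueness of a measure with given values on rectangles, the law of (Y, Z) is the product of
    the two laws; Fubini's theorem then separates the factors. *)
Lemma Rintegral_indep_mul Y Z :
    measurable_fun [set: T] Y -> measurable_fun [set: T] Z ->
    independent_rv Y Z -> P.-integrable [set: T] (EFin \o Y) ->
    P.-integrable [set: T] (EFin \o Z) ->
    P.-integrable [set: T] (EFin \o (fun w => Y w * Z w)) ->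
  \int[P]_w (Y w * Z w) = \int[P]_w Y w * \int[P]_w Z w.
Proof.
move=> mY mZ YZ iY iZ iYZ.
pose Y' := mfun_Sub (mem_set mY) : {mfun T >-> R}.
pose Z' := mfun_Sub (mem_set mZ) : {mfun T >-> R}.
pose U w := (Y w, Z w).
have mU : measurable_fun [set: T] U by exact/measurable_fun_pairP.
pose U' := mfun_Sub (mem_set mU) : {mfun T >-> (R * R)%type}.
pose f (p : R * R) := p.1 * p.2.
have mf : measurable_fun [set: R * R] (EFin \o f).
  by apply/measurable_EFinP; apply: measurable_funM.
have prodE : forall X, measurable X ->
    (distribution P Y' \x distribution P Z')%E X = distribution P U' X.
  apply: product_measure_unique => A C mA mC.
  rewrite /distribution /pushforward -[RHS]YZ//.
have eq1 : (\int[P]_w (Y w * Z w)%:E = \int[distribution P Y' \x distribution P Z']_p (f p)%:E)%E.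
  transitivity (\int[distribution P U']_p (EFin \o f) p)%E.
    by rewrite integral_distribution.
  by apply: eq_measure_integral => X mX _; exact: (esym (prodE X mX)).
have ifp : (distribution P Y' \x distribution P Z')%E.-integrable [set: R * R] (EFin \o f).
  have iU : (distribution P U').-integrable [set: R * R] (EFin \o f).
    exact: (@integrable_pushforward _ _ _ _ _ U mU P setT _ mf iYZ measurableT).
  move/integrableP : iU => [_ iU]; apply/integrableP; split=> //.
  apply: le_lt_trans iU; rewrite le_eqVlt; apply/orP; left; apply/eqP.
  by apply: eq_measure_integral => X mX _; exact: prodE.
have mid : measurable_fun [set: R] (EFin \o id) by exact/measurable_EFinP.
have iZd : (distribution P Z').-integrable [set: R] (EFin \o id).
  exact: (@integrable_pushforward _ _ _ _ _ Z mZ P setT _ mid iZ measurableT).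
have iYd : (distribution P Y').-integrable [set: R] (EFin \o id).
  exact: (@integrable_pushforward _ _ _ _ _ Y mY P setT _ mid iY measurableT).
have EZ : (\int[distribution P Z']_z z%:E = \int[P]_w (Z w)%:E)%E.
  by rewrite -(integral_distribution (X := Z') mid iZ).
have EY : (\int[distribution P Y']_z z%:E = \int[P]_w (Y w)%:E)%E.
  by rewrite -(integral_distribution (X := Y') mid iY).
have FE y : fubini_F (distribution P Z') (EFin \o f) y =
    (y%:E * (\int[P]_w Z w)%:E)%E.
  transitivity (\int[distribution P Z']_z (y%:E * z%:E))%E; first exact: eq_integral.
  by rewrite integralZl// EZ [in RHS]/Rintegral fineK//; exact: integrable_fin_num.
rewrite [LHS]/Rintegral eq1 -integral12_prod_meas1//.
transitivity (fine (\int[distribution P Y']_y (y%:E * (\int[P]_w Z w)%:E)))%E.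
  by congr fine; apply: eq_integral => y _; exact: FE.
by rewrite integralZr// EY fineM//; exact: integrable_fin_num.
Qed.

(** To be used with [F1] the initial value, [H] the whole Brownian path, [F2] its past and [G] an
    increment. On intersections of [A1] in [F1] and [A2] in [F2], which form a pi-system, P(A1 A2 C)
    = P(A1) P(A2 C) = P(A1) P(A2) P(C), as A2 C lies in [H]; Dynkin's theorem extends this to the
    join. *)
Lemma independent_systems_join (F1 F2 G H : set (set T)) :
    sigma_algebra [set: T] F1 -> sigma_algebra [set: T] F2 ->
    F1 `<=` measurable -> H `<=` measurable -> setI_closed H ->
    F2 `<=` H -> G `<=` H ->
    independent_systems P F1 H -> independent_systems P F2 G ->
  independent_systems P <<s F1 `|` F2 >> G.
Proof.
move=> s1 s2 m1 mH IH F2H GH i1 i2.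
pose I := [set A | exists A1 A2, [/\ F1 A1, F2 A2 & A = A1 `&` A2]].
have F1T : F1 setT by case: s1 => F10 F1C _; rewrite -(setD0 setT); exact: F1C.
have F2T : F2 setT by case: s2 => F20 F2C _; rewrite -(setD0 setT); exact: F2C.
have subI : <<s F1 `|` F2 >> `<=` <<s I >>.
  apply: smallest_sub; first exact: smallest_sigma_algebra.
  move=> A [FA|FA]; apply: sub_sigma_algebra.
    by exists A, setT; rewrite setIT.
  by exists setT, A; rewrite setTI.
move=> A C /subI sA GC; move: A sA.
pose K := [set A | measurable A /\ P (A `&` C) = (P A * P C)%E].
have mC : measurable C by apply: mH; apply: GH.
suff: <<s I >> `<=` K by move=> IK A /IK [].
rewrite -setI_closed_g_dynkin_g_sigma_algebra.
- apply: smallest_sub.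
    split.
    + by split => //; rewrite setTI probability_setT mul1e.
    + move=> A [mA AC]; split; first exact: measurableC.
      rewrite probability_setC// setIC -setDE measureD//; last first.
        by rewrite ltey_eq fin_num_measure.
      rewrite (setIC C A) [X in (_ - X)%E](_ : _ = (P A * P C)%E)//.
      by rewrite muleBl ?mul1e//; exact: fin_num_measure.
    + move=> A tA KA; have mA n : measurable (A n) by have [] := KA n.
      split; first exact: bigcupT_measurable.
      rewrite setI_bigcupl measure_bigcup//; last 2 first.
        by move=> n _; exact: measurableI.
        exact: trivIset_setIr.
      rewrite measure_bigcup//.
      rewrite muleC -[P C]fineK ?fin_num_measure// -nneseriesZl//.
      apply: eq_eseriesr => n _; apply: etrans (KA n).2 _.
      by rewrite fineK ?fin_num_measure// muleC.
  move=> _ [A1 [A2 [F1A F2A ->]]]; split.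
    by apply: measurableI; [exact: m1|apply: mH; apply: F2H].
  rewrite -setIA (i1 A1 (A2 `&` C))//; last by apply: IH; [exact: F2H|exact: GH].
  by rewrite i2// muleA (i1 A1 A2)//; exact: F2H.
- move=> _ _ [A1 [A2 [FA1 FA2 ->]]] [B1 [B2 [FB1 FB2 ->]]].
  exists (A1 `&` B1), (A2 `&` B2); split; last by rewrite setIACA.
    by have := @measurableI _ (g_sigma_algebraType F1) A1 B1;
      rewrite /measurable/= !sigma_algebra_id//; exact.
  by have := @measurableI _ (g_sigma_algebraType F2) A2 B2;
    rewrite /measurable/= !sigma_algebra_id//; exact.
Qed.

End independence.

(** * Moments of the centered Gaussian law *)

Section normal_moments.
Context {R : realType}.
Local Notation mu := (@lebesgue_measure R).
Implicit Types (s x : R) (f g G : R -> R).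

(** The change of variables goes through the abstract Radon-Nikodym derivative [q], which agrees
    almost everywhere with the Gaussian density since both have the same integral over every
    measurable set. *)
Lemma ge0_integral_normal_prob s f : measurable_fun [set: R] f ->
  (forall x, 0 <= f x) ->
  (\int[normal_prob 0 s]_x (f x)%:E = \int[mu]_x (f x * normal_pdf 0 s x)%:E)%E.
Proof.
move=> mf f0.
have dom := normal_prob_dominates 0 s.
rewrite -(Radon_Nikodym_SigmaFinite.change_of_variables dom)//; last exact/measurable_EFinP.
set q := Radon_Nikodym_SigmaFinite.f _ _.
have iq : mu.-integrable [set: R] q by exact: Radon_Nikodym_SigmaFinite.f_integrable.
have qp : ae_eq mu [set: R] q (EFin \o normal_pdf 0 s).
  apply: integral_ae_eq => //.
    by apply/measurable_EFinP; exact: measurable_normal_pdf.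
  by move=> E _ mE; rewrite -Radon_Nikodym_SigmaFinite.f_integral.
apply: ae_eq_integral => //.
- by apply: emeasurable_funM; [exact/measurable_EFinP|exact: measurable_int iq].
- apply/measurable_EFinP; apply: measurable_funM => //.
  exact: measurable_normal_pdf.
- by apply: filterS qp => x /= qx _; rewrite EFinM qx.
Qed.

(** Reduction to the nonnegative case through f = (f + |f|) - |f|. *)
Lemma Rintegral_normal_prob s f : measurable_fun [set: R] f ->
  (normal_prob 0 s).-integrable [set: R] (EFin \o f) ->
  mu.-integrable [set: R] (EFin \o (fun x => f x * normal_pdf 0 s x)) /\
  \int[normal_prob 0 s]_x f x = \int[mu]_x (f x * normal_pdf 0 s x).
Proof.
move=> mf if_.
pose p := normal_pdf 0 s.
have p0 x : 0 <= p x by exact: normal_pdf_ge0.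
have mp : measurable_fun [set: R] p by exact: measurable_normal_pdf.
have mnf : measurable_fun [set: R] (fun x => `|f x|) by exact: measurableT_comp.
have infp : mu.-integrable [set: R] (EFin \o (fun x => `|f x| * p x)).
  apply/integrableP; split; first by apply/measurable_EFinP; exact: measurable_funM.
  under eq_integral do rewrite /= ger0_norm ?mulr_ge0//.
  rewrite -ge0_integral_normal_prob//.
  by move/integrableP : if_ => [_].
have ifp : mu.-integrable [set: R] (EFin \o (fun x => f x * p x)).
  apply: le_integrable infp => //.
    by apply/measurable_EFinP; exact: measurable_funM.
  by move=> x _ /=; rewrite lee_fin !normrM normr_id.
split=> //.
have inf : (normal_prob 0 s).-integrable [set: R] (EFin \o (fun x => `|f x|)).
  exact: (integrable_norm if_).
have isum : (normal_prob 0 s).-integrable [set: R] (EFin \o (fun x => f x + `|f x|)).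
  exact: integrable_addR.
have E1 : \int[normal_prob 0 s]_x `|f x| = \int[mu]_x (`|f x| * p x).
  by rewrite /Rintegral ge0_integral_normal_prob.
have E2 : \int[normal_prob 0 s]_x (f x + `|f x|) = \int[mu]_x ((f x + `|f x|) * p x).
  rewrite /Rintegral ge0_integral_normal_prob//.
    exact: measurable_funD.
  by move=> x; rewrite -lerBlDr sub0r lerNl -normrN ler_norm.
rewrite -[LHS](addrK (\int[normal_prob 0 s]_x `|f x|)) -RintegralD// E2 E1.
rewrite -RintegralB//; last first.
  rewrite (_ : (fun _ => _) = (fun x => f x * p x + `|f x| * p x)).
    exact: integrable_addR.
  by apply/funext => x /=; rewrite mulrDl.
by apply: eq_Rintegral => x _; rewrite mulrDl addrK.
Qed.

Lemma normal_pdf0E s x : 0 < s ->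
  normal_pdf 0 s x = normal_peak s * expR (- (x ^+ 2 / (s ^+ 2 * 2))).
Proof.
by move=> s0; rewrite normal_pdfE ?gt_eqF// /normal_fun subr0 mulr_natr mulNr.
Qed.

(** A power times a Gaussian density is dominated by a density of twice the deviation. With y = x^2
    / (8 s^2) the exponents are 4y and y, and y^(k+1) <= (k+1)! e^y leaves room to spare. The factor
    8^(k+1) comes from y, the factor 2 from the ratio of the peaks. Integrating gives even moments
    of the right order in [s] without computing them. *)
Lemma expr_normal_pdf_le s x k : 0 < s ->
  x ^+ (2 * k.+1) * normal_pdf 0 s x <=
  8 ^+ k.+1 * k.+1`!%:R * 2 * s ^+ (2 * k.+1) * normal_pdf 0 (2 * s) x.
Proof.
move=> s0; have s20 : 0 < 2 * s by rewrite mulr_gt0.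
rewrite !normal_pdf0E//.
pose y := x ^+ 2 / (8 * s ^+ 2).
have s2 : 0 < s ^+ 2 by rewrite exprn_gt0.
have y0 : 0 <= y by rewrite divr_ge0 ?sqr_ge0// mulr_ge0// ltW.
have -> : x ^+ 2 / (s ^+ 2 * 2) = 4 * y by rewrite /y; field; rewrite gt_eqF.
have -> : x ^+ 2 / ((2 * s) ^+ 2 * 2) = y by rewrite /y; field; rewrite gt_eqF.
have -> : normal_peak (2 * s) = normal_peak s / 2.
  rewrite /normal_peak -invfM; congr (_^-1).
  rewrite exprMn -mulrnAr -mulrA -[_ *+ 2]mulr_natl sqrtrM ?exprn_ge0//.
  rewrite sqrtr_sqr ger0_norm// mulrC; congr (Num.sqrt _ * _).
  by rewrite -mulr_natr; ring.
have -> : x ^+ (2 * k.+1) = (8 * s ^+ 2) ^+ k.+1 * y ^+ k.+1.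
  by rewrite -exprMn mulrC divfK ?exprM// gt_eqF// mulr_gt0.
have h : y ^+ k.+1 * expR (- (4 * y)) <= k.+1`!%:R * expR (- y).
  have h1 := expR_ge1Dxn k y0.
  have f0 : 0 < k.+1`!%:R :> R by rewrite ltr0n fact_gt0.
  have h2 : y ^+ k.+1 <= k.+1`!%:R * expR y.
    rewrite mulrC -ler_pdivrMr//; lra.
  apply: (le_trans (ler_wpM2r (expR_ge0 _) h2)).
  rewrite -mulrA -expRD ler_pM2l// ler_expR; lra.
rewrite exprMn -exprM.
have -> : 8 ^+ k.+1 * s ^+ (2 * k.+1) * y ^+ k.+1 * (normal_peak s * expR (- (4 * y)))
  = 8 ^+ k.+1 * s ^+ (2 * k.+1) * normal_peak s * (y ^+ k.+1 * expR (- (4 * y))) by ring.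
have -> : 8 ^+ k.+1 * k.+1`!%:R * 2 * s ^+ (2 * k.+1) * (normal_peak s / 2 * expR (- y))
  = 8 ^+ k.+1 * s ^+ (2 * k.+1) * normal_peak s * (k.+1`!%:R * expR (- y)) by field.
have sE : 0 <= s ^+ (2 * k.+1) by rewrite exprn_ge0// ltW.
rewrite ler_wpM2l// mulr_ge0 ?normal_peak_ge0// mulr_ge0// exprn_ge0//.
Qed.

Lemma normal_even_moment_le s k : 0 < s ->
  (\int[normal_prob 0 s]_x (x ^+ (2 * k.+1))%:E <=
   (8 ^+ k.+1 * k.+1`!%:R * 2 * s ^+ (2 * k.+1))%:E)%E.
Proof.
move=> s0.
have ev x : 0 <= x ^+ (2 * k.+1) :> R by rewrite exprM exprn_ge0// sqr_ge0.
rewrite ge0_integral_normal_prob//.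
set C := 8 ^+ _ * _ * _ * _.
have C0 : 0 <= C by rewrite /C !mulr_ge0// exprn_ge0// ltW.
rewrite -[leRHS]mule1 -(integral_normal_pdf 0 (2 * s)) -ge0_integralZl//=; first last.
- by move=> x _; rewrite lee_fin normal_pdf_ge0.
- by apply/measurable_EFinP; exact: measurable_normal_pdf.
apply: ge0_le_integral => //.
- by move=> x _; rewrite lee_fin mulr_ge0// normal_pdf_ge0.
- apply/measurable_EFinP; apply: measurable_funM; last exact: measurable_normal_pdf.
  by [].
- by apply/measurable_EFinP; apply: measurable_funM => //; exact: measurable_normal_pdf.
- by move=> x _; rewrite lee_fin; exact: expr_normal_pdf_le.
Qed.

Lemma integrable_normal_even s k : 0 < s ->
  (normal_prob 0 s).-integrable [set: R] (fun x => (x ^+ (2 * k.+1))%:E).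
Proof.
move=> s0; apply/integrableP; split; first by exact/measurable_EFinP.
have ev x : 0 <= x ^+ (2 * k.+1) :> R by rewrite exprM exprn_ge0// sqr_ge0.
rewrite [ltLHS](_ : _ = \int[normal_prob 0 s]_x (x ^+ (2 * k.+1))%:E)%E; last first.
  by apply: eq_integral => x _; rewrite gee0_abs// lee_fin.
exact: le_lt_trans (normal_even_moment_le s k s0) (ltry _).
Qed.

(* The mean and variance of the Gaussian come from primitives vanishing at infinity. *)
Lemma Rintegral_primitive0 G g : (forall x, is_derive x (1 : R) G (g x)) ->
  continuous g -> mu.-integrable [set: R] (EFin \o g) ->
  (fun n => G n%:R - G (- n%:R)) @ \oo --> (0 : R) ->
  \int[mu]_x g x = 0.
Proof.
move=> Gg cg ig G0.
have mg : measurable_fun [set: R] (EFin \o g) by exact: measurable_int ig.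
pose g_ n := (EFin \o g) \_ `[(- n%:R : R), n%:R].
have mg_ n : measurable_fun [set: R] (g_ n).
  by apply/(measurable_restrictT _ _).1 => //; exact: measurable_funTS.
have g_g : {ae mu, forall x, [set: R] x -> g_ ^~ x @ \oo --> (EFin \o g) x}.
  apply: aeW => x _ /=; apply: cvg_near_cst.
  have [m xm] : exists m : nat, `|x| <= m%:R.
    by exists (Num.truncn `|x|).+1; exact/ltW/truncnS_gt.
  near=> n; rewrite /g_ patchE ifT// inE/= in_itv/= -ler_norml.
  by rewrite (le_trans xm)// ler_nat; near: n; exact: nbhs_infty_ge.
have ag_ : {ae mu, forall x n, [set: R] x -> (`|g_ n x| <= (abse \o (EFin \o g)) x)%E}.
  apply: aeW => x n _ /=; rewrite /g_ patchE; case: ifP => //.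
  by rewrite abse0 lee_fin.
have [_ _ gc] := @dominated_convergence _ _ R mu [set: R] measurableT g_
  (EFin \o g) (abse \o (EFin \o g)) mg_ mg g_g (integrable_abse ig) ag_.
have E n : (\int[mu]_(x in [set: R]) g_ n x = (G n%:R - G (- n%:R))%:E)%E.
  rewrite -integral_mkcond (@integral_is_derive _ G)//.
  by rewrite -subr_ge0 opprK addr_ge0.
have gc2 : (fun n => (G n%:R - G (- n%:R))%:E) @ \oo --> (\int[mu]_x (g x)%:E)%E.
  by under eq_fun do rewrite -E.
have gc3 : (fun n => (G n%:R - G (- n%:R))%:E) @ \oo --> (0%:E : \bar R).
  by apply: cvg_EFin; [exact: nearW|].
by rewrite /Rintegral (cvg_unique _ gc2 gc3).
Unshelve. all: by end_near. Qed.

Lemma is_derive_normal_pdf s x : 0 < s ->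
  is_derive x (1 : R) (normal_pdf 0 s) (- (x / s ^+ 2) * normal_pdf 0 s x).
Proof.
move=> s0.
pose e (y : R) := - (y ^+ 2 / (s ^+ 2 * 2)).
have de : is_derive x (1 : R) e (- (x / s ^+ 2)).
  rewrite (_ : e = cst (- (s ^+ 2 * 2)^-1) * (fun y => y ^+ 2)); last first.
    by apply/funext => y; rewrite /e !fctE mulNr mulrC.
  by apply: is_derive_eq; rewrite /GRing.scale/=; field; rewrite gt_eqF.
have dE : is_derive x (1 : R) (expR \o e) (expR (e x) * - (x / s ^+ 2)).
  by apply: is_derive1_comp.
rewrite (_ : normal_pdf 0 s = cst (normal_peak s) * (expR \o e)); last first.
  by apply/funext => y; rewrite normal_pdf0E.
by apply: is_derive_eq; rewrite /GRing.scale/= !fctE; ring.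
Qed.

(** The boundary term of the variance. By [expr_normal_pdf_le] with k = 0, n^2 times the density at
    n is bounded. *)
Lemma cvg_nat_normal_pdf s : 0 < s ->
  (fun n : nat => n%:R * normal_pdf 0 s n%:R) @ \oo --> (0 : R).
Proof.
move=> s0; pose C := 8 ^+ 1 * 1`!%:R * 2 * s ^+ (2 * 1) * normal_peak (2 * s).
have C0 : 0 <= C by rewrite /C !mulr_ge0// ?exprn_ge0 ?normal_peak_ge0// ltW.
have h n : n.+1%:R * normal_pdf 0 s n.+1%:R <= C / n.+1%:R.
  rewrite ler_pdivlMr// mulrAC -expr2.
  apply: (le_trans (expr_normal_pdf_le s n.+1%:R 0 s0)).
  rewrite /C ler_wpM2l ?normal_pdf_ub//; first by rewrite !mulr_ge0// ltW.
  by rewrite mulf_neq0// gt_eqF.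
rewrite -cvg_shiftS.
apply: (@squeeze_cvgr _ _ _ _ (fun=> 0) (fun n => C / n.+1%:R)).
- by near=> n; rewrite h mulr_ge0// normal_pdf_ge0.
- exact: cvg_cst.
- rewrite -[X in _ --> X](mulr0 C); apply: cvgM; first exact: cvg_cst.
  exact: cvg_harmonic.
Unshelve. all: by end_near. Qed.

Lemma integrable_normal_id s : 0 < s ->
  (normal_prob 0 s).-integrable [set: R] (EFin \o (@id R)).
Proof.
move=> s0.
have i2 : (normal_prob 0 s).-integrable [set: R] (fun x => (1 + x ^+ (2 * 1))%:E).
  rewrite (_ : (fun _ => _) = ((fun=> 1%:E) \+ (fun x => (x ^+ (2 * 1))%:E))%E)//.
  apply: integrableD => //; last exact: (integrable_normal_even s 0).
  by apply: finite_measure_integrable_cst.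
apply: le_integrable i2 => //; first exact/measurable_EFinP.
move=> x _ /=; rewrite lee_fin [leRHS]ger0_norm; last by rewrite addr_ge0// sqr_ge0.
rewrite -[x ^+ 2]real_normK ?num_real//.
have : 0 <= (`|x| - 1) ^+ 2 by rewrite sqr_ge0.
have := normr_ge0 x; nra.
Qed.

Lemma normal_mean s : 0 < s -> \int[normal_prob 0 s]_x x = 0.
Proof.
move=> s0; have [] := Rintegral_normal_prob s (@id R) _ (integrable_normal_id s s0).
  by [].
move=> ip ->; apply: (Rintegral_primitive0 (fun x => - s ^+ 2 * normal_pdf 0 s x)).
- move=> x; have dp := is_derive_normal_pdf s x s0.
  suff : is_derive x (1 : R) (cst (- s ^+ 2) * normal_pdf 0 s) (x * normal_pdf 0 s x) by [].
  apply: (is_derive_eq (is_deriveM (is_derive_cst (- s ^+ 2) x 1) dp)).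
  by rewrite /GRing.scale/= ?fctE; field; rewrite gt_eqF.
- move=> x; apply: cvgM; first exact: cvg_id.
  by apply: continuous_normal_pdf; rewrite gt_eqF.
- exact: ip.
- rewrite (_ : (fun _ => _) = cst 0); first exact: cvg_cst.
  by apply/funext => n; rewrite !normal_pdf0E// sqrrN subrr.
Qed.

(** With p the density, (x^2 - s^2) p is the derivative of - s^2 x p, so its integral is 0. *)
Lemma normal_variance s : 0 < s -> \int[normal_prob 0 s]_x (x ^+ 2) = s ^+ 2.
Proof.
move=> s0.
have [|i2 ->] := Rintegral_normal_prob s (fun x => x ^+ 2) _ (integrable_normal_even s 0 s0).
  by [].
have ip := integrable_normal_pdf 0 s.
have is2 : mu.-integrable [set: R] (EFin \o (fun x => s ^+ 2 * normal_pdf 0 s x)).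
  exact: integrable_mulR.
have Ep : \int[mu]_x (s ^+ 2 * normal_pdf 0 s x) = s ^+ 2.
  by rewrite RintegralZl// /Rintegral integral_normal_pdf mulr1.
rewrite -[RHS]Ep; apply/eqP; rewrite -subr_eq0 -RintegralB//; apply/eqP.
apply: (Rintegral_primitive0 (fun x => - s ^+ 2 * (x * normal_pdf 0 s x))).
- move=> x; have dp := is_derive_normal_pdf s x s0.
  suff : is_derive x (1 : R) (cst (- s ^+ 2) * (id * normal_pdf 0 s))
    (x ^+ 2 * normal_pdf 0 s x - s ^+ 2 * normal_pdf 0 s x) by [].
  apply: (is_derive_eq (is_deriveM (is_derive_cst (- s ^+ 2) x 1)
    (is_deriveM (is_derive_id x 1) dp))).
  by rewrite /GRing.scale/= ?fctE; field; rewrite gt_eqF.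
- move=> x; have cp : normal_pdf 0 s @ x --> normal_pdf 0 s x.
    by apply: continuous_normal_pdf; rewrite gt_eqF.
  apply: (@cvgB _ R); apply: cvgM => //; [exact: exprn_continuous|exact: cvg_cst].
- exact: integrable_subR.
- rewrite (_ : (fun _ => _) = (fun n : nat => (- s ^+ 2 * 2) * (n%:R * normal_pdf 0 s n%:R))).
    rewrite -[X in _ --> X](mulr0 (- s ^+ 2 * 2)); apply: cvgM; first exact: cvg_cst.
    exact: cvg_nat_normal_pdf.
  by apply/funext => n; rewrite !normal_pdf0E// sqrrN; ring.
Qed.

End normal_moments.

Section brownian_increments.
Context {disp : measure_display} {T : measurableType disp} {R : realType}.
Context (P : probability T R) (d : nat) (B : R -> T -> 'rV[R]_d).
Hypothesis hB : standard_brownian_motion P B.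
Variables (s t : R).
Hypotheses (s_ge0 : 0 <= s) (st : s < t).
Let D (i : 'I_d) (w : T) : R := (B t w - B s w) ord0 i.
Let m := Num.sqrt (t - s).

Let m_gt0 : 0 < m. Proof. by rewrite sqrtr_gt0 subr_gt0. Qed.

Lemma measurable_increment i : measurable_fun [set: T] (D i).
Proof.
have [mB _ _ _ _] := hB.
rewrite (_ : D i = (fun w => B t w ord0 i - B s w ord0 i)); last first.
  by apply/funext => w; rewrite /D !mxE.
apply: measurable_funB; apply: mB => //.
exact: le_trans s_ge0 (ltW st).
Qed.

Lemma increment_law i A : measurable A -> P (D i @^-1` A) = normal_prob 0 m A.
Proof.
have [_ _ hlaw _ _] := hB; move=> mA.
have := hlaw s t s_ge0 st (fun j => if j == i then A else setT).
rewrite (bigD1 i)//= eqxx big1 ?mule1; last first.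
  by move=> j /negbTE ->; rewrite probability_setT.
move=> <-; last by move=> j; case: ifP.
congr (P _); apply/seteqP; split=> [w Aw j|w /(_ i)].
  by case: eqP => // ->.
by rewrite eqxx.
Qed.

Lemma increments_law2 i j A C : i != j -> measurable A -> measurable C ->
  P (D i @^-1` A `&` D j @^-1` C) = (normal_prob 0 m A * normal_prob 0 m C)%E.
Proof.
have [_ _ hlaw _ _] := hB; move=> ij mA mC.
have := hlaw s t s_ge0 st (fun k => if k == i then A else if k == j then C else setT).
rewrite (bigD1 i)//= eqxx (bigD1 j)/=; last by rewrite eq_sym.
rewrite eq_sym (negbTE ij) eqxx big1 ?mule1; last first.
  by move=> k /andP[/negbTE -> /negbTE ->]; rewrite probability_setT.
move=> <-; last by move=> k; case: ifP => // _; case: ifP.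
congr (P _); apply/seteqP; split=> [w [Aw Cw] k|w H].
  by case: eqP => [->//|_]; case: eqP => // ->.
have := H i; have := H j; rewrite eqxx.
by rewrite eq_sym (negbTE ij) eqxx.
Qed.

Lemma increment_transfer i (f : R -> R) : measurable_fun [set: R] f ->
  (normal_prob 0 m).-integrable [set: R] (EFin \o f) ->
  P.-integrable [set: T] (EFin \o (fun w => f (D i w))) /\
  \int[P]_w f (D i w) = \int[normal_prob 0 m]_x f x.
Proof.
move=> mf if_.
have mD := measurable_increment i.
pose D' := @mfun_Sub _ _ T (measurableTypeR R) (D i) (mem_set mD).
have E (g : R -> \bar R) : (\int[distribution P D']_x g x = \int[normal_prob 0 m]_x g x)%E.
  by apply: eq_measure_integral => A mA _; exact: increment_law.
have ifD : P.-integrable [set: T] (EFin \o (fun w => f (D i w))).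
  apply/integrableP; split; first by apply/measurable_EFinP; exact: measurableT_comp.
  move/integrableP : if_ => [_]; apply: le_lt_trans; rewrite -E.
  rewrite -(ge0_integral_distribution D' (f := fun x => `|(f x)%:E|%E))//.
  by apply: measurableT_comp => //; exact/measurable_EFinP.
split=> //; rewrite /Rintegral; congr fine; rewrite -E.
rewrite -(@integral_distribution _ _ _ _ _ P D' (EFin \o f))//.
exact/measurable_EFinP.
Qed.

Lemma increment_mean i : P.-integrable [set: T] (EFin \o D i) /\ \int[P]_w D i w = 0.
Proof.
have [||iD ->] := increment_transfer i (@id R).
- by [].
- exact: integrable_normal_id.
- by split => //; exact: normal_mean.
Qed.

Lemma increment_variance i :
  P.-integrable [set: T] (EFin \o (fun w => D i w ^+ 2)) /\ \int[P]_w D i w ^+ 2 = t - s.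
Proof.
have [||iD ->] := increment_transfer i (fun x => x ^+ 2).
- by [].
- exact: (integrable_normal_even m 0).
- by split => //; rewrite normal_variance// sqr_sqrtr// subr_ge0 ltW.
Qed.

Lemma increment_even_moment i k :
  P.-integrable [set: T] (EFin \o (fun w => D i w ^+ (2 * k.+1))) /\
  \int[P]_w D i w ^+ (2 * k.+1) <= 8 ^+ k.+1 * k.+1`!%:R * 2 * (t - s) ^+ k.+1.
Proof.
have iN := integrable_normal_even m k m_gt0.
have [||iD ->] := increment_transfer i (fun x => x ^+ (2 * k.+1)).
- by [].
- exact: iN.
- split => //; rewrite -lee_fin fineK; last exact: integrable_fin_num.
  apply: (le_trans (normal_even_moment_le m k m_gt0)).
  by rewrite exprM sqr_sqrtr// subr_ge0 ltW.
Qed.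

Lemma increment_covariance i j :
  P.-integrable [set: T] (EFin \o (fun w => D i w * D j w)) /\
  \int[P]_w (D i w * D j w) = (t - s) *+ (i == j).
Proof.
have [<-|ij] := eqVneq i j; first exact: increment_variance.
have mDi := measurable_increment i; have mDj := measurable_increment j.
have iDij : P.-integrable [set: T] (EFin \o (fun w => D i w * D j w)).
  apply: (@le_integrableR _ _ _ _ _ (fun w => D i w ^+ 2 + D j w ^+ 2)).
  - exact: measurable_funM.
  - move=> w; rewrite normrM -[D i w ^+ 2]real_normK ?num_real//.
    rewrite -[D j w ^+ 2]real_normK ?num_real//.
    have : 0 <= (`|D i w| - `|D j w|) ^+ 2 by rewrite sqr_ge0.
    have := normr_ge0 (D i w); have := normr_ge0 (D j w); nra.
  - apply: integrable_addR; [exact: (increment_variance i).1|exact: (increment_variance j).1].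
split=> //; rewrite (Rintegral_indep_mul P (D i) (D j))//.
- by rewrite (increment_mean i).2 mul0r.
- by move=> A C mA mC; rewrite increments_law2// !increment_law.
- exact: (increment_mean i).1.
- exact: (increment_mean j).1.
Qed.

End brownian_increments.

(** * One step of the Euler scheme *)

Section step_bound.
Context {R : realType}.
Implicit Types (m u x y z : R).

(* With [m = sqrt h] and [u] the norm of a Brownian increment over time [h],
   this dominates the monomials of degree at least 3 in [m] and [u] that occur
   in the expansion of one step, and its mean is O(h^(3/2)). *)
Definition step_error m u : R := m ^+ 3 + m * u ^+ 2 + u ^+ 4 / m + u ^+ 6.

(** The odd powers of u are absorbed by the inequality of arithmetic and geometric means: 2 m^2 u <=
    m^3 + m u^2 and 2 u^3 <= m u^2 + u^4 / m. Only even Gaussian moments then have to be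
    estimated. *)
Lemma step_error_monomials m u : 0 < m -> m <= 1 -> 0 <= u ->
  [/\ m ^+ 3 <= step_error m u, m ^+ 2 * u <= step_error m u,
      u ^+ 3 <= step_error m u & u ^+ 4 <= step_error m u] /\
  u ^+ 6 <= step_error m u.
Proof.
move=> m0 m1 u0; rewrite /step_error.
have a1 : 0 <= m ^+ 3 by rewrite exprn_ge0// ltW.
have a2 : 0 <= m * u ^+ 2 by rewrite mulr_ge0 ?exprn_ge0// ltW.
have a3 : u ^+ 4 <= u ^+ 4 / m by rewrite ler_pdivlMr// ler_piMr// exprn_ge0.
have a4 : 0 <= u ^+ 6 by rewrite exprn_ge0.
have a5 : 0 <= u ^+ 4 by rewrite exprn_ge0.
have a6 : m ^+ 2 * u <= (m ^+ 3 + m * u ^+ 2) / 2.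
  rewrite -subr_ge0 (_ : _ - _ = m * (m - u) ^+ 2 / 2); last by field.
  by rewrite divr_ge0// mulr_ge0 ?sqr_ge0// ltW.
have a7 : u ^+ 3 <= (m * u ^+ 2 + u ^+ 4 / m) / 2.
  rewrite -subr_ge0 (_ : _ - _ = u ^+ 2 * (m - u) ^+ 2 / (2 * m)); last first.
    by field; rewrite gt_eqF.
  by rewrite divr_ge0// mulr_ge0 ?sqr_ge0// ltW.
by split; [split|]; lra.
Qed.

Lemma cube_sum_le x y z : 0 <= x -> 0 <= y -> 0 <= z ->
  (x + y + z) ^+ 3 <= 9 * (x ^+ 3 + y ^+ 3 + z ^+ 3).
Proof.
move=> x0 y0 z0.
have h (a b : R) : 0 <= a -> 0 <= b -> 0 <= (a + b) * (a - b) ^+ 2.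
  by move=> a0 b0; apply: mulr_ge0; [exact: addr_ge0|exact: sqr_ge0].
have := h _ _ x0 y0; have := h _ _ y0 z0; have := h _ _ x0 z0.
have xy : 0 <= x * (y - z) ^+ 2 by rewrite mulr_ge0// sqr_ge0.
have yz : 0 <= y * (x - z) ^+ 2 by rewrite mulr_ge0// sqr_ge0.
have zx : 0 <= z * (x - y) ^+ 2 by rewrite mulr_ge0// sqr_ge0.
nra.
Qed.

Variables (theta sigma L2 M : R).
Hypotheses (sigma_gt0 : 0 < sigma) (L2_ge0 : 0 <= L2) (M_ge0 : 0 <= M).

(* [r = |z|^2], [p = <z, D>] and [u = |D|]: [s] is the increment of the
   squared norm when [z] becomes [(1 - theta h) z + sigma D], [h = m^2]. *)
Lemma step_expansion : exists2 C, 0 <= C & forall m u r p g1 g2,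
    0 < m -> m <= 1 -> 0 <= u -> 0 <= r -> r <= L2 -> `|p| <= Num.sqrt L2 * u ->
    `|g1| <= M -> `|g2| <= M ->
    let a := 1 - theta * m ^+ 2 in
    let s := (a ^+ 2 - 1) * r + 2 * a * sigma * p + sigma ^+ 2 * u ^+ 2 in
  `|s| ^+ 3 <= C * step_error m u /\
  `|g1 * s + g2 / 2 * s ^+ 2 - (- (2 * theta * m ^+ 2 * r * g1) +
     2 * a * sigma * g1 * p + sigma ^+ 2 * g1 * u ^+ 2 +
     2 * sigma ^+ 2 * g2 * p ^+ 2)| <= C * step_error m u.
Proof.
pose K := Num.sqrt L2.
have K0 : 0 <= K by exact: sqrtr_ge0.
pose t := `|theta|.
have t0 : 0 <= t by exact: normr_ge0.
pose A := (2 * t + t ^+ 2) * L2 + 2 * t * sigma * K + sigma ^+ 2.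
have s0 := ltW sigma_gt0.
have w1 : 0 <= (2 * t + t ^+ 2) * L2 by rewrite mulr_ge0// addr_ge0 ?sqr_ge0// mulr_ge0.
have w2 : 0 <= 2 * t * sigma * K by rewrite !mulr_ge0.
have s20 : 0 <= sigma ^+ 2 by rewrite sqr_ge0.
have A0 : 0 <= A by rewrite /A; lra.
pose C1 := 2 * A + 2 * (1 + t) * sigma * K + sigma ^+ 2.
have q0 : 0 <= 2 * (1 + t) * sigma * K by rewrite !mulr_ge0// addr_ge0.
have C10 : 0 <= C1 by rewrite /C1; lra.
have AC : 2 * A <= C1 by rewrite /C1; lra.
exists (27 * C1 ^+ 3 + M * t ^+ 2 * L2 + M / 2 * (8 * C1 ^+ 2)).
  have : 0 <= C1 ^+ 3 by rewrite exprn_ge0.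
  have : 0 <= M * t ^+ 2 * L2 by rewrite !mulr_ge0.
  have : 0 <= M / 2 * (8 * C1 ^+ 2) by rewrite !mulr_ge0// ?divr_ge0// ?sqr_ge0.
  lra.
move=> m u r p g1 g2 m0 m1 u0 r0 rL pu g1M g2M a s.
have [[e1 e2 e3 e4] e6] := step_error_monomials m u m0 m1 u0.
set E := step_error m u in e1 e2 e3 e4 e6 *.
have m2 : 0 <= m ^+ 2 by rewrite sqr_ge0.
have m21 : m ^+ 2 <= 1 by rewrite -[leRHS](expr1n _ 2) lerXn2r// nnegrE// ltW.
have u2 : 0 <= u ^+ 2 by rewrite sqr_ge0.
have E0 : 0 <= E by apply: le_trans e1; rewrite exprn_ge0// ltW.
have pK : `|2 * sigma * p| <= C1 * u.
  rewrite !normrM (ger0_norm s0) (@ger0_norm _ 2)//.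
  apply: (@le_trans _ _ (2 * sigma * (K * u))); first by rewrite ler_wpM2l// mulr_ge0.
  rewrite mulrA ler_wpM2r// /C1.
  have : 0 <= t * sigma * K by rewrite !mulr_ge0.
  lra.
(* The increment is split into its leading noise term 2 sigma p, of order u, and a rest [e] of order
   m^2 + u^2. *)
pose e := (a ^+ 2 - 1) * r + 2 * (a - 1) * sigma * p + sigma ^+ 2 * u ^+ 2.
have sE : s = 2 * sigma * p + e by rewrite /s /e; ring.
have a21 : `|a ^+ 2 - 1| <= (2 * t + t ^+ 2) * m ^+ 2.
  rewrite (_ : a ^+ 2 - 1 = - (2 * theta * m ^+ 2) + theta ^+ 2 * m ^+ 2 * m ^+ 2); last first.
    by rewrite /a; ring.
  have n1 : `|2 * theta * m ^+ 2| = 2 * t * m ^+ 2.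
    by rewrite (normrM (2 * theta)) (normrM 2) (ger0_norm m2) (@ger0_norm _ 2).
  have n2 : `|theta ^+ 2 * m ^+ 2 * m ^+ 2| <= t ^+ 2 * m ^+ 2.
    rewrite (normrM (theta ^+ 2 * m ^+ 2)) (normrM (theta ^+ 2)).
    by rewrite (ger0_norm m2) normrX ler_piMr// mulr_ge0// sqr_ge0.
  by apply: (le_trans (ler_normD _ _)); rewrite normrN n1; lra.
have a1 : `|a - 1| <= t * m ^+ 2.
  by rewrite /a addrC addKr normrN normrM (ger0_norm m2).
have eA : `|e| <= A * (m ^+ 2 + m ^+ 2 * u + u ^+ 2).
  have h1 : `|(a ^+ 2 - 1) * r| <= (2 * t + t ^+ 2) * L2 * m ^+ 2.
    rewrite normrM (ger0_norm r0) mulrAC.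
    by apply: ler_pM.
  have h2 : `|2 * (a - 1) * sigma * p| <= 2 * t * sigma * K * (m ^+ 2 * u).
    rewrite !normrM (ger0_norm s0) (@ger0_norm _ 2)//.
    rewrite (_ : 2 * t * _ * _ * _ = 2 * (t * m ^+ 2) * sigma * (K * u)); last by ring.
    apply: ler_pM => //; first by rewrite !mulr_ge0.
    by rewrite ler_wpM2r// ler_wpM2l.
  have h3 : `|sigma ^+ 2 * u ^+ 2| <= sigma ^+ 2 * u ^+ 2 by rewrite ger0_norm// mulr_ge0.
  apply: (le_trans (ler_normD _ _)); apply: (le_trans (lerD (ler_normD _ _) (lexx _))).
  apply: (le_trans (lerD (lerD h1 h2) h3)).
  have mu0 : 0 <= m ^+ 2 * u by rewrite mulr_ge0.
  rewrite !(mulrDr A); apply: lerD; first apply: lerD.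
  - by rewrite ler_wpM2r// /A; lra.
  - by rewrite ler_wpM2r// /A; lra.
  - by rewrite ler_wpM2r// /A; lra.
have mmu : m ^+ 2 * u <= m ^+ 2 + u ^+ 2.
  have h : 0 <= (m ^+ 2 - u) ^+ 2 by rewrite sqr_ge0.
  have h' : m ^+ 2 * m ^+ 2 <= m ^+ 2 by rewrite ler_piMr.
  nra.
have eC : `|e| <= C1 * (m ^+ 2 + u ^+ 2).
  apply: (le_trans eA); apply: (@le_trans _ _ (2 * A * (m ^+ 2 + u ^+ 2))).
    rewrite (_ : 2 * A * _ = A * (2 * (m ^+ 2 + u ^+ 2))); last by ring.
    by rewrite ler_wpM2l//; lra.
  by rewrite ler_wpM2r// addr_ge0.
have sC : `|s| <= C1 * (m ^+ 2 + u + u ^+ 2).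
  rewrite sE; apply: (le_trans (ler_normD _ _)).
  apply: (le_trans (lerD pK eC)).
  by rewrite -mulrDr ler_wpM2l//; lra.
have t1 : 0 <= M * t ^+ 2 * L2 * E by rewrite !mulr_ge0.
have t2 : 0 <= M / 2 * (8 * C1 ^+ 2) * E by rewrite !mulr_ge0// ?divr_ge0// ?sqr_ge0.
have t3 : 0 <= C1 ^+ 3 * E by rewrite mulr_ge0// exprn_ge0.
have m63 : (m ^+ 2) ^+ 3 <= m ^+ 3.
  by rewrite -exprM exprM lerXn2r ?nnegrE ?exprn_ge0 ?(ltW m0)// expr2 ler_piMr// ltW.
split.
  apply: (@le_trans _ _ ((C1 * (m ^+ 2 + u + u ^+ 2)) ^+ 3)).
    by rewrite lerXn2r// nnegrE// mulr_ge0// !addr_ge0.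
  rewrite exprMn.
  apply: (@le_trans _ _ (C1 ^+ 3 * (27 * E))); last by lra.
  rewrite ler_wpM2l ?exprn_ge0//.
  apply: (le_trans (cube_sum_le _ _ _ m2 u0 u2)).
  rewrite -!exprM; rewrite -exprM in m63; lra.
(* What remains is the h^2 term of a^2 - 1, and s^2 without the square of its leading term 2 sigma
   p; all of it has order at least 3. *)
rewrite (_ : _ - _ = g1 * (theta ^+ 2 * r * (m ^+ 2 * m ^+ 2)) +
   g2 / 2 * (e ^+ 2 + 2 * (e * (2 * sigma * p)))); last first.
  by rewrite sE /e /a; field.
apply: (le_trans (ler_normD _ _)).
have m40 : 0 <= m ^+ 2 * m ^+ 2 by rewrite mulr_ge0.
have m4 : m ^+ 2 * m ^+ 2 <= m ^+ 3.
  by rewrite -exprD (exprSr m 3) ler_piMr ?exprn_ge0 ?(ltW m0).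
have k1 : `|g1 * (theta ^+ 2 * r * (m ^+ 2 * m ^+ 2))| <= M * t ^+ 2 * L2 * E.
  rewrite (_ : M * t ^+ 2 * L2 * E = M * (t ^+ 2 * (L2 * E))); last by ring.
  rewrite (normrM g1); apply: ler_pM => //.
  rewrite -(mulrA (theta ^+ 2)) (normrM (theta ^+ 2)) normrX ler_wpM2l ?sqr_ge0//.
  rewrite normrM (ger0_norm r0); apply: ler_pM => //.
  by rewrite (ger0_norm m40) (le_trans m4).
have k2 : `|e ^+ 2 + 2 * (e * (2 * sigma * p))| <= 8 * C1 ^+ 2 * E.
  apply: (le_trans (ler_normD _ _)); rewrite normrX (normrM 2) (normrM e) (@ger0_norm _ 2)//.
  have l1 : `|e| ^+ 2 <= C1 ^+ 2 * (4 * E).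
    apply: (@le_trans _ _ ((C1 * (m ^+ 2 + u ^+ 2)) ^+ 2)).
      by rewrite lerXn2r// nnegrE// mulr_ge0// addr_ge0.
    rewrite exprMn ler_wpM2l ?sqr_ge0//.
    have : 0 <= (m ^+ 2 - u ^+ 2) ^+ 2 by rewrite sqr_ge0.
    have : (m ^+ 2) ^+ 2 <= m ^+ 3.
      by rewrite -exprM (exprSr m 3) ler_piMr ?exprn_ge0 ?(ltW m0).
    have : (u ^+ 2) ^+ 2 = u ^+ 4 by rewrite -exprM.
    nra.
  have l2 : `|e| * `|2 * sigma * p| <= C1 ^+ 2 * (2 * E).
    apply: (@le_trans _ _ (C1 * (m ^+ 2 + u ^+ 2) * (C1 * u))).
      by apply: ler_pM.
    rewrite (_ : _ * _ = C1 ^+ 2 * (m ^+ 2 * u + u ^+ 3)); last by ring.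
    by rewrite ler_wpM2l ?sqr_ge0//; lra.
  lra.
have k3 : `|g2 / 2 * (e ^+ 2 + 2 * (e * (2 * sigma * p)))| <= M / 2 * (8 * C1 ^+ 2) * E.
  rewrite normrM -[leRHS]mulrA; apply: ler_pM => //.
  by rewrite normrM normfV (@ger0_norm _ 2)// ler_wpM2r.
apply: (le_trans (lerD k1 k3)); lra.
Qed.

End step_bound.

Section finite_sums.
Context {R : realType} (d : nat).
Implicit Types x y : 'I_d -> R.

Lemma cauchy_schwarz_sum x y :
  (\sum_i x i * y i) ^+ 2 <= (\sum_i x i ^+ 2) * (\sum_i y i ^+ 2).
Proof.
set a := \sum_i x i ^+ 2; set b := \sum_i x i * y i; set c := \sum_i y i ^+ 2.
have E s : \sum_i (s * x i + y i) ^+ 2 = s ^+ 2 * a + 2 * s * b + c.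
  rewrite !mulr_sumr -!big_split/=; apply: eq_bigr => i _; ring.
have a0 : 0 <= a by apply: sumr_ge0 => i _; exact: sqr_ge0.
have pos s : 0 <= s ^+ 2 * a + 2 * s * b + c.
  by rewrite -E; apply: sumr_ge0 => i _; exact: sqr_ge0.
move: a0; rewrite le_eqVlt => /predU1P[a0|a0].
  have [->|b0] := eqVneq b 0; first by rewrite expr0n/= -a0 mul0r.
  (* With a = 0 the quadratic polynomial is affine of slope 2b, and at this point it would take the
     value -1. *)
  have := pos (- (c + 1) / (2 * b)); rewrite -a0 mulr0 add0r.
  rewrite (_ : 2 * (- (c + 1) / (2 * b)) * b = - (c + 1)); last by field.
  lra.
have := pos (- b / a).
rewrite (_ : (- b / a) ^+ 2 * a + 2 * (- b / a) * b + c = (a * c - b ^+ 2) / a); last first.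
  by field; rewrite gt_eqF.
by rewrite pmulr_lge0 ?invr_gt0// subr_ge0.
Qed.

Lemma exprn_sum_le x k : (forall i, 0 <= x i) ->
  (\sum_i x i) ^+ k.+1 <= d%:R ^+ k.+1 * \sum_i x i ^+ k.+1.
Proof.
case: d x => [|n] x x0; first by rewrite !big_ord0 expr0n mulr0.
have [i _ xi] := @arg_maxP _ _ _ (ord0 : 'I_n.+1) xpredT x isT.
apply: (@le_trans _ _ ((n.+1%:R * x i) ^+ k.+1)).
  rewrite lerXn2r ?nnegrE ?sumr_ge0// ?mulr_ge0//.
  rewrite mulr_natl -[X in _ *+ X](card_ord n.+1) -sumr_const.
  by apply: ler_sum => j _; exact: xi.
rewrite exprMn ler_wpM2l ?exprn_ge0// (bigD1 i)//= lerDl.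
by apply: sumr_ge0 => j _; rewrite exprn_ge0.
Qed.

End finite_sums.

(** * Brownian increments against the past *)

Section sub_sigma_algebra_increments.
Context {disp : measure_display} {T : measurableType disp} {R : realType}.
Context (P : probability T R) (d : nat) (B : R -> T -> 'rV[R]_d).
Hypothesis hB : standard_brownian_motion P B.
Variables (s t : R).
Hypotheses (s_ge0 : 0 <= s) (st : s < t).
Variable G : set (set T).
Hypothesis mG : <<s G >> `<=` measurable.
Hypothesis iG : independent_systems P <<s G >>
  (sigma_generated [set: unit] (fun=> fun w => B t w - B s w)).
Local Notation TG := (g_sigma_algebraType G).
Let D (i : 'I_d) (w : T) : R := (B t w - B s w) ord0 i.

Lemma sub_measurable_fun (Y : T -> R) :
  measurable_fun [set: TG] (Y : TG -> R) -> measurable_fun [set: T] Y.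
Proof. by move=> mY _ A mA; apply: mG; exact: mY. Qed.

Let H : set (set T) := \bigcup_(k in [set: unit]) \bigcup_(i in [set: 'I_d])
  preimage_set_system [set: T] (fun w => (B t w - B s w) ord0 i) measurable.

Let mH i : measurable_fun [set: g_sigma_algebraType H] (D i : g_sigma_algebraType H -> R).
Proof.
move=> _ A mA; rewrite setTI; apply: sub_sigma_algebra.
by exists tt => //; exists i => //; exists A => //; rewrite setTI.
Qed.

Lemma independent_increment (Y W : T -> R) :
  measurable_fun [set: TG] (Y : TG -> R) ->
  measurable_fun [set: g_sigma_algebraType H] (W : g_sigma_algebraType H -> R) ->
  independent_rv P Y W.
Proof.
move=> mY mW A C mA mC; apply: iG.
  by have := mY measurableT A mA; rewrite setTI.
by have := mW measurableT C mC; rewrite setTI.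
Qed.

(** This and the next lemma stand in for conditional expectations: in the expansion of a step the
    coefficients depend on the past only, so the linear terms have mean 0 and the quadratic ones
    survive only on the diagonal. *)
Lemma Rintegral_mul_increment (Y : T -> R) M i :
    measurable_fun [set: TG] (Y : TG -> R) -> (forall w, `|Y w| <= M) ->
  P.-integrable [set: T] (EFin \o (fun w => Y w * D i w)) /\
  \int[P]_w (Y w * D i w) = 0.
Proof.
move=> mY YM; have [iD D0] := increment_mean P d B hB s t s_ge0 st i.
have mD := measurable_increment P d B hB s t s_ge0 st i.
have mYT := sub_measurable_fun _ mY.
have iYD : P.-integrable [set: T] (EFin \o (fun w => Y w * D i w)).
  apply: (@le_integrableR _ _ _ _ _ (fun w => M * `|D i w|)).
  - exact: measurable_funM.
  - by move=> w; rewrite normrM ler_wpM2r.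
  - by apply: integrable_mulR; exact: (integrable_norm iD).
split=> //; rewrite (Rintegral_indep_mul P Y (D i))//.
- by rewrite D0 mulr0.
- exact: independent_increment.
- exact: bounded_integrableR mYT YM.
Qed.

Lemma Rintegral_mul_increment2 (Y : T -> R) M i j :
    measurable_fun [set: TG] (Y : TG -> R) -> (forall w, `|Y w| <= M) ->
  P.-integrable [set: T] (EFin \o (fun w => Y w * (D i w * D j w))) /\
  \int[P]_w (Y w * (D i w * D j w)) = (\int[P]_w Y w) * ((t - s) *+ (i == j)).
Proof.
move=> mY YM; have [iD D0] := increment_covariance P d B hB s t s_ge0 st i j.
have mD k := measurable_increment P d B hB s t s_ge0 st k.
have mDD : measurable_fun [set: T] (fun w => D i w * D j w).
  by apply: measurable_funM; exact: mD.
have mYT := sub_measurable_fun _ mY.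
have iYD : P.-integrable [set: T] (EFin \o (fun w => Y w * (D i w * D j w))).
  apply: (@le_integrableR _ _ _ _ _ (fun w => M * `|D i w * D j w|)).
  - exact: measurable_funM.
  - by move=> w; rewrite normrM ler_wpM2r.
  - by apply: integrable_mulR; exact: (integrable_norm iD).
split=> //; rewrite (Rintegral_indep_mul P Y (fun w => D i w * D j w))//.
- by rewrite D0.
- apply: independent_increment => //; exact: (measurable_funM (mH i) (mH j)).
- exact: bounded_integrableR mYT YM.
Qed.

End sub_sigma_algebra_increments.

Definition sqnorm {R : realType} {d : nat} (v : 'rV[R]_d) : R :=
  \sum_(i < d) v ord0 i ^+ 2.

Lemma Rintegral_prob_cst {disp : measure_display} {T : measurableType disp}
    {R : realType} (P : probability T R) (c : R) : \int[P]_w c = c.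
Proof.
rewrite Rintegral_cst//; have := probability_setT P => /= ->.
by rewrite mulr1.
Qed.

Section step_expectation.
Context {disp : measure_display} {T : measurableType disp} {R : realType}.
Context (P : probability T R) (d : nat) (B : R -> T -> 'rV[R]_d).
Hypothesis hB : standard_brownian_motion P B.

Lemma sqnorm_ge0 (v : 'rV[R]_d) : 0 <= sqnorm v.
Proof. by apply: sumr_ge0 => i _; exact: sqr_ge0. Qed.

(** With q = |D|^2 the error is m^3 + m q + q^2 / m + q^3. As q^k has mean of order m^(2k) and m <=
    1, each term has order at least m^3; the four summands of the constant correspond to these four
    terms. *)
Lemma step_error_expectation : exists2 C, 0 <= C & forall s t,
    0 <= s -> s < t -> t - s <= 1 ->
    let E w := step_error (Num.sqrt (t - s)) (Num.sqrt (sqnorm (B t w - B s w))) in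
  P.-integrable [set: T] (EFin \o E) /\ \int[P]_w E w <= C * Num.sqrt (t - s) ^+ 3.
Proof.
pose K k : R := 8 ^+ k.+1 * k.+1`!%:R * 2.
have K0 k : 0 <= K k by rewrite /K !mulr_ge0// exprn_ge0.
exists (1 + d%:R + d%:R ^+ 2 * (d%:R * K 1) + d%:R ^+ 3 * (d%:R * K 2)).
  by rewrite !addr_ge0 ?mulr_ge0 ?exprn_ge0.
move=> s t s0 st ts1 E.
pose D i w := (B t w - B s w) ord0 i.
set m := Num.sqrt (t - s) in E *.
have h0 : 0 < t - s by rewrite subr_gt0.
have m0 : 0 < m by rewrite sqrtr_gt0.
have m2 : m ^+ 2 = t - s by rewrite sqr_sqrtr// ltW.
have m1 : m <= 1 by rewrite -sqrtr1 ler_wsqrtr.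
have mD i : measurable_fun [set: T] (D i) := measurable_increment P d B hB s t s0 st i.
have iD i k := (increment_even_moment P d B hB s t s0 st i k).1.
have ED i k := (increment_even_moment P d B hB s t s0 st i k).2.
pose q w := \sum_i D i w ^+ 2.
have qE w : sqnorm (B t w - B s w) = q w by [].
have q0 w : 0 <= q w by rewrite -qE; exact: sqnorm_ge0.
have mq : measurable_fun [set: T] q.
  by apply: measurable_sum => i; apply: measurable_funX; exact: mD.
have EE w : E w = m ^+ 3 + m * q w + q w ^+ 2 / m + q w ^+ 3.
  rewrite /E /step_error qE.
  rewrite (_ : 4 = 2 * 2)%N// (_ : 6 = 2 * 3)%N// !(exprM (Num.sqrt _)).
  by rewrite sqr_sqrtr ?q0.
have iS k : P.-integrable [set: T] (EFin \o (fun w => \sum_i D i w ^+ (2 * k.+1))).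
  by apply: integrable_sumR => i _; exact: iD.
have ES k : \int[P]_w (\sum_i D i w ^+ (2 * k.+1)) <= d%:R * K k * (m ^+ 2) ^+ k.+1.
  rewrite Rintegral_sum; last by move=> i _; exact: iD.
  apply: (@le_trans _ _ (\sum_(i < d) K k * (m ^+ 2) ^+ k.+1)).
    by apply: ler_sum => i _; rewrite m2; exact: ED.
  by rewrite sumr_const card_ord -[leLHS]mulr_natl mulrA.
have qk k w : q w ^+ k.+1 <= d%:R ^+ k.+1 * \sum_i D i w ^+ (2 * k.+1).
  apply: (le_trans (exprn_sum_le d (fun i => D i w ^+ 2) k _)).
    by move=> i; exact: sqr_ge0.
  rewrite ler_wpM2l ?exprn_ge0// le_eqVlt; apply/orP; left; apply/eqP.
  by apply: eq_bigr => i _; rewrite -exprM.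
have iq k : P.-integrable [set: T] (EFin \o (fun w => q w ^+ k.+1)).
  apply: (@le_integrableR _ _ _ _ _ (fun w => d%:R ^+ k.+1 * \sum_i D i w ^+ (2 * k.+1))).
  - exact: measurable_funX.
  - by move=> w; rewrite ger0_norm ?exprn_ge0.
  - exact: integrable_mulR.
have Eqk k : \int[P]_w (q w ^+ k.+1) <= d%:R ^+ k.+1 * (d%:R * K k) * (m ^+ 2) ^+ k.+1.
  apply: (@le_trans _ _ (\int[P]_w (d%:R ^+ k.+1 * \sum_i D i w ^+ (2 * k.+1)))).
    by apply: le_Rintegral => //; exact: integrable_mulR.
  by rewrite RintegralZl// -mulrA ler_wpM2l ?exprn_ge0.
have Eq1 : \int[P]_w q w = d%:R * m ^+ 2.
  rewrite Rintegral_sum; last first.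
    by move=> i _; exact: (increment_variance P d B hB s t s0 st i).1.
  rewrite (eq_bigr (fun=> m ^+ 2)); last first.
    by move=> i _; rewrite m2; exact: (increment_variance P d B hB s t s0 st i).2.
  by rewrite sumr_const card_ord mulr_natl.
have i1 : P.-integrable [set: T] (EFin \o (fun=> m ^+ 3 : R)).
  by apply: (@bounded_integrableR _ _ _ _ _ `|m ^+ 3|).
have iq1 : P.-integrable [set: T] (EFin \o q) by have := iq 0; exact.
have i2 := integrable_mulR P m q iq1.
have i3 := integrable_mulR P m^-1 (fun w => q w ^+ 2) (iq 1).
have i4 := iq 2.
rewrite (_ : E = (fun w => m ^+ 3 + m * q w + m^-1 * q w ^+ 2 + q w ^+ 3)); last first.
  by apply/funext => w; rewrite EE (mulrC m^-1).
have i12 := integrable_addR P _ _ i1 i2.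
have i123 := integrable_addR P _ _ i12 i3.
split; first exact: (integrable_addR P _ _ i123 i4).
rewrite RintegralD// RintegralD// RintegralD//.
rewrite Rintegral_prob_cst !RintegralZl// Eq1.
have e2 : m^-1 * \int[P]_w (q w ^+ 2) <= d%:R ^+ 2 * (d%:R * K 1) * m ^+ 3.
  rewrite mulrC ler_pdivrMr// (le_trans (Eqk 1))//.
  by rewrite le_eqVlt; apply/orP; left; apply/eqP; ring.
have e3 : \int[P]_w (q w ^+ 3) <= d%:R ^+ 3 * (d%:R * K 2) * m ^+ 3.
  rewrite (le_trans (Eqk 2))// ler_wpM2l ?mulr_ge0 ?exprn_ge0//.
  by rewrite -exprM (_ : 2 * 3 = 3 * 2)%N// exprM expr2 ler_piMr ?exprn_ge0 ?exprn_ile1// ltW.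
rewrite (_ : m * (d%:R * m ^+ 2) = d%:R * m ^+ 3); last by ring.
rewrite !mulrDl mul1r; apply: lerD => //; apply: lerD => //.
Qed.

End step_expectation.

Section one_step.
Context {disp : measure_display} {T : measurableType disp} {R : realType}.
Context (P : probability T R) (d : nat) (B : R -> T -> 'rV[R]_d).
Hypothesis hB : standard_brownian_motion P B.
Variables (theta sigma L2 M : R) (F f1 f2 : R -> R).
Hypotheses (sigma_gt0 : 0 < sigma) (L2_ge0 : 0 <= L2) (M_ge0 : 0 <= M).
Hypotheses (cF : continuous F) (cf1 : continuous f1) (cf2 : continuous f2).
Hypothesis f1_bound : forall r, 0 <= r <= L2 -> `|f1 r| <= M.
Hypothesis f2_bound : forall r, 0 <= r <= L2 -> `|f2 r| <= M.
Hypothesis taylor : forall r u, 0 <= r <= L2 -> 0 <= r + u ->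
  `|F (Num.min (r + u) (L2 + 1)) - F r - f1 r * u - f2 r / 2 * u ^+ 2| <= M * `|u| ^+ 3.
Hypothesis ode : forall r,
  2 * sigma ^+ 2 * r * f2 r + (d%:R * sigma ^+ 2 - 2 * theta * r) * f1 r = 1.

(** Inside the ball the increment of [F] is [main], a quadratic polynomial in the Brownian increment
    with coefficients known at time [s], up to (M + 1) C1 E: the part M C1 is the Taylor remainder,
    the part C1 comes from [step_expansion]. The bound on the cube of the jump is kept for the
    overshoot at the exit. *)
Lemma one_step : exists2 C, 0 <= C & forall (s t : R) (G : set (set T))
    (z : T -> 'rV[R]_d),
    0 <= s -> s < t -> t - s <= 1 -> <<s G >> `<=` measurable ->
    independent_systems P <<s G >>
      (sigma_generated [set: unit] (fun=> fun w => B t w - B s w)) ->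
    (forall i, measurable_fun [set: g_sigma_algebraType G]
       ((fun w => z w ord0 i) : g_sigma_algebraType G -> R)) ->
    let r w := sqnorm (z w) in
    let I w := \1_[set w | r w < L2] w : R in
    let r' w := sqnorm ((1 - theta * (t - s)) *: z w + sigma *: (B t w - B s w)) in
  [/\ P.-integrable [set: T] (EFin \o (fun w => I w * `|r' w - r w| ^+ 3)),
      \int[P]_w (I w * `|r' w - r w| ^+ 3) <= C * Num.sqrt (t - s) ^+ 3,
      P.-integrable [set: T]
        (EFin \o (fun w => I w * (F (Num.min (r' w) (L2 + 1)) - F (r w)))) &
      `|\int[P]_w (I w * (F (Num.min (r' w) (L2 + 1)) - F (r w))) -
        (t - s) * \int[P]_w I w| <= C * Num.sqrt (t - s) ^+ 3].
Proof.
have [C1 C10 hC1] := step_expansion theta sigma L2 M sigma_gt0 L2_ge0 M_ge0.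
have [C2 C20 hC2] := step_error_expectation P d B hB.
have MC : 0 <= (M + 1) * C1 by rewrite mulr_ge0// addr_ge0.
exists ((M + 1) * C1 * C2); first by rewrite mulr_ge0.
move=> s t G z s0 st ts1 mG iG mz r I r'.
pose D i w := (B t w - B s w) ord0 i.
pose m := Num.sqrt (t - s).
have h0 : 0 < t - s by rewrite subr_gt0.
have m0 : 0 < m by rewrite sqrtr_gt0.
have m2 : m ^+ 2 = t - s by rewrite sqr_sqrtr// ltW.
have m1 : m <= 1 by rewrite -sqrtr1 ler_wsqrtr.
have [iE hE] := hC2 s t s0 st ts1.
pose q w := sqnorm (B t w - B s w).
pose E w := step_error m (Num.sqrt (q w)).
rewrite -/m -/(E _) in iE hE *.
pose a := 1 - theta * m ^+ 2.
pose p w := \sum_i z w ord0 i * D i w.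
have r0 w : 0 <= r w by exact: sqnorm_ge0.
have q0 w : 0 <= q w by exact: sqnorm_ge0.
have r'0 w : 0 <= r' w by exact: sqnorm_ge0.
have rE w : r' w - r w = (a ^+ 2 - 1) * r w + 2 * a * sigma * p w + sigma ^+ 2 * q w.
  rewrite /r' /r /p /q /sqnorm !mulr_sumr -sumrB -!big_split/=.
  by apply: eq_bigr => i _; rewrite !mxE -m2 /D/= !mxE /a; ring.
have pq w : r w <= L2 -> `|p w| <= Num.sqrt L2 * Num.sqrt (q w).
  move=> rL; rewrite -sqrtrM// -sqrtr_sqr; apply: ler_wsqrtr.
  apply: (le_trans (cauchy_schwarz_sum d _ _)).
  by apply: ler_pM => //; apply: sumr_ge0 => i _; exact: sqr_ge0.
pose TG := g_sigma_algebraType G.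
have mr : measurable_fun [set: TG] (r : TG -> R).
  by apply: measurable_sum => i; apply: measurable_funX; exact: mz.
have mA : <<s G >> [set w | r w < L2].
  rewrite (_ : [set w | _] = [set: T] `&` r @^-1` `]-oo, L2[%classic).
    by apply: mr => //; exact: measurable_itv.
  by apply/seteqP; split=> w /=; rewrite in_itv/=; [split|case].
have mI : measurable_fun [set: TG] (I : TG -> R) by exact: (@measurable_indic _ TG).
have I01 w : I w = (r w < L2)%R%:R.
  by rewrite /I indicE; congr (_%:R); rewrite mem_setE.
have mf1r : measurable_fun [set: TG] (f1 \o r : TG -> R).
  by apply: measurableT_comp => //; exact: continuous_measurable_fun.
have mf2r : measurable_fun [set: TG] (f2 \o r : TG -> R).
  by apply: measurableT_comp => //; exact: continuous_measurable_fun.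
have zL w i : r w < L2 -> `|z w ord0 i| <= Num.sqrt L2.
  move=> rL; rewrite -sqrtr_sqr; apply: ler_wsqrtr; apply: le_trans (ltW rL).
  rewrite /r /sqnorm (bigD1 i)//= lerDl; apply: sumr_ge0 => j _; exact: sqr_ge0.
pose K := Num.sqrt L2.
have K0 : 0 <= K by exact: sqrtr_ge0.
(* The coefficients of degree 0, 1 and 2 in the increment. The indicator confines [z] to the ball,
   which makes them bounded, and it is itself known from the past. *)
pose Y0 w := I w * (- (2 * theta * m ^+ 2 * r w * f1 (r w))).
pose Y1 i w := I w * (2 * a * sigma * f1 (r w) * z w ord0 i).
pose Y2 i j w := I w * (sigma ^+ 2 * f1 (r w) *+ (i == j) +
  2 * sigma ^+ 2 * f2 (r w) * (z w ord0 i * z w ord0 j)).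
have rL2 w : r w < L2 -> 0 <= r w <= L2 by move=> /ltW ->; rewrite r0.
have mY0 : measurable_fun [set: TG] (Y0 : TG -> R).
  apply: measurable_funM => //; apply: measurableT_comp => //.
  by apply: measurable_funM => //; apply: measurable_funM.
have mY1 i : measurable_fun [set: TG] (Y1 i : TG -> R).
  apply: measurable_funM => //; apply: measurable_funM => //.
  exact: measurable_funM.
have mY2 i j : measurable_fun [set: TG] (Y2 i j : TG -> R).
  apply: measurable_funM => //; apply: measurable_funD.
    under eq_fun do rewrite -mulr_natr.
    by apply: measurable_funM => //; exact: measurable_funM.
  apply: measurable_funM; first exact: measurable_funM.
  by apply: measurable_funM.
have bI (X : T -> R) (N : R) : 0 <= N -> (forall w, r w < L2 -> `|X w| <= N) ->
    forall w, `|I w * X w| <= N.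
  move=> N0 XN w; rewrite I01; case: (boolP (r w < L2)) => [/XN|_].
    by rewrite mul1r.
  by rewrite mul0r normr0.
have bY0 : forall w, `|Y0 w| <= 2 * `|theta| * m ^+ 2 * L2 * M.
  apply: bI => [|w rL]; first by rewrite !mulr_ge0// ltW.
  rewrite normrN (normrM _ (f1 _)); apply: ler_pM => //; last exact/f1_bound/rL2.
  rewrite (normrM _ (r w)) (ger0_norm (r0 w)); apply: ler_pM => //; last exact: ltW.
  by rewrite (normrM _ (m ^+ 2)) (normrM 2) (@ger0_norm _ 2)// (ger0_norm (sqr_ge0 m)).
have bY1 i : forall w, `|Y1 i w| <= 2 * `|a| * sigma * M * K.
  apply: bI => [|w rL]; first by rewrite !mulr_ge0// ltW.
  rewrite (normrM _ (z w _ _)); apply: ler_pM => //; last exact: zL.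
  rewrite (normrM _ (f1 _)); apply: ler_pM => //; last exact/f1_bound/rL2.
  by rewrite (normrM _ sigma) (normrM 2) (@ger0_norm _ 2)// (gtr0_norm sigma_gt0).
have bY2 i j : forall w, `|Y2 i j w| <= sigma ^+ 2 * M + 2 * sigma ^+ 2 * M * (K * K).
  apply: bI => [|w rL]; first by rewrite addr_ge0 ?mulr_ge0 ?(ltW sigma_gt0)//.
  have s20 : 0 <= sigma ^+ 2 by exact: sqr_ge0.
  apply: (le_trans (ler_normD _ _)); apply: lerD.
    rewrite normrMn (normrM (sigma ^+ 2)) (ger0_norm s20) -mulrnAr.
    rewrite ler_wpM2l//; case: (i == j); first by rewrite mulr1n; exact/f1_bound/rL2.
    by rewrite mulr0n.
  rewrite (normrM _ (_ * z w _ _)); apply: ler_pM => //.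
    rewrite (normrM _ (f2 _)); apply: ler_pM => //; last exact/f2_bound/rL2.
    by rewrite (normrM 2) (@ger0_norm _ 2)// (ger0_norm s20).
  by rewrite normrM; apply: ler_pM => //; exact: zL.
have E1 i := Rintegral_mul_increment P d B hB s t s0 st G mG iG _ _ i (mY1 i) (bY1 i).
have E2 i j := Rintegral_mul_increment2 P d B hB s t s0 st G mG iG _ _ i j (mY2 i j) (bY2 i j).
have iY0 : P.-integrable [set: T] (EFin \o Y0).
  by apply: bounded_integrableR bY0; exact: sub_measurable_fun mY0.
have iY2 i j : P.-integrable [set: T] (EFin \o Y2 i j).
  by apply: bounded_integrableR (bY2 i j); exact: sub_measurable_fun (mY2 i j).
have I_bound w : `|I w| <= 1.
  by rewrite I01; case: (_ < _); rewrite ?normr1// normr0.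
have mIT : measurable_fun [set: T] I by exact: sub_measurable_fun mI.
have iI : P.-integrable [set: T] (EFin \o I) by exact: bounded_integrableR mIT I_bound.
pose S1 w := \sum_i Y1 i w * D i w.
pose S2 w := \sum_i \sum_j Y2 i j w * (D i w * D j w).
have iS1 : P.-integrable [set: T] (EFin \o S1).
  by apply: integrable_sumR => i _; exact: (E1 i).1.
have iS2 : P.-integrable [set: T] (EFin \o S2).
  by do 2 (apply: integrable_sumR => ? _); exact: (E2 _ _).1.
pose main w := Y0 w + S1 w + S2 w.
have i01 := integrable_addR P _ _ iY0 iS1.
have imain : P.-integrable [set: T] (EFin \o main) by exact: (integrable_addR P _ _ i01 iS2).
(* The sum [S1] has mean 0 and only the diagonal of [S2] contributes; together with [Y0] it yields
   (t - s) I times the left side of [ode] at r, which is 1. *)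
have Emain : \int[P]_w main w = (t - s) * \int[P]_w I w.
  rewrite RintegralD// RintegralD//.
  rewrite [X in _ + X + _]Rintegral_sum; last by move=> i _; exact: (E1 i).1.
  rewrite big1 ?addr0; last by move=> i _; exact: (E1 i).2.
  rewrite [X in _ + X]Rintegral_sum; last first.
    by move=> i _; apply: integrable_sumR => j _; exact: (E2 i j).1.
  rewrite (eq_bigr (fun i => \int[P]_w ((t - s) * Y2 i i w))); last first.
    move=> i _; rewrite Rintegral_sum; last by move=> j _; exact: (E2 i j).1.
    rewrite (bigD1 i)//= big1 ?addr0.
      by rewrite (E2 i i).2 eqxx mulr1n RintegralZl// mulrC.
    by move=> j ji; rewrite (E2 i j).2 eq_sym (negbTE ji) mulr0n mulr0.
  rewrite -Rintegral_sum; last by move=> i _; exact: integrable_mulR.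
  rewrite -RintegralD//; last by apply: integrable_sumR => i _; exact: integrable_mulR.
  rewrite -RintegralZl//; apply: eq_Rintegral => w _.
  have YS : \sum_i Y2 i i w = I w * (d%:R * (sigma ^+ 2 * f1 (r w)) +
      2 * sigma ^+ 2 * f2 (r w) * r w).
    rewrite -mulr_sumr; congr (_ * _); rewrite big_split/=; congr (_ + _).
      rewrite (eq_bigr (fun=> sigma ^+ 2 * f1 (r w))); last by move=> i _; rewrite eqxx.
      by rewrite sumr_const card_ord mulr_natl.
    by rewrite /r /sqnorm mulr_sumr; apply: eq_bigr => i _; rewrite expr2.
  rewrite -mulr_sumr YS /Y0 m2.
  rewrite -[X in _ = _ * X]mulr1 -[X in _ = _ * (_ * X)](ode (r w)); ring.
have mB i := measurable_increment P d B hB s t s0 st i.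
have mzT i : measurable_fun [set: T] (fun w => z w ord0 i) by exact: sub_measurable_fun (mz i).
have mrT : measurable_fun [set: T] r by exact: sub_measurable_fun mr.
have mr' : measurable_fun [set: T] r'.
  apply: measurable_sum => i; apply: measurable_funX.
  under eq_fun do rewrite 2!mxE [X in _ + X]mxE.
  by apply: measurable_funD; apply: measurable_funM.
have step w : r w < L2 ->
    `|r' w - r w| ^+ 3 <= C1 * E w /\
    `|F (Num.min (r' w) (L2 + 1)) - F (r w) - main w| <= (M + 1) * C1 * E w.
  move=> rL; have rL' := ltW rL.
  have [] := hC1 m (Num.sqrt (q w)) (r w) (p w) (f1 (r w)) (f2 (r w)) m0 m1
    (sqrtr_ge0 _) (r0 w) rL' (pq w rL') (f1_bound _ (rL2 _ rL)) (f2_bound _ (rL2 _ rL)).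
  rewrite -/a sqr_sqrtr// -rE -/(E w) => h1 h2; split => //.
  have mainE : main w = - (2 * theta * m ^+ 2 * r w * f1 (r w)) +
     2 * a * sigma * f1 (r w) * p w + sigma ^+ 2 * f1 (r w) * q w +
     2 * sigma ^+ 2 * f2 (r w) * p w ^+ 2.
    rewrite /main /Y0 /S1 /S2 /Y1 /Y2 I01 rL mul1r -addrA -[RHS]addrA -[RHS]addrA; congr (_ + _).
    congr (_ + _).
      by rewrite /p mulr_sumr; apply: eq_bigr => i _; rewrite mul1r mulrA.
    rewrite /q /sqnorm [p w ^+ 2]expr2 /p big_distrlr/= !mulr_sumr -big_split/=.
    apply: eq_bigr => i _.
    under eq_bigr do rewrite mul1r mulrDl.
    rewrite big_split/=; congr (_ + _).
      rewrite (bigD1 i)//= big1 ?addr0; first by rewrite eqxx mulr1n -expr2.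
      by move=> j; rewrite eq_sym => /negbTE ->; rewrite mulr0n mul0r.
    by rewrite mulr_sumr; apply: eq_bigr => j _; ring.
  rewrite mainE.
  have := taylor (r w) (r' w - r w) (rL2 _ rL); rewrite addrC subrK => /(_ (r'0 w)) h3.
  set A1 := F _ - F _ in h3 *; set A2 := _ + _ * p w ^+ 2 in h2 *.
  rewrite (_ : A1 - A2 = (A1 - f1 (r w) * (r' w - r w) - f2 (r w) / 2 * (r' w - r w) ^+ 2) +
     (f1 (r w) * (r' w - r w) + f2 (r w) / 2 * (r' w - r w) ^+ 2 - A2)); last by ring.
  apply: (le_trans (ler_normD _ _)); rewrite mulrDl mul1r mulrDl; apply: lerD => //.
  by apply: (le_trans h3); rewrite -mulrA ler_wpM2l.
have E0 w : 0 <= E w.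
  have [[h _ _ _] _] := step_error_monomials m (Num.sqrt (q w)) m0 m1 (sqrtr_ge0 _).
  by apply: le_trans h; rewrite exprn_ge0// ltW.
have C12 : C1 <= (M + 1) * C1 by rewrite mulrDl mul1r lerDr mulr_ge0.
have IE (X : T -> R) : (forall w, r w < L2 -> `|X w| <= (M + 1) * C1 * E w) ->
    forall w, `|I w * X w| <= (M + 1) * C1 * E w.
  move=> XE w; rewrite I01; case: (boolP (r w < L2)) => [/XE|_].
    by rewrite mul1r.
  by rewrite mul0r normr0 mulr_ge0.
have iCE := integrable_mulR P ((M + 1) * C1) E iE.
have ECE : \int[P]_w ((M + 1) * C1 * E w) <= (M + 1) * C1 * C2 * m ^+ 3.
  by rewrite RintegralZl// -[leRHS]mulrA ler_wpM2l.
have b1 : forall w, `|I w * `|r' w - r w| ^+ 3| <= (M + 1) * C1 * E w.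
  apply: IE => w rL; rewrite normrX normr_id.
  by apply: (le_trans (step w rL).1); rewrite ler_wpM2r.
have mr3 : measurable_fun [set: T] (fun w => I w * `|r' w - r w| ^+ 3).
  apply: measurable_funM => //; apply: measurable_funX; apply: measurableT_comp => //.
  exact: measurable_funB.
have i3 := le_integrableR P _ _ mr3 b1 iCE.
have mFm : measurable_fun [set: T] (fun w => F (Num.min (r' w) (L2 + 1)) - F (r w)).
  apply: measurable_funB.
    apply: measurableT_comp; first exact: continuous_measurable_fun.
    exact: measurable_minr.
  by apply: measurableT_comp => //; exact: continuous_measurable_fun.
have mdiff : measurable_fun [set: T] (fun w => I w * (F (Num.min (r' w) (L2 + 1)) - F (r w)) - main w).
  apply: measurable_funB; first exact: measurable_funM.
  exact/measurable_EFinP/(measurable_int _ imain).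
have b2 w : `|I w * (F (Num.min (r' w) (L2 + 1)) - F (r w)) - main w| <= (M + 1) * C1 * E w.
  case: (boolP (r w < L2)) => rL.
    by rewrite I01 rL mul1r; exact: (step w rL).2.
  rewrite /main /Y0 /S1 /S2 /Y1 /Y2 I01 (negbTE rL) !mul0r.
  rewrite big1; last by move=> i _; rewrite !mul0r.
  rewrite big1; last by move=> i _; rewrite big1// => j _; rewrite !mul0r.
  by rewrite !addr0 subr0 normr0 mulr_ge0.
have idiff := le_integrableR P _ _ mdiff b2 iCE.
have iFm : P.-integrable [set: T]
    (EFin \o (fun w => I w * (F (Num.min (r' w) (L2 + 1)) - F (r w)))).
  rewrite (_ : (fun w => _) = (fun w => (I w * (F (Num.min (r' w) (L2 + 1)) - F (r w)) - main w) + main w)).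
    exact: (integrable_addR P _ _ idiff imain).
  by apply/funext => w; rewrite subrK.
split => //.
- apply: le_trans ECE; apply: le_Rintegral => // w _.
  exact: le_trans (ler_norm _) (b1 w).
- rewrite -Emain -RintegralB//.
  apply: (le_trans (le_normr_Rintegral _ idiff)) => //.
  apply: le_trans ECE; apply: le_Rintegral => //.
  exact: (integrable_norm idiff).
Qed.

End one_step.

(** * The stopped chain and its exit time *)

Section filtration.
Context {disp : measure_display} {T : measurableType disp} {R : realType}.
Context (P : probability T R) (d : nat) (B : R -> T -> 'rV[R]_d) (X0 : T -> 'rV[R]_d).
Hypothesis hB : standard_brownian_motion P B.
Hypothesis mX0 : measurable_vector X0.
Hypothesis hindep : independent_systems P
  (sigma_generated [set: unit] (fun=> X0)) (sigma_generated `[0, +oo[%classic B).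

Lemma sigma_generated_sub (I : Type) (K : set I) (Y : I -> T -> 'rV[R]_d)
    (S : set (set T)) : sigma_algebra [set: T] S ->
  (forall k i A, K k -> measurable A -> S ((fun w => Y k w ord0 i) @^-1` A)) ->
  sigma_generated K Y `<=` S.
Proof.
move=> sS YS; apply: smallest_sub => // _ [k Kk [i _ [A mA <-]]].
by rewrite setTI; exact: YS.
Qed.

Lemma sigma_generated_preimage (I : Type) (K : set I) (Y : I -> T -> 'rV[R]_d) k i A :
  K k -> measurable A -> sigma_generated K Y ((fun w => Y k w ord0 i) @^-1` A).
Proof.
move=> Kk mA; apply: sub_sigma_algebra.
by exists k => //; exists i => //; exists A => //; rewrite setTI.
Qed.

(** Kept as a generating system, which is what [g_sigma_algebraType] expects. No negligible sets are
    adjoined: the chain is an explicit function of the initial value and of [B]. *)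
Definition driving_events (u : R) : set (set T) :=
  sigma_generated [set: unit] (fun=> X0) `|` sigma_generated `[0, u]%classic B.

Let past_sub u : sigma_generated `[0, u]%classic B `<=` sigma_generated `[0, +oo[%classic B.
Proof.
apply: sigma_generated_sub; first exact: smallest_sigma_algebra.
move=> k i A; rewrite /= in_itv/= => /andP[k0 _] mA.
by apply: sigma_generated_preimage => //=; rewrite in_itv/= k0.
Qed.

Let path_measurable : sigma_generated `[0, +oo[%classic B `<=` measurable.
Proof.
have [mB _ _ _ _] := hB.
apply: sigma_generated_sub; first exact: sigma_algebra_measurable.
move=> k i A; rewrite /= in_itv/= andbT => k0 mA.
by rewrite -[X in measurable X]setTI; exact: mB.
Qed.

Let init_measurable : sigma_generated [set: unit] (fun=> X0) `<=` measurable.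
Proof.
apply: sigma_generated_sub; first exact: sigma_algebra_measurable.
by move=> k i A _ mA; rewrite -[X in measurable X]setTI; exact: mX0.
Qed.

Lemma driving_events_measurable u : <<s driving_events u >> `<=` measurable.
Proof.
apply: smallest_sub; first exact: sigma_algebra_measurable.
by move=> A [/init_measurable//|/past_sub/path_measurable].
Qed.

Lemma driving_events_independent s t : 0 <= s -> s < t ->
  independent_systems P <<s driving_events s >>
    (sigma_generated [set: unit] (fun=> fun w => B t w - B s w)).
Proof.
move=> s0 st; have [mB _ _ iB _] := hB.
apply: (@independent_systems_join _ _ _ _ _ _ _ (sigma_generated `[0, +oo[%classic B)) => //.
- exact: smallest_sigma_algebra.
- exact: smallest_sigma_algebra.
- by move=> A C; exact: (@measurableI _ (g_sigma_algebraType (\bigcup_(k in `[0, +oo[%classic)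
    \bigcup_(i in [set: 'I_d]) preimage_set_system [set: T] (fun w => B k w ord0 i)
          (measurable : set (set R))))).
- set H := \bigcup_(k in `[0, +oo[%classic) \bigcup_(i in [set: 'I_d])
    preimage_set_system [set: T] (fun w => B k w ord0 i) (measurable : set (set R)).
  apply: sigma_generated_sub; first exact: smallest_sigma_algebra.
  move=> [] i A _ mA.
  pose TH := g_sigma_algebraType H.
  have mBH u : 0 <= u -> measurable_fun [set: TH] ((fun w => B u w ord0 i) : TH -> R).
    move=> u0 _ C mC; rewrite setTI; apply: sigma_generated_preimage => //=.
    by rewrite in_itv/= u0.
  have mD : measurable_fun [set: TH] ((fun w => B t w ord0 i - B s w ord0 i) : TH -> R).
    by apply: measurable_funB; apply: mBH => //; exact: le_trans s0 (ltW st).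
  have := mD measurableT A mA; rewrite setTI.
  by rewrite (_ : _ @^-1` A = (fun w => (B t w - B s w) ord0 i) @^-1` A)//;
    apply/seteqP; split=> w /=; rewrite !mxE.
- by move=> A C FA FC; rewrite setIC muleC (iB s t).
Qed.

Lemma driving_events_le s t : s <= t -> <<s driving_events s >> `<=` <<s driving_events t >>.
Proof.
move=> st; apply: sub_sigma_algebra2 => A [XA|BA]; [by left|right].
move: A BA; apply: sigma_generated_sub; first exact: smallest_sigma_algebra.
move=> k i A; rewrite /= in_itv/= => /andP[k0 ks] mA.
by apply: sigma_generated_preimage => //=; rewrite in_itv/= k0 (le_trans ks).
Qed.

Local Notation TG u := (g_sigma_algebraType (driving_events u)).

Lemma driving_events_init u i :
  measurable_fun [set: TG u] ((fun w => X0 w ord0 i) : TG u -> R).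
Proof.
move=> _ A mA; rewrite setTI; apply: sub_sigma_algebra; left.
exact: (sigma_generated_preimage unit setT (fun=> X0) tt).
Qed.

Lemma driving_events_path u v i : 0 <= v -> v <= u ->
  measurable_fun [set: TG u] ((fun w => B v w ord0 i) : TG u -> R).
Proof.
move=> v0 vu _ A mA; rewrite setTI; apply: sub_sigma_algebra; right.
by apply: sigma_generated_preimage => //=; rewrite in_itv/= v0.
Qed.

Lemma driving_events_fun_le u v (f : T -> R) : u <= v ->
  measurable_fun [set: TG u] (f : TG u -> R) -> measurable_fun [set: TG v] (f : TG v -> R).
Proof. by move=> uv mf _ A mA; apply: (driving_events_le _ _ uv); exact: mf. Qed.

Variables (theta sigma L2 h : R).

(* Euler scheme of step [h], stopped on leaving the ball of squared radius [L2]. *)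
Fixpoint stopped_chain (k : nat) (w : T) : 'rV[R]_d :=
  if k is j.+1 then
    let z := stopped_chain j w in
    if sqnorm z < L2 then
      (1 - theta * h) *: z + sigma *: (B (j.+1%:R * h) w - B (j%:R * h) w)
    else z
  else X0 w.

Hypothesis h_gt0 : 0 < h.

Lemma measurable_stopped_chain k i :
  measurable_fun [set: TG (k%:R * h)]
    ((fun w => stopped_chain k w ord0 i) : TG (k%:R * h) -> R).
Proof.
elim: k i => [|k IH] i; first exact: driving_events_init.
have kk : k%:R * h <= k.+1%:R * h by rewrite ler_pM2r// ler_nat.
set G := driving_events (k.+1%:R * h).
have mz j : measurable_fun [set: g_sigma_algebraType G]
    ((fun w => stopped_chain k w ord0 j) : g_sigma_algebraType G -> R).
  exact: driving_events_fun_le kk (IH j).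
have mr : measurable_fun [set: g_sigma_algebraType G]
    ((fun w => sqnorm (stopped_chain k w)) : g_sigma_algebraType G -> R).
  by apply: measurable_sum => j; apply: measurable_funX; exact: mz.
have mA : <<s G >> [set w | sqnorm (stopped_chain k w) < L2].
  rewrite (_ : [set w | _] = [set: T] `&`
      (fun w => sqnorm (stopped_chain k w)) @^-1` `]-oo, L2[%classic).
    by apply: mr => //; exact: measurable_itv.
  by apply/seteqP; split=> w /=; rewrite in_itv/=; [split|case].
pose I w : R := \1_[set w | sqnorm (stopped_chain k w) < L2] w.
have mI : measurable_fun [set: g_sigma_algebraType G] (I : g_sigma_algebraType G -> R).
  exact: (@measurable_indic _ (g_sigma_algebraType G)).
have mb u : 0 <= u -> u <= k.+1%:R * h -> measurable_fun [set: g_sigma_algebraType G]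
    ((fun w => B u w ord0 i) : g_sigma_algebraType G -> R).
  by move=> u0 uk; exact: driving_events_path.
rewrite (_ : (fun w => _) = (fun w => stopped_chain k w ord0 i + I w *
   (- (theta * h) * stopped_chain k w ord0 i +
    sigma * (B (k.+1%:R * h) w ord0 i - B (k%:R * h) w ord0 i)))).
  apply: measurable_funD => //; apply: measurable_funM => //.
  apply: measurable_funD; apply: measurable_funM => //.
  apply: measurable_funB; apply: mb => //; exact: mulr_ge0 (ler0n _ _) (ltW h_gt0).
apply/funext => w /=; have -> : I w = (sqnorm (stopped_chain k w) < L2)%R%:R.
  by rewrite /I indicE; congr (_%:R); rewrite mem_setE.
case: (sqnorm _ < L2); last by rewrite mul0r addr0.
by rewrite mul1r !mxE; ring.
Qed.

End filtration.

(** * The mean of the discrete exit time *)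

Section exit_estimate.
Context {disp : measure_display} {T : measurableType disp} {R : realType}.
Context (P : probability T R) (d : nat) (B : R -> T -> 'rV[R]_d) (X0 : T -> 'rV[R]_d).
Hypothesis hB : standard_brownian_motion P B.
Hypothesis mX0 : measurable_vector X0.
Hypothesis hindep : independent_systems P
  (sigma_generated [set: unit] (fun=> X0)) (sigma_generated `[0, +oo[%classic B).
Variables (theta sigma L2 M : R) (F f1 f2 : R -> R).
Hypotheses (sigma_gt0 : 0 < sigma) (L2_ge0 : 0 <= L2) (M_ge0 : 0 <= M).
Hypotheses (cF : continuous F) (cf1 : continuous f1) (cf2 : continuous f2).
Hypothesis F_bound : forall r, 0 <= r <= L2 + 1 -> `|F r| <= M.
Hypothesis f1_bound : forall r, 0 <= r <= L2 -> `|f1 r| <= M.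
Hypothesis f2_bound : forall r, 0 <= r <= L2 -> `|f2 r| <= M.
Hypothesis taylor : forall r u, 0 <= r <= L2 -> 0 <= r + u ->
  `|F (Num.min (r + u) (L2 + 1)) - F r - f1 r * u - f2 r / 2 * u ^+ 2| <= M * `|u| ^+ 3.
Hypothesis ode : forall r,
  2 * sigma ^+ 2 * r * f2 r + (d%:R * sigma ^+ 2 - 2 * theta * r) * f1 r = 1.
Hypothesis F_lip : forall r, L2 <= r <= L2 + 1 -> `|F r - F L2| <= M * (r - L2).
Variable x2 : R.
Hypotheses (x2_ge0 : 0 <= x2) (x2_le : x2 <= L2).
Hypothesis hX0 : {ae P, forall w, sqnorm (X0 w) = x2}.

Local Notation chain h k w := (stopped_chain d B X0 theta sigma L2 h k w).

Definition inside h k w : R := \1_[set w | sqnorm (chain h k w) < L2] w.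

(** Since the chain is frozen once outside, the steps it spends inside are the initial ones;
    counting them gives the exit time, capped at n h. *)
Definition discrete_exit_time h n w : R := h * \sum_(k < n) inside h k w.

Lemma insideE h k w : inside h k w = (sqnorm (chain h k w) < L2)%R%:R.
Proof. by rewrite /inside indicE; congr (_%:R); rewrite mem_setE. Qed.

Lemma measurable_inside h k : 0 < h -> measurable_fun [set: T] (inside h k).
Proof.
move=> h0; apply: measurable_indic.
have mc i : measurable_fun [set: T] (fun w => chain h k w ord0 i).
  apply: sub_measurable_fun (driving_events_measurable P d B X0 hB mX0 (k%:R * h)) _ _.
  exact: measurable_stopped_chain.
rewrite (_ : [set w | _] = [set: T] `&` (fun w => sqnorm (chain h k w)) @^-1` `]-oo, L2[%classic).
  have mr : measurable_fun [set: T] (fun w => sqnorm (chain h k w)).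
    by apply: measurable_sum => j; apply: measurable_funX; exact: mc.
  by apply: mr => //; exact: measurable_itv.
by apply/seteqP; split=> w /=; rewrite in_itv/=; [split|case].
Qed.

Lemma measurable_discrete_exit_time h n : 0 < h ->
  measurable_fun [set: T] (discrete_exit_time h n).
Proof.
move=> h0; apply: measurable_funM => //.
by apply: measurable_sum => k; exact: measurable_inside.
Qed.

(** Summing [one_step] gives E Phi_n - F(x2) = E tau up to the accumulated error [e]; the other
    terms compare E Phi_n with F(L2). If the chain is still inside after n steps the difference is
    at most 2 M, and by Markov's inequality this has probability at most E tau / (n h), where E tau
    <= 2 M + e because [F] is bounded by [M]. The terms with [delta] account for the overshoot. *)
Lemma exit_estimate_step : exists2 C, 0 <= C & forall (n : nat) (h delta e : R),
    0 < h -> h <= 1 -> 0 < delta -> (0 < n)%N -> e = n%:R * (C * Num.sqrt h ^+ 3) ->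
    `|\int[P]_w discrete_exit_time h n w - (F L2 - F x2)| <=
    e + 2 * M * ((2 * M + e) / (n%:R * h)) + M * delta + M / delta ^+ 2 * e.
Proof.
have [C C0 hC] := one_step P d B hB theta sigma L2 M F f1 f2 sigma_gt0 L2_ge0 M_ge0
  cF cf1 cf2 f1_bound f2_bound taylor ode.
exists C => // n h delta e h0 h1 delta0 n0 eE.
pose Z k w := chain h k w.
pose rho k w := sqnorm (Z k w).
pose I k w := inside h k w.
pose r' k w := sqnorm ((1 - theta * h) *: Z k w + sigma *: (B (k.+1%:R * h) w - B (k%:R * h) w)).
pose c3 := C * Num.sqrt h ^+ 3.
have hk k : k.+1%:R * h - k%:R * h = h by rewrite -mulrBl -natrB// subSnn mul1r.
have step k := hC (k%:R * h) (k.+1%:R * h) (driving_events d B X0 (k%:R * h)) (Z k).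
have {}step k : [/\ P.-integrable [set: T] (EFin \o (fun w => I k w * `|r' k w - rho k w| ^+ 3)),
      \int[P]_w (I k w * `|r' k w - rho k w| ^+ 3) <= c3,
      P.-integrable [set: T]
        (EFin \o (fun w => I k w * (F (Num.min (r' k w) (L2 + 1)) - F (rho k w)))) &
      `|\int[P]_w (I k w * (F (Num.min (r' k w) (L2 + 1)) - F (rho k w))) -
        h * \int[P]_w I k w| <= c3].
  have := step k; rewrite hk; apply.
  - by rewrite mulr_ge0// ltW.
  - by rewrite ltr_pM2r// ltr_nat.
  - by [].
  - exact: driving_events_measurable hB mX0 _.
  - apply: driving_events_independent => //; first by rewrite mulr_ge0// ltW.
    by rewrite ltr_pM2r// ltr_nat.
  - by move=> i; exact: measurable_stopped_chain.
have mZ k i : measurable_fun [set: T] (fun w => Z k w ord0 i).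
  apply: sub_measurable_fun (driving_events_measurable P d B X0 hB mX0 (k%:R * h)) _ _.
  exact: measurable_stopped_chain.
have mrho k : measurable_fun [set: T] (rho k).
  by apply: measurable_sum => j; apply: measurable_funX; exact: mZ.
have rho0 k w : 0 <= rho k w by exact: sqnorm_ge0.
have r'0 k w : 0 <= r' k w by exact: sqnorm_ge0.
have IE k w : I k w = (rho k w < L2)%R%:R by exact: insideE.
have I0 k w : 0 <= I k w by rewrite IE.
have I1 k w : `|I k w| <= 1 by rewrite IE; case: (_ < _); rewrite ?normr1// normr0.
have mI k : measurable_fun [set: T] (I k) by exact: measurable_inside.
have iI k : P.-integrable [set: T] (EFin \o I k) by exact: bounded_integrableR (mI k) (I1 k).
have rhoS k w : rho k.+1 w = if rho k w < L2 then r' k w else rho k w.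
  by rewrite /rho /Z /=; case: ifP.
pose Phi k w := F (Num.min (rho k w) (L2 + 1)).
have L21 : 0 <= L2 + 1 by rewrite addr_ge0.
have Phi_bound k w : `|Phi k w| <= M.
  by apply: F_bound; rewrite le_min rho0 L21/= ge_min lexx orbT.
have mPhi k : measurable_fun [set: T] (Phi k).
  apply: measurableT_comp; first exact: continuous_measurable_fun.
  exact: measurable_minr.
have iPhi k : P.-integrable [set: T] (EFin \o Phi k) by exact: bounded_integrableR (mPhi k) (Phi_bound k).
have PhiS k w : Phi k.+1 w - Phi k w = I k w * (F (Num.min (r' k w) (L2 + 1)) - F (rho k w)).
  rewrite /Phi rhoS IE; case: ifPn => rL; last by rewrite subrr mul0r.
  have -> : Num.min (rho k w) (L2 + 1) = rho k w.
    by apply/min_idPl; rewrite ltW// (lt_le_trans rL)// lerDl.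
  by rewrite mul1r.
have tau_int : \int[P]_w discrete_exit_time h n w = \sum_(k < n) h * \int[P]_w I k w.
  rewrite RintegralZl//; last by apply: integrable_sumR => k _; exact: iI.
  rewrite Rintegral_sum; last by move=> k _; exact: iI.
  by rewrite mulr_sumr.
have e0 : 0 <= e by rewrite eE mulr_ge0// mulr_ge0// exprn_ge0// sqrtr_ge0.
have EPhi : `|\int[P]_w Phi n w - \int[P]_w Phi 0%N w - \int[P]_w discrete_exit_time h n w| <= e.
  rewrite -RintegralB//.
  rewrite (_ : \int[P]_w (Phi n w - Phi 0%N w) = \sum_(k < n)
    \int[P]_w (I k w * (F (Num.min (r' k w) (L2 + 1)) - F (rho k w)))); last first.
    rewrite -Rintegral_sum; last by move=> k _; have [] := step k.
    apply: eq_Rintegral => w _.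
    rewrite -(big_mkord xpredT (fun k => I k w * (F (Num.min (r' k w) (L2 + 1)) - F (rho k w)))).
    rewrite -(telescope_sumr (fun k => Phi k w))//.
    by apply: eq_bigr => k _; rewrite -PhiS.
  rewrite tau_int -sumrB; apply: (le_trans (ler_norm_sum _ _ _)).
  apply: (@le_trans _ _ (\sum_(k < n) c3)).
    by apply: ler_sum => k _; have [] := step k.
  by rewrite sumr_const card_ord eE mulr_natl.
(* [J] marks the null event on which the initial radius is wrong. *)
pose A := [set w | sqnorm (X0 w) != x2].
have mA : measurable A.
  have mr : measurable_fun [set: T] (fun w => sqnorm (X0 w)) by exact: (mrho 0%N).
  rewrite (_ : A = [set: T] `&` (fun w => sqnorm (X0 w)) @^-1` (~` [set x2])).
    by apply: mr => //; exact: measurableC.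
  by apply/seteqP; split=> w /=; [move/eqP; split|case => _ /eqP].
pose J w : R := \1_A w.
have EJ : \int[P]_w J w = 0.
  suff PA : P A = 0%E.
    transitivity (fine (P A)); last by rewrite PA.
    by rewrite /Rintegral integral_indic// setIT.
  have [N [mN N0 AN]] := hX0.
  apply/eqP; rewrite eq_le measure_ge0 andbT -N0.
  by apply: le_measure; rewrite ?inE// => w Aw; apply: AN => /= E; move: Aw; rewrite /A/= E eqxx.
have mJ : measurable_fun [set: T] J by exact: measurable_indic.
have J0 w : 0 <= J w by rewrite /J indicE.
have J1 w : `|J w| <= 1 by rewrite ger0_norm// /J indicE; case: (_ \in _).
have iJ : P.-integrable [set: T] (EFin \o J) by exact: bounded_integrableR mJ J1.
have JE w : sqnorm (X0 w) != x2 -> J w = 1 by move=> Aw; rewrite /J indicE mem_set.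
have Phi0 : \int[P]_w Phi 0%N w = F x2.
  apply/eqP; rewrite -subr_eq0 -normr_le0 -(Rintegral_prob_cst P (F x2)).
  have ic : P.-integrable [set: T] (EFin \o (fun=> F x2)).
    exact: (@bounded_integrableR _ _ _ _ _ `|F x2|).
  rewrite -RintegralB//; have id := integrable_subR P _ _ (iPhi 0%N) ic.
  apply: (le_trans (le_normr_Rintegral _ id)) => //.
  apply: (@le_trans _ _ (\int[P]_w (2 * M * J w))); last by rewrite RintegralZl// EJ mulr0.
  apply: le_Rintegral => //; [exact: (integrable_norm id)|exact: integrable_mulR|move=> w _].
  have [E|/JE ->] := eqVneq (sqnorm (X0 w)) x2.
    have -> : Phi 0%N w = F x2.
      rewrite /Phi /rho /Z /= E; congr F; apply/min_idPl.
      by rewrite (le_trans x2_le)// lerDl.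
    by rewrite subrr normr0 !mulr_ge0.
  rewrite mulr1 mulrDl mul1r; apply: (le_trans (ler_normB _ _)); apply: lerD => //.
  by apply: F_bound; rewrite x2_ge0 (le_trans x2_le)// lerDl.
(* The chain is frozen at its first exit, so it overshoots [L2] by at most the
   jump at the exit; the mean overshoot is then controlled by the sum [b] of
   the cubes of all jumps through [V <= delta + V^3 / delta^2]. *)
pose b w := \sum_(k < n) I k w * `|r' k w - rho k w| ^+ 3.
have ib : P.-integrable [set: T] (EFin \o b) by apply: integrable_sumR => k _; have [] := step k.
have Eb : \int[P]_w b w <= e.
  rewrite Rintegral_sum; last by move=> k _; have [] := step k.
  apply: (@le_trans _ _ (\sum_(k < n) c3)).
    by apply: ler_sum => k _; have [] := step k.
  by rewrite sumr_const card_ord eE mulr_natl.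
have bterm k w : 0 <= I k w * `|r' k w - rho k w| ^+ 3 by rewrite mulr_ge0 ?exprn_ge0.
have b0 w : 0 <= b w by apply: sumr_ge0.
have overshoot w : sqnorm (X0 w) = x2 -> L2 <= rho n w -> (rho n w - L2) ^+ 3 <= b w.
  move=> E; rewrite /b; elim: (n) => [|k IH].
    (* A chain outside from the start has x2 = L2, and so no overshoot. *)
    by rewrite /rho /Z /= E => h'; rewrite big_ord0 (le_anti (introT andP (conj x2_le h'))) subrr expr0n.
  rewrite big_ord_recr/= rhoS IE; case: ifPn => rL.
    move=> Lr; rewrite mul1r; apply: (@le_trans _ _ (`|r' k w - rho k w| ^+ 3)); last first.
      by rewrite lerDr; apply: sumr_ge0.
    rewrite lerXn2r ?nnegrE ?subr_ge0//.
    by apply: le_trans (ler_norm _); rewrite lerD2l lerN2 ltW.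
  by move=> /IH {}IH; rewrite mul0r addr0.
have decr w k : (k <= n)%N -> I n w <= I k w.
  move=> kn; rewrite -(subnKC kn); elim: (n - k)%N => [|j IHj]; first by rewrite addn0.
  apply: le_trans IHj; rewrite addnS !IE.
  rewrite ler_nat rhoS; have [rL|rL] := boolP (rho (k + j)%N w < L2); first exact: leq_b1.
  by rewrite (negbTE rL).
pose tau w := discrete_exit_time h n w.
have nh0 : 0 < n%:R * h by rewrite mulr_gt0// ltr0n.
have itau : P.-integrable [set: T] (EFin \o tau).
  by apply: integrable_mulR; apply: integrable_sumR => k _; exact: iI.
have In_tau w : n%:R * h * I n w <= tau w.
  rewrite /tau /discrete_exit_time -mulrA mulrCA ler_wpM2l ?(ltW h0)//.
  rewrite mulr_natl -[X in _ *+ X](card_ord n) -sumr_const.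
  by apply: ler_sum => k _; apply: decr; exact: ltnW.
have Phin_bound : `|\int[P]_w Phi n w| <= M.
  apply: (le_trans (le_normr_Rintegral _ (iPhi n))) => //.
  rewrite -[leRHS](Rintegral_prob_cst P); apply: le_Rintegral => //.
    exact: (integrable_norm (iPhi n)).
  exact: (@bounded_integrableR _ _ _ _ _ `|M|).
have Fx2 : `|F x2| <= M by apply: F_bound; rewrite x2_ge0 (le_trans x2_le)// lerDl.
have Etau : \int[P]_w tau w <= 2 * M + e.
  move: EPhi Phin_bound Fx2; rewrite Phi0 -/tau !ler_norml => /andP[u1 u2] /andP[u3 u4] /andP[u5 u6].
  lra.
have EIn : \int[P]_w I n w <= (2 * M + e) / (n%:R * h).
  rewrite ler_pdivlMr// mulrC -RintegralZl//; apply: le_trans Etau.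
  apply: le_Rintegral => //; exact: integrable_mulR.
have PhiL : `|\int[P]_w Phi n w - F L2| <= 2 * M * ((2 * M + e) / (n%:R * h)) + M * delta + M / delta ^+ 2 * e.
  rewrite -(Rintegral_prob_cst P (F L2)).
  have ic : P.-integrable [set: T] (EFin \o (fun=> F L2)).
    exact: (@bounded_integrableR _ _ _ _ _ `|F L2|).
  rewrite -RintegralB//; have id := integrable_subR P _ _ (iPhi n) ic.
  apply: (le_trans (le_normr_Rintegral _ id)) => //.
  have iMd : P.-integrable [set: T] (EFin \o (fun=> M * delta)).
    exact: (@bounded_integrableR _ _ _ _ _ `|M * delta|).
  have j1 := integrable_mulR P (2 * M) _ (iI n).
  have j2 := integrable_mulR P (M / delta ^+ 2) _ ib.
  have j3 := integrable_mulR P (2 * M) _ iJ.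
  have j12 := integrable_addR P _ _ j1 iMd.
  have j123 := integrable_addR P _ _ j12 j2.
  have j1234 := integrable_addR P _ _ j123 j3.
  apply: (@le_trans _ _ (\int[P]_w (2 * M * I n w + M * delta + M / delta ^+ 2 * b w + 2 * M * J w))).
    apply: le_Rintegral => //; first exact: (integrable_norm id).
    move=> w _.
    have k1 : 0 <= 2 * M * I n w by rewrite !mulr_ge0.
    have k2 : 0 <= M * delta by rewrite mulr_ge0// ltW.
    have k3 : 0 <= M / delta ^+ 2 * b w by rewrite mulr_ge0// divr_ge0// exprn_ge0// ltW.
    have k4 : 0 <= 2 * M * J w by rewrite !mulr_ge0.
    have FL2 : `|F L2| <= M by apply: F_bound; rewrite L2_ge0 lerDl/=.
    have triv : `|Phi n w - F L2| <= 2 * M.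
      by rewrite mulrDl mul1r; apply: (le_trans (ler_normB _ _)); exact: lerD.
    have [E|/JE JJ] := eqVneq (sqnorm (X0 w)) x2; last first.
      apply: (le_trans triv); rewrite JJ; lra.
    have [rL|rL] := ltP (rho n w) L2.
      have In1 : I n w = 1 by rewrite IE rL.
      by apply: (le_trans triv); rewrite In1; lra.
    have ov := overshoot w E rL.
    pose V := Num.min (rho n w) (L2 + 1) - L2.
    have V0 : 0 <= V by rewrite subr_ge0 le_min rL lerDl/=.
    have VM : `|Phi n w - F L2| <= M * V.
      by apply: F_lip; rewrite le_min rL lerDl ler01/= ge_min lexx orbT.
    have V3 : V ^+ 3 <= b w.
      have rV : V <= rho n w - L2 by rewrite /V lerD2r ge_min lexx.
      by apply: le_trans ov; rewrite lerXn2r// nnegrE// (le_trans V0).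
    have Vd : V <= delta + V ^+ 3 / delta ^+ 2.
      have [Vd|Vd] := leP V delta.
        by rewrite (le_trans Vd)// lerDl divr_ge0// exprn_ge0// ltW.
      apply: (@le_trans _ _ (V ^+ 3 / delta ^+ 2)); last by rewrite lerDr ltW.
      rewrite ler_pdivlMr ?exprn_gt0// (exprS V 2) ler_wpM2l//.
      by rewrite lerXn2r// ?nnegrE; exact: ltW.
    have : M * V <= M * delta + M / delta ^+ 2 * b w.
      rewrite -mulrA -mulrDr ler_wpM2l// (le_trans Vd)// lerD2l mulrC ler_wpM2l//.
      by rewrite invr_ge0 exprn_ge0// ltW.
    move: k1 k4; lra.
  rewrite RintegralD// RintegralD// RintegralD// Rintegral_prob_cst !RintegralZl// EJ mulr0 addr0.
  apply: lerD; first by rewrite lerD2r ler_wpM2l// mulr_ge0.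
  by rewrite ler_wpM2l// divr_ge0// exprn_ge0// ltW.
move: EPhi PhiL; rewrite Phi0 -/tau.
rewrite (_ : \int[P]_w tau w - (F L2 - F x2) =
  (\int[P]_w Phi n w - F L2) - (\int[P]_w Phi n w - F x2 - \int[P]_w tau w)); last by ring.
move=> u1 u2; apply: (le_trans (ler_normB _ _)); lra.
Qed.

(** With h = t / n the accumulated error is e = C t sqrt(t / n), which tends to 0. The choice of
    [delta] makes M delta at most eps / 2, and [K] collects the coefficients of [e]; the term 4 M^2
    / t, due to paths not yet out at time t, does not depend on n. *)
Lemma exit_estimate t eps : 0 < t -> 0 < eps -> exists N : nat, forall n, (N < n)%N ->
  `|\int[P]_w discrete_exit_time (t / n%:R) n w - (F L2 - F x2)| <= 4 * M ^+ 2 / t + eps.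
Proof.
move=> t0 eps0; have [C C0 hC] := exit_estimate_step.
pose delta := eps / (2 * (M + 1)).
have M1 : 0 < M + 1 by rewrite ltr_wpDl.
have delta0 : 0 < delta by rewrite divr_gt0// mulr_gt0.
pose K := 1 + 2 * M / t + M / delta ^+ 2.
have K1 : 1 <= K.
  have a1 : 0 <= 2 * M / t by rewrite divr_ge0 ?mulr_ge0// ltW.
  have a2 : 0 <= M / delta ^+ 2 by rewrite divr_ge0 ?sqr_ge0.
  by rewrite /K; lra.
have K0 : 0 < K by exact: lt_le_trans K1.
pose eta := eps / (2 * K).
have eta0 : 0 < eta by rewrite divr_gt0// mulr_gt0.
(* The threshold beyond which e <= eta, obtained by squaring; the bound on n also exceeds t, so that
   the step is at most 1. *)
pose g := (C * t) ^+ 2 * t / eta ^+ 2.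
exists (Num.truncn g + Num.truncn t).+1 => n Nn.
have n0 : (0 < n)%N by exact: leq_ltn_trans Nn.
have n0R : 0 < n%:R :> R by rewrite ltr0n.
have gn : g <= n%:R.
  apply: (le_trans (ltW (truncnS_gt g))); rewrite ler_nat.
  by apply: leq_trans (ltnW Nn); rewrite ltnS leq_addr.
have tn : t <= n%:R.
  apply: (le_trans (ltW (truncnS_gt t))); rewrite ler_nat.
  by apply: leq_trans (ltnW Nn); rewrite ltnS leq_addl.
have h0 : 0 < t / n%:R by rewrite divr_gt0.
have h1 : t / n%:R <= 1 by rewrite ler_pdivrMr// mul1r.
pose e := n%:R * (C * Num.sqrt (t / n%:R) ^+ 3).
apply: (le_trans (hC n (t / n%:R) delta e h0 h1 delta0 n0 erefl)).
have nh : n%:R * (t / n%:R) = t by rewrite mulrC divfK// gt_eqF.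
have sh0 : 0 <= Num.sqrt (t / n%:R) by exact: sqrtr_ge0.
have eE : e = C * t * Num.sqrt (t / n%:R).
  rewrite /e exprS sqr_sqrtr ?(ltW h0)//.
  by rewrite -[X in _ = C * X * _]nh; ring.
have e0 : 0 <= e by rewrite eE !mulr_ge0// ltW.
have ee : e <= eta.
  rewrite -(@ler_pXn2r _ 2)// ?nnegrE ?(ltW eta0)//.
  rewrite eE exprMn sqr_sqrtr ?(ltW h0)// mulrA ler_pdivrMr//.
  by rewrite [leRHS]mulrC -ler_pdivrMr// exprn_gt0.
rewrite nh.
rewrite (_ : e + 2 * M * ((2 * M + e) / t) + M * delta + M / delta ^+ 2 * e =
  4 * M ^+ 2 / t + (M * delta + K * e)); last first.
  by rewrite /K; field; rewrite !gt_eqF.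
rewrite lerD2l.
have -> : eps = eps / 2 + eps / 2 by rewrite -splitr.
apply: lerD.
  rewrite (_ : M * delta = eps / 2 * (M / (M + 1))); last first.
    by rewrite /delta; field; rewrite gt_eqF.
  by rewrite ler_piMr ?divr_ge0 ?(ltW eps0)// ler_pdivrMr// mul1r lerDl.
apply: (@le_trans _ _ (K * eta)); first by rewrite ler_wpM2l// ltW.
by rewrite /eta le_eqVlt; apply/orP; left; apply/eqP; field; rewrite gt_eqF.
Qed.

End exit_estimate.

(** * Comparison with the Ornstein-Uhlenbeck path *)

Section scalar_paths.
Context {R : realType}.
Local Notation mu := (@lebesgue_measure R).
Implicit Types (f : R -> R) (s t u h eta theta : R).

(** Heine's theorem, phrased as an eventual property of [delta] so that finitely many coordinates
    can be treated at once by intersection in the filter. *)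
Lemma itv_uniform_modulus f t eta : {within `[0, +oo[, continuous f} -> 0 < eta ->
  \forall delta \near 0^'+, forall s u, 0 <= s <= t -> 0 <= u <= t ->
    `|s - u| < delta -> `|f s - f u| <= eta.
Proof.
move=> cf eta0.
have /compact_near_coveringP/near_covering_withinP := @segment_compact R 0 t.
move=> /(_ R 0^'+ (fun delta s => forall u, 0 <= u <= t -> `|s - u| < delta -> `|f s - f u| <= eta)).
move=> H; have {}H : \forall delta \near 0^'+, `[0, t]%classic `<=` (fun s =>
   forall u, 0 <= u <= t -> `|s - u| < delta -> `|f s - f u| <= eta).
  apply: H => x /=; rewrite in_itv/= => /andP[x0 xt].
  have /subspace_continuousP/(_ x) := cf; rewrite /= in_itv/= x0 => /(_ isT).
  move=> /cvgrPdist_lt/(_ (eta / 2)); rewrite divr_gt0// => /(_ isT).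
  rewrite near_withinE => /nbhs_ballP[e /= e0 xe].
  exists (ball x (e / 2), [set delta | delta < e / 2]) => /=.
    split; first by apply: nbhsx_ballx; rewrite divr_gt0.
    by apply: nbhs_right_lt; rewrite divr_gt0.
  move=> [s delta] /= [xs de]; rewrite in_itv/= => /andP[s0 st] u /andP[u0 ut] su.
  have fs : `|f x - f s| < eta / 2.
    apply: xe; last by rewrite /= in_itv/= s0.
    by apply: (@lt_trans _ _ (e / 2)) => //; rewrite ltr_pdivrMr// ltr_pMr// ltr1n.
  have fu : `|f x - f u| < eta / 2.
    apply: xe; last by rewrite /= in_itv/= u0.
    rewrite /ball/= (_ : x - u = (x - s) + (s - u)); last by ring.
    apply: (le_lt_trans (ler_normD _ _)); rewrite [ltRHS](splitr e).
    by apply: ltrD => //; exact: lt_trans de.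
  rewrite (_ : f s - f u = (f x - f u) - (f x - f s)); last by ring.
  by apply: (le_trans (ler_normB _ _)); rewrite (splitr eta) ltW// ltrD.
near=> delta => s u s0t u0t su.
have : `[0, t]%classic `<=` (fun s =>
   forall u, 0 <= u <= t -> `|s - u| < delta -> `|f s - f u| <= eta) by near: delta.
by move=> /(_ s); rewrite /= in_itv/=; apply.
Unshelve. all: by end_near. Qed.

Lemma path_integral_step f t u eta : {within `[0, +oo[, continuous f} ->
    0 <= t -> t <= u -> (forall s, t <= s <= u -> `|f s - f t| <= eta) ->
  `|\int[mu]_(s in `[0, u]) f s - \int[mu]_(s in `[0, t]) f s - (u - t) * f t|
    <= (u - t) * eta.
Proof.
move=> cf t0 tu feta.
have if0 : mu.-integrable `[0, u] (EFin \o f).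
  apply: continuous_compact_integrable; first exact: segment_compact.
  by apply: continuous_subspaceW cf => x /=; rewrite !in_itv/= => /andP[->].
rewrite (@Rintegral_itvB _ f (BLeft 0) (BRight u) t)//.
have if1 : mu.-integrable `]t, u] (EFin \o f).
  apply: integrableS if0 => // x /=; rewrite !in_itv/= => /andP[tx ->].
  by rewrite (le_trans t0)// ltW.
have cst_int c : \int[mu]_(x in `]t, u]) c = (u - t) * c.
  transitivity (c * fine (mu `]t, u]%classic)); first exact: Rintegral_cst.
  rewrite [X in fine X](_ : _ = (u - t)%:E); first by rewrite mulrC.
  rewrite lebesgue_measure_itv/= lte_fin.
  by move: tu; rewrite le_eqVlt => /predU1P[->|->//]; rewrite ltxx subrr.
have cst_i c : mu.-integrable `]t, u] (EFin \o (fun=> c : R)).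
  have ic : mu.-integrable `[t, u] (EFin \o (fun=> c : R)).
    apply: continuous_compact_integrable; first exact: segment_compact.
    by apply: continuous_subspaceT => x; exact: cvg_cst.
  by apply: integrableS ic => // x /=; rewrite !in_itv/= => /andP[/ltW -> ->].
rewrite -(cst_int (f t)) -RintegralB// -(cst_int eta).
have id : mu.-integrable `]t, u] (EFin \o (fun s => f s - f t)).
  by apply: (@integrableB _ _ _ mu `]t, u] _ (EFin \o f) (EFin \o (fun=> f t))).
apply: (le_trans (le_normr_Rintegral _ id)) => //.
apply: le_Rintegral => //.
  by apply: integrable_norm id.
by move=> s; rewrite /= in_itv/= => /andP[/ltW ts su]; apply: feta; rewrite ts.
Qed.

End scalar_paths.

Section path_comparison.
Context {disp : measure_display} {T : measurableType disp} {R : realType}.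
Variables (d : nat) (B X : R -> T -> 'rV[R]_d) (theta sigma L2 : R) (w : T).
Hypothesis cX : {within `[0, +oo[, continuous (fun t => X t w)}.
Hypothesis eqX : forall t : R, 0 <= t ->
  X t w = X 0 w - theta *: \row_i (\int[lebesgue_measure]_(s in `[0, t]) X s w ord0 i)
          + sigma *: (B t w - B 0 w).
Let x i t : R := X t w ord0 i.
Let r t : R := sqnorm (X t w).
Local Notation chain h k := (stopped_chain d B (X 0) theta sigma L2 h k w).

Lemma coordinate_continuous i : {within `[0, +oo[, continuous (x i)}.
Proof.
apply/subspace_continuousP => s s0.
have /subspace_continuousP/(_ s s0) cs := cX.
exact: (cvg_comp _ _ cs (@coord_continuous R 1 d ord0 i (X s w))).
Qed.

Lemma sqnorm_path_continuous : {within `[0, +oo[, continuous r}.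
Proof.
apply/subspace_continuousP => s s0; rewrite /r /sqnorm.
apply: cvg_big => [|i _]; first exact: add_continuous.
have /subspace_continuousP/(_ s s0) xs := coordinate_continuous i.
exact: (cvg_comp _ _ xs (@exprn_continuous R 2 (x i s))).
Qed.

(** The noise is additive and shared, so it cancels exactly, and only the drift is discretized. With
    a = |theta| h and [eta] the oscillation of the path over one step, the error satisfies e_(k+1)
    <= (1 + a) e_k + a eta, and Gronwall's argument gives eta (exp(|theta| k h) - 1). The comparison
    stops at the exit, where the chain is frozen and the path is not. *)
Lemma euler_error t zeta : 0 < t -> 0 < zeta ->
  \forall n \near \oo, forall k, (k <= n)%N ->
    (forall j, (j < k)%N -> sqnorm (chain (t / n%:R) j) < L2) ->
    forall i, `|x i (k%:R * (t / n%:R)) - chain (t / n%:R) k ord0 i| <= zeta.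
Proof.
move=> t0 zeta0.
pose eta := zeta / expR (`|theta| * t).
have eta0 : 0 < eta by rewrite divr_gt0// expR_gt0.
have [delta [H delta0]] : exists delta, (forall i s u, 0 <= s <= t -> 0 <= u <= t ->
    `|s - u| < delta -> `|x i s - x i u| <= eta) /\ 0 < delta.
  have H : \forall delta \near 0^'+, (forall i s u, 0 <= s <= t -> 0 <= u <= t ->
    `|s - u| < delta -> `|x i s - x i u| <= eta).
    apply: filter_forall => i.
    exact: (itv_uniform_modulus (x i) t eta (coordinate_continuous i) eta0).
  near (0 : R)^'+ => delta; exists delta; split; last by near: delta; exact: nbhs_right_gt.
  by near: delta; exact: H.
exists (Num.truncn (t / delta)).+1 => // n /= nd.
have nt : t / delta < n%:R.
  by apply: (lt_le_trans (truncnS_gt _)); rewrite ler_nat.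
have n0 : 0 < n%:R :> R by apply: le_lt_trans nt; rewrite divr_ge0// ltW.
set h := t / n%:R.
have h0 : 0 < h by rewrite divr_gt0.
have hd : h < delta by rewrite ltr_pdivrMr// mulrC -ltr_pdivrMr.
have nh : n%:R * h = t by rewrite mulrC divfK// gt_eqF.
have claim k : (k <= n)%N -> (forall j, (j < k)%N -> sqnorm (chain h j) < L2) ->
    forall i, `|x i (k%:R * h) - chain h k ord0 i| <= eta * (expR (`|theta| * (k%:R * h)) - 1).
  elim: k => [_ _ i|k IH kn ins i].
    by rewrite mul0r /= subrr normr0 mulr0 expR0 subrr mulr0.
  have {}IH := IH (ltnW kn) (fun j jk => ins j (ltnW jk)) i.
  set tk := k%:R * h in IH *; set tk1 := k.+1%:R * h.
  have tk0 : 0 <= tk by rewrite mulr_ge0// ltW.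
  have tkE : tk1 = tk + h by rewrite /tk1 /tk -addn1 natrD mulrDl mul1r.
  have tk1t : tk1 <= t by rewrite -nh /tk1 ler_pM2r// ler_nat.
  have tktk1 : tk <= tk1 by rewrite tkE lerDl ltW.
  have osc s : tk <= s <= tk1 -> `|x i s - x i tk| <= eta.
    move=> /andP[s1 s2]; apply: H.
    - by rewrite (le_trans tk0)//= (le_trans s2).
    - by rewrite tk0/= (le_trans tktk1).
    - rewrite ger0_norm ?subr_ge0//; apply: le_lt_trans hd.
      by rewrite lerBlDl -tkE.
  pose J u := \int[lebesgue_measure]_(s in `[0, u]) x i s.
  have := path_integral_step (x i) tk tk1 eta (coordinate_continuous i) tk0 tktk1 osc.
  rewrite -/(J tk1) -/(J tk).
  rewrite (_ : tk1 - tk = h); last by rewrite tkE addrC addKr.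
  move=> HJ.
  have E1 : x i tk1 = x i 0 - theta * J tk1 + sigma * (B tk1 w ord0 i - B 0 w ord0 i).
    by rewrite /x (eqX tk1) ?(le_trans tk0)// !mxE.
  have E0 : x i tk = x i 0 - theta * J tk + sigma * (B tk w ord0 i - B 0 w ord0 i).
    by rewrite /x (eqX tk)// !mxE.
  have EZ : chain h k.+1 ord0 i = (1 - theta * h) * chain h k ord0 i +
      sigma * (B tk1 w ord0 i - B tk w ord0 i).
    by rewrite /= ins// !mxE.
  set z := chain h k ord0 i in IH EZ.
  have -> : x i tk1 - chain h k.+1 ord0 i =
      (x i tk - z) - theta * h * (x i tk - z) - theta * (J tk1 - J tk - h * x i tk).
    by rewrite EZ E1 E0; ring.
  set e := x i tk - z in IH *.
  have b1 : `|theta * h * e| <= `|theta| * h * `|e| by rewrite (normrM (theta * h)) (normrM theta) (gtr0_norm h0).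
  have b2 : `|theta * (J tk1 - J tk - h * x i tk)| <= `|theta| * (h * eta).
    by rewrite normrM ler_wpM2l.
  apply: (le_trans (ler_normB _ _)); apply: (le_trans (lerD (ler_normB _ _) b2)).
  apply: (le_trans (lerD (lerD (lexx _) b1) (lexx _))).
  rewrite tkE (mulrDr `|theta|) expRD.
  set a := `|theta| * h; set Ek := expR (`|theta| * tk) in IH *.
  have a0 : 0 <= a by rewrite mulr_ge0// ltW.
  have Ek0 : 0 < Ek by exact: expR_gt0.
  have ea : 1 + a <= expR a by exact: expR_ge1Dx.
  apply: (@le_trans _ _ ((1 + a) * (eta * (Ek - 1)) + a * eta)).
    have : (1 + a) * `|e| <= (1 + a) * (eta * (Ek - 1)) by rewrite ler_wpM2l// addr_ge0.
    rewrite /a; lra.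
  rewrite (_ : (1 + a) * (eta * (Ek - 1)) + a * eta = eta * (Ek * (1 + a) - 1)); last by ring.
  by rewrite ler_pM2l// lerD2r ler_pM2l.
move=> k kn ins i; apply: (le_trans (claim k kn ins i)).
rewrite /eta mulrAC ler_pdivrMr ?expR_gt0// ler_pM2l//.
rewrite lerBlDr (@le_trans _ _ (expR (`|theta| * t)))// ?lerDl// ler_expR.
by rewrite ler_wpM2l// -nh ler_pM2r// ler_nat.
Unshelve. all: by end_near. Qed.

Lemma sqnorm_error t zeta : 0 < t -> 0 < zeta ->
  \forall n \near \oo, forall k, (k <= n)%N ->
    (forall j, (j < k)%N -> sqnorm (chain (t / n%:R) j) < L2) ->
    `|r (k%:R * (t / n%:R)) - sqnorm (chain (t / n%:R) k)| <= zeta.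
Proof.
move=> t0 zeta0.
have rt : {within `[0, t], continuous r}.
  by apply: continuous_subspaceW sqnorm_path_continuous => y /=; rewrite !in_itv/= => /andP[->].
have [c _ rc] := EVT_max (ltW t0) rt.
pose K := 1 + r c.
have K1 : 1 <= K by rewrite lerDl; exact: sqnorm_ge0.
(* [K] bounds the coordinates of the path. Each coordinate obeys |y^2 - z^2| <= |y - z| (2 |y| + |y
   - z|), with |y - z| <= xi <= 1; the final 1 keeps [Q] positive for every d. *)
pose Q := d%:R * (2 * K + 1) + 1.
have Q0 : 0 < Q by rewrite ltr_wpDl// mulr_ge0// addr_ge0// mulr_ge0//; lra.
pose xi := Num.min 1 (zeta / Q).
have xi0 : 0 < xi by rewrite lt_min ltr01 divr_gt0.
have xi1 : xi <= 1 by rewrite ge_min lexx.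
have xiQ : xi * Q <= zeta by rewrite -ler_pdivlMr// ge_min lexx orbT.
near=> n => k kn ins.
have n0 : (0 < n)%N by near: n; exists 1%N.
have n0R : 0 < n%:R :> R by rewrite ltr0n.
have err : forall i, `|x i (k%:R * (t / n%:R)) - chain (t / n%:R) k ord0 i| <= xi.
  by move: k kn ins; near: n; exact: euler_error.
set u := k%:R * _ in err *; set z := chain _ k in err *.
have u0 : 0 <= u by rewrite mulr_ge0// divr_ge0// ltW.
have ut : u <= t.
  by rewrite /u mulrA ler_pdivrMr// mulrC ler_pM2l// ler_nat.
have ru : r u <= r c by apply: rc; rewrite in_itv/= u0.
have xK i : `|x i u| <= K.
  have : x i u ^+ 2 <= r u.
    by rewrite /r /sqnorm (bigD1 i)//= lerDl; apply: sumr_ge0 => j _; exact: sqr_ge0.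
  rewrite -[x i u ^+ 2]real_normK ?num_real// /K.
  have := sqr_ge0 (`|x i u| - 1); nra.
rewrite {1}/r /sqnorm -sumrB; apply: (le_trans (ler_norm_sum _ _ _)).
apply: (@le_trans _ _ (\sum_(i < d) xi * (2 * K + 1))).
  apply: ler_sum => i _; rewrite subr_sqr normrM; apply: ler_pM => //.
    exact: err.
  rewrite [X in `|X|](_ : _ = 2 * x i u - (x i u - z ord0 i)); last by rewrite /x; ring.
  apply: (le_trans (ler_normB _ _)); rewrite normrM (@ger0_norm _ 2)//.
  by apply: lerD; [rewrite ler_pM2l|exact: le_trans (err i) xi1].
rewrite sumr_const card_ord -[leLHS]mulr_natl mulrCA.
by apply: le_trans xiQ; rewrite ler_pM2l// lerDl.
Unshelve. all: by end_near. Qed.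

(** By compactness the path stays below [L2] on [0, s] with a margin of 2 zeta, so a chain within
    zeta of it is inside at every grid time up to s. The number of these times, counting 0,
    multiplied by h is at least s. *)
Lemma discrete_exit_ge t s : 0 <= s -> s < t -> (forall u, 0 <= u <= s -> r u < L2) ->
  \forall n \near \oo, s <= discrete_exit_time d B (X 0) theta sigma L2 (t / n%:R) n w.
Proof.
move=> s0 st rL; have t0 : 0 < t by exact: le_lt_trans st.
have rs : {within `[0, s], continuous r}.
  by apply: continuous_subspaceW sqnorm_path_continuous => y /=; rewrite !in_itv/= => /andP[->].
have [c cs rc] := EVT_max s0 rs.
pose zeta := (L2 - r c) / 2.
have zeta0 : 0 < zeta by rewrite divr_gt0// subr_gt0; apply: rL; move: cs; rewrite in_itv.
near=> n.
have n0 : (0 < n)%N by near: n; exists 1%N.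
have n0R : 0 < n%:R :> R by rewrite ltr0n.
set h := t / n%:R.
have h0 : 0 < h by rewrite divr_gt0.
have nh : n%:R * h = t by rewrite mulrC divfK// gt_eqF.
have err : forall k, (k <= n)%N ->
    (forall j, (j < k)%N -> sqnorm (chain h j) < L2) ->
    `|r (k%:R * h) - sqnorm (chain h k)| <= zeta.
  by rewrite /h; near: n; exact: sqnorm_error.
(* Strong induction, because the error bound at step k presupposes that the chain was inside at all
   earlier steps. *)
have ins k : k%:R * h <= s -> sqnorm (chain h k) < L2.
  elim/ltn_ind: k => k IH ks.
  have kn : (k <= n)%N by rewrite -(ler_nat R) -(ler_pM2r h0) nh (le_trans ks)// ltW.
  have insj j : (j < k)%N -> sqnorm (chain h j) < L2.
    move=> jk; apply: IH => //; apply: le_trans ks.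
    by rewrite ler_pM2r// ler_nat ltnW.
  have := err k kn insj.
  have : r (k%:R * h) <= r c by apply: rc; rewrite in_itv/= ks mulr_ge0// ltW.
  rewrite ler_norml => rk /andP[h1 h2]; have z0 := zeta0; rewrite /zeta in h1 h2 z0; lra.
pose m := (Num.truncn (s / h)).+1.
have sh0 : (Num.truncn (s / h))%:R <= s / h by rewrite truncn_le divr_ge0// ltW.
have mn : (m <= n)%N.
  by rewrite /m -(ltr_nat R) (le_lt_trans sh0)// ltr_pdivrMr// nh.
have sm : s <= h * m%:R by rewrite mulrC -ler_pdivrMr// ltW// truncnS_gt.
apply: (le_trans sm); rewrite /discrete_exit_time ler_pM2l//.
rewrite -(big_mkord xpredT (fun k => inside d B (X 0) theta sigma L2 h k w)).
rewrite (@big_cat_nat _ _ _ m)//=.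
rewrite (@eq_big_nat _ _ _ 0 m _ (fun=> 1)); last first.
  move=> k /andP[_ km]; rewrite insideE ins//.
  rewrite -ler_pdivlMr//; apply: le_trans sh0.
  by rewrite ler_nat -ltnS.
rewrite sumr_const_nat subn0 lerDl; apply: sumr_ge0 => k _.
by rewrite insideE.
Unshelve. all: by end_near. Qed.

(** At the first grid time after u, at most s for small steps, either the chain has already exited,
    and is then frozen outside, or the error bound applies and puts it outside: half of the margin r
    u - L2 pays for the move from u to the grid, half for the chain. *)
Lemma discrete_exit_le t s u : s <= t -> 0 <= u -> u < s -> L2 < r u ->
  \forall n \near \oo, discrete_exit_time d B (X 0) theta sigma L2 (t / n%:R) n w <= s.
Proof.
move=> st u0 us rL; have t0 : 0 < t by exact: le_lt_trans (lt_le_trans us st).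
pose zeta := (r u - L2) / 2.
have zeta0 : 0 < zeta by rewrite divr_gt0// subr_gt0.
have [delta [H delta0]] : exists delta, (forall s u, 0 <= s <= t -> 0 <= u <= t ->
    `|s - u| < delta -> `|r s - r u| <= zeta) /\ 0 < delta.
  have H := itv_uniform_modulus r t zeta sqnorm_path_continuous zeta0.
  near (0 : R)^'+ => delta; exists delta; split; last by near: delta; exact: nbhs_right_gt.
  by near: delta; exact: H.
pose q := Num.min delta (s - u).
have q0 : 0 < q by rewrite lt_min delta0 subr_gt0.
near=> n.
have n0 : (0 < n)%N by near: n; exists 1%N.
have n0R : 0 < n%:R :> R by rewrite ltr0n.
set h := t / n%:R.
have h0 : 0 < h by rewrite divr_gt0.
have nh : n%:R * h = t by rewrite mulrC divfK// gt_eqF.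
have hd : h < delta /\ h <= s - u.
  have : h < q.
    rewrite ltr_pdivrMr// mulrC -ltr_pdivrMr//.
    apply: (lt_le_trans (truncnS_gt _)); rewrite ler_nat.
    by near: n; exists (Num.truncn (t / q)).+1.
  by rewrite lt_min => /andP[-> /ltW].
have err : forall k, (k <= n)%N ->
    (forall j, (j < k)%N -> sqnorm (chain h j) < L2) ->
    `|r (k%:R * h) - sqnorm (chain h k)| <= zeta.
  by rewrite /h; near: n; exact: sqnorm_error.
pose k := (Num.truncn (u / h)).+1.
have uh0 : (Num.truncn (u / h))%:R <= u / h by rewrite truncn_le divr_ge0// ltW.
have k1 : u < k%:R * h by rewrite -ltr_pdivrMr// truncnS_gt.
have k2 : k%:R * h <= u + h.
  by rewrite /k -addn1 natrD mulrDl mul1r lerD2r -ler_pdivlMr.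
have ks : k%:R * h <= s by apply: (le_trans k2); rewrite -lerBrDl; exact: hd.2.
have kn : (k <= n)%N by rewrite -(ler_nat R) -(ler_pM2r h0) nh (le_trans ks).
have out : L2 <= sqnorm (chain h k).
  have [ins|] := pselect (forall j, (j < k)%N -> sqnorm (chain h j) < L2).
    have := err k kn ins; rewrite ler_norml => /andP[h1 h2].
    have : `|r (k%:R * h) - r u| <= zeta.
      apply: H.
      - by rewrite (le_trans u0 (ltW k1))/= (le_trans ks).
      - by rewrite u0 (le_trans (ltW us)).
      - rewrite ger0_norm ?subr_ge0 ?(ltW k1)//; apply: le_lt_trans hd.1.
        by rewrite lerBlDl.
    rewrite ler_norml => /andP[h3 h4]; rewrite /zeta in h1 h2 h3 h4; lra.
  move=> /existsNP[j /not_implyP[jk /negP]]; rewrite -leNgt => zj.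
  suff frozen m : L2 <= sqnorm (chain h (j + m)).
    by have := frozen (k - j)%N; rewrite subnKC// ltnW.
  elim: m => [|m IHm]; first by rewrite addn0.
  by rewrite addnS /= ltNge IHm.
have zero m : (k <= m)%N -> inside d B (X 0) theta sigma L2 h m w = 0.
  move=> km; rewrite insideE (_ : (_ < _) = false)//; apply/negbTE; rewrite -leNgt.
  rewrite -(subnKC km); elim: (m - k)%N => [|p IHp]; first by rewrite addn0.
  by rewrite addnS /= ltNge IHp.
apply: le_trans ks; rewrite mulrC /discrete_exit_time ler_pM2l//.
rewrite -(big_mkord xpredT (fun k => inside d B (X 0) theta sigma L2 h k w)).
rewrite (@big_cat_nat _ _ _ k)//=.
rewrite [X in _ + X]big_nat_cond [X in _ + X]big1 ?addr0; last first.
  by move=> m /andP[/andP[km _] _]; exact: zero.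
apply: (@le_trans _ _ (\sum_(0 <= m < k) 1)).
  by apply: ler_sum => m _; rewrite insideE; case: (_ < _).
by rewrite sumr_const_nat subn0.
Unshelve. all: by end_near. Qed.

End path_comparison.

(** * Passage to the limit *)

Section lower_integral.
Local Open Scope ereal_scope.
Context {disp : measure_display} {T : measurableType disp} {R : realType}.
Variable mu : {measure set T -> \bar R}.
Implicit Types f g : T -> \bar R.

(* No measurability: the integral of a nonnegative function is the supremum
   of the integrals of the simple functions below it. *)
Lemma ge0_le_lower_integral f g : (forall x, 0 <= f x) -> (forall x, f x <= g x) ->
  \int[mu]_x f x <= \int[mu]_x g x.
Proof.
move=> f0 fg; have g0 x : 0 <= g x by exact: le_trans (fg x).
rewrite !ge0_integralTE//; apply: ereal_sup_le => _ [h /= hf <-].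
by exists h => //= x; exact: le_trans (hf x) (fg x).
Qed.

(** Raising [g] to infinity on a null set makes the inequality hold everywhere, and leaves the
    integral of the measurable [g] unchanged. The next lemma is dual: it lowers a measurable [f] to
    0. *)
Lemma ae_le_lower_integral_r f g : (forall x, 0 <= f x) -> (forall x, 0 <= g x) ->
  measurable_fun [set: T] g -> {ae mu, forall x, f x <= g x} ->
  \int[mu]_x f x <= \int[mu]_x g x.
Proof.
move=> f0 g0 mg [N [mN N0 fgN]].
pose g' x := if x \in N then +oo else g x.
have mg' : measurable_fun [set: T] g'.
  apply: measurable_fun_ifT => //.
  by apply: (measurable_fun_bool true); rewrite setTI preimage_mem_true.
have g'0 x : 0 <= g' x by rewrite /g'; case: ifP.
rewrite (_ : \int[mu]_x g x = \int[mu]_x g' x).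
  apply: ge0_le_lower_integral => // x; rewrite /g'; case: ifPn => [_|xN]; first by rewrite leey.
  apply: contrapT => h; move: xN; rewrite notin_setE; apply; exact: fgN.
apply: ge0_ae_eq_integral => //.
exists N; split => // x /= h; apply: contrapT => xN; apply: h => _.
by rewrite /g' memNset.
Qed.

Lemma ae_le_lower_integral_l f g : (forall x, 0 <= f x) -> (forall x, 0 <= g x) ->
  measurable_fun [set: T] f -> {ae mu, forall x, f x <= g x} ->
  \int[mu]_x f x <= \int[mu]_x g x.
Proof.
move=> f0 g0 mf [N [mN N0 fgN]].
pose f' x := if x \in N then 0 else f x.
have mf' : measurable_fun [set: T] f'.
  apply: measurable_fun_ifT => //.
  by apply: (measurable_fun_bool true); rewrite setTI preimage_mem_true.
have f'0 x : 0 <= f' x by rewrite /f'; case: ifP.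
rewrite (_ : \int[mu]_x f x = \int[mu]_x f' x).
  apply: ge0_le_lower_integral => // x; rewrite /f'; case: ifPn => [_//|xN].
  apply: contrapT => h; move: xN; rewrite notin_setE; apply; exact: fgN.
apply: ge0_ae_eq_integral => //.
exists N; split => // x /= h; apply: contrapT => xN; apply: h => _.
by rewrite /f' memNset.
Qed.

End lower_integral.

Section limn_einf_bounds.
Local Open Scope ereal_scope.
Context {R : realType}.
Implicit Types (u : (\bar R)^nat) (a : \bar R).

Lemma limn_einf_ge u a : (\forall n \near \oo, a <= u n) -> a <= limn_einf u.
Proof.
move=> [N _ aN]; rewrite limn_einf_lim; apply: lime_ge; first exact: is_cvg_einfs.
exists N => // n /= Nn; apply: le_ereal_inf_tmp => _ [m /= nm <-].
by apply: aN => /=; exact: leq_trans nm.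
Qed.

Lemma limn_einf_le u a : (\forall n \near \oo, u n <= a) -> limn_einf u <= a.
Proof.
move=> [N _ aN]; rewrite limn_einf_lim; apply: lime_le; first exact: is_cvg_einfs.
exists N => // n /= Nn; apply: le_trans (aN n Nn).
by apply: ereal_inf_lbound; exists n => /=.
Qed.

Lemma measurable_fun_limn_einf d (T : measurableType d) (f : (T -> \bar R)^nat) :
  (forall n, measurable_fun [set: T] (f n)) ->
  measurable_fun [set: T] (fun x => limn_einf (f ^~ x)).
Proof.
move=> mf; rewrite /limn_einf; apply: measurableT_comp => //.
apply: measurable_fun_limn_esup => // n; exact: measurableT_comp.
Qed.

End limn_einf_bounds.

Lemma EFin_Rintegral {disp : measure_display} {T : measurableType disp} {R : realType}
    (mu : {measure set T -> \bar R}) (f : T -> R) :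
  mu.-integrable [set: T] (EFin \o f) ->
  (\int[mu]_w (f w)%:E = (\int[mu]_w f w)%:E)%E.
Proof. by move=> fi; rewrite /Rintegral fineK//; exact: integrable_fin_num. Qed.

Section radial_constants.
Context {R : realType}.
Variables (F f1 f2 f3 f4 : R -> R) (L2 : R).
Hypothesis dF : forall r, is_derive r (1 : R) F (f1 r).
Hypothesis df1 : forall r, is_derive r (1 : R) f1 (f2 r).
Hypothesis df2 : forall r, is_derive r (1 : R) f2 (f3 r).
Hypothesis df3 : forall r, is_derive r (1 : R) f3 (f4 r).
Hypothesis L2_ge0 : 0 <= L2.

Lemma radial_constants : exists2 M, 0 <= M &
  [/\ forall r, 0 <= r <= L2 + 1 -> `|F r| <= M,
      forall r, 0 <= r <= L2 -> `|f1 r| <= M,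
      forall r, 0 <= r <= L2 -> `|f2 r| <= M,
      forall r u, 0 <= r <= L2 -> 0 <= r + u ->
        `|F (Num.min (r + u) (L2 + 1)) - F r - f1 r * u - f2 r / 2 * u ^+ 2| <= M * `|u| ^+ 3 &
      forall r, L2 <= r <= L2 + 1 -> `|F r - F L2| <= M * (r - L2)].
Proof.
have [M0 M00 h0] := continuous_bounded F 0 (L2 + 1) (is_derive_continuous _ _ dF).
have [M1 M10 h1] := continuous_bounded f1 0 (L2 + 1) (is_derive_continuous _ _ df1).
have [M2 M20 h2] := continuous_bounded f2 0 (L2 + 1) (is_derive_continuous _ _ df2).
have [M3 M30 h3] := capped_taylor2_bound F f1 f2 f3 f4 L2 dF df1 df2 df3.
have LL r : 0 <= r <= L2 -> 0 <= r <= L2 + 1.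
  by move=> /andP[-> rL]; rewrite (le_trans rL)// lerDl.
exists (M0 + M1 + M2 + M3); first by rewrite !addr_ge0.
split.
- by move=> r /h0; lra.
- by move=> r /LL/h1; lra.
- by move=> r /LL/h2; lra.
- move=> r u rL ru; apply: (le_trans (h3 r u rL ru)).
  by rewrite ler_wpM2r ?exprn_ge0//; lra.
- move=> r /andP[Lr rL]; have [c [_ /andP[c1 c2]] ->] := is_derive_MVT F f1 L2 r dF.
  rewrite normrM (ger0_norm (_ : 0 <= r - L2)) ?subr_ge0//.
  rewrite ler_wpM2r ?subr_ge0//; apply: (le_trans (h1 c _)); last by lra.
  rewrite (le_trans L2_ge0)/=; last by apply: le_trans c1; rewrite le_min lexx.
  by apply: (le_trans c2); rewrite ge_max rL lerDl ler01.
Qed.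

End radial_constants.

Section ereal_comparison.
Context {R : realType}.
Local Open Scope ereal_scope.

(** Lets a possibly infinite hitting time be compared by testing only the finite times before it. *)
Lemma lee_of_real_lt (a b : \bar R) : 0 <= b ->
  (forall s : R, (0 <= s)%R -> s%:E < a -> s%:E <= b) -> a <= b.
Proof.
case: b => [r|_ _|//]; last by rewrite leey.
rewrite lee_fin => r0 H; case: a H => [q H|H|_]; last by rewrite leNye.
- rewrite lee_fin leNgt; apply/negP => rq.
  have h1 : (0 <= (r + q) / 2)%R by lra.
  have h2 : ((r + q) / 2)%:E < q%:E by rewrite lte_fin; lra.
  have := H _ h1 h2; rewrite lee_fin; lra.
- have := H (r + 1)%R (addr_ge0 r0 ler01) (ltry _); rewrite lee_fin => h; exfalso; move: h; clear; lra.
Qed.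

End ereal_comparison.

Section hitting_time_path.
Context {disp : measure_display} {T : measurableType disp} {R : realType}.
Variables (d : nat) (X : R -> T -> 'rV[R]_d) (L : R) (w : T).
Hypothesis L_gt0 : 0 < L.
Hypothesis cX : {within `[0, +oo[, continuous (fun t => X t w)}.

Lemma euclidean_norm_eq (v : 'rV[R]_d) (c : R) : 0 <= c ->
  (euclidean_norm v = c) <-> (sqnorm v = c ^+ 2).
Proof.
move=> c0; rewrite /euclidean_norm -/(sqnorm v); split=> [<-|->].
  by rewrite sqr_sqrtr// sqnorm_ge0.
by rewrite sqrtr_sqr ger0_norm.
Qed.

Lemma hitting_time_ge0 : (0 <= hitting_time X L w)%E.
Proof. by apply: le_ereal_inf_tmp => _ [t [t0 _] <-]; rewrite lee_fin. Qed.

Lemma lt_hitting_time s : sqnorm (X 0 w) <= L ^+ 2 -> (s%:E < hitting_time X L w)%E ->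
  forall u, 0 <= u <= s -> sqnorm (X u w) < L ^+ 2.
Proof.
move=> X0L sh u /andP[u0 us]; rewrite ltNge; apply/negP => Lu.
have cu : {within `[0, u], continuous (fun t => sqnorm (X t w))}.
  apply: continuous_subspaceW (sqnorm_path_continuous d X w cX) => y /=.
  by rewrite !in_itv/= => /andP[->].
have [|c] := IVT (v := L ^+ 2) u0 cu.
  by rewrite ge_min X0L le_max Lu orbT.
rewrite in_itv/= => /andP[c0 cu'] Rc.
have : (hitting_time X L w <= c%:E)%E.
  apply: ereal_inf_lbound; exists c => //; split=> //.
  by apply/euclidean_norm_eq; first exact: ltW.
move=> /(lt_le_trans sh); rewrite lte_fin => sc.
by move: (le_trans cu' us); rewrite leNgt sc.
Qed.

Lemma hitting_time_lt s : (hitting_time X L w < s%:E)%E ->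
  exists u, [/\ 0 <= u, u < s & sqnorm (X u w) = L ^+ 2].
Proof.
move=> /ereal_inf_lt[_ [u [u0 Xu] <-]]; rewrite lte_fin => us.
by exists u; split => //; apply/euclidean_norm_eq => //; exact: ltW.
Qed.

End hitting_time_path.

(** * The two inequalities for the mean hitting time *)

Section expected_hitting_time.
Context {disp : measure_display} {T : measurableType disp} {R : realType}.
Context (P : probability T R) (d : nat) (B X : R -> T -> 'rV[R]_d).
Variables (theta sigma : R) (F f1 f2 f3 f4 : R -> R) (L x : R).
Hypothesis hB : standard_brownian_motion P B.
Hypothesis hX : ornstein_uhlenbeck_solution P theta sigma B X.
Hypothesis hindep : independent_systems P
  (sigma_generated [set: unit] (fun=> X 0)) (sigma_generated `[0, +oo[%classic B).
Hypothesis sigma_gt0 : 0 < sigma.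
Hypothesis dF : forall r, is_derive r (1 : R) F (f1 r).
Hypothesis df1 : forall r, is_derive r (1 : R) f1 (f2 r).
Hypothesis df2 : forall r, is_derive r (1 : R) f2 (f3 r).
Hypothesis df3 : forall r, is_derive r (1 : R) f3 (f4 r).
Hypothesis ode : forall r,
  2 * sigma ^+ 2 * r * f2 r + (d%:R * sigma ^+ 2 - 2 * theta * r) * f1 r = 1.
Hypotheses (L_gt0 : 0 < L) (x_ge0 : 0 <= x) (x_le : x <= L).
Hypothesis hX0 : {ae P, forall w, euclidean_norm (X 0 w) = x}.

Let mX0 : measurable_vector (X 0).
Proof. by case: hX => + _ _ _; exact. Qed.

Let hX0' : {ae P, forall w, sqnorm (X 0 w) = x ^+ 2}.
Proof. by apply: filterS hX0 => w; apply: (euclidean_norm_eq d _ _ x_ge0).1. Qed.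

(** Shifted to n + 1 steps so that the step size is positive for every n, as measurability along the
    whole sequence requires. *)
Let exit L2 (t : R) n w :=
  discrete_exit_time d B (X 0) theta sigma L2 (t / n.+1%:R) n.+1 w.

Let exit_ge0 L2 t n w : 0 < t -> 0 <= exit L2 t n w.
Proof.
move=> t0; rewrite mulr_ge0// ?divr_ge0 ?(ltW t0)//.
by apply: sumr_ge0 => k _; rewrite insideE.
Qed.

Let exit_le L2 t n w : 0 < t -> exit L2 t n w <= t.
Proof.
move=> t0; rewrite /exit /discrete_exit_time mulrAC ler_pdivrMr// ler_pM2l//.
rewrite -[leRHS]mulr1 mulr_natl -[X in _ *+ X](card_ord n.+1) -sumr_const.
by apply: ler_sum => k _; rewrite insideE; case: (_ < _).
Qed.

Let measurable_exit L2 t n : 0 < t -> measurable_fun [set: T] (exit L2 t n).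
Proof.
by move=> t0; apply: (measurable_discrete_exit_time P d B (X 0) hB mX0); rewrite divr_gt0.
Qed.

Let integrable_exit L2 t n : 0 < t -> P.-integrable [set: T] (EFin \o exit L2 t n).
Proof.
move=> t0; apply: (@bounded_integrableR _ _ _ _ _ t); first exact: measurable_exit.
by move=> w; rewrite ger0_norm ?exit_ge0 ?exit_le.
Qed.

Lemma expected_exit L2 : x ^+ 2 <= L2 -> exists2 M, 0 <= M &
  forall t eps, 0 < t -> 0 < eps -> \forall n \near \oo,
  `|\int[P]_w exit L2 t n w - (F L2 - F (x ^+ 2))| <= 4 * M ^+ 2 / t + eps.
Proof.
move=> xL2; have L20 : 0 <= L2 by exact: le_trans (sqr_ge0 x) xL2.
have [M M0 [h1 h2 h3 h4 h5]] := radial_constants F f1 f2 f3 f4 L2 dF df1 df2 df3 L20.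
exists M => // t eps t0 eps0.
have [N hN] := exit_estimate P d B (X 0) hB mX0 hindep theta sigma L2 M F f1 f2
  sigma_gt0 L20 M0 (is_derive_continuous _ _ dF) (is_derive_continuous _ _ df1)
  (is_derive_continuous _ _ df2) h1 h2 h3 h4 ode h5 (x ^+ 2) (sqr_ge0 x) xL2 hX0' t eps t0 eps0.
by exists N => // n /= Nn; exact: hN.
Qed.

Local Open Scope ereal_scope.

(** Fatou's lemma is applied twice: over the number of steps at a fixed horizon m + 1, and then over
    m, which removes the error 4 M^2 / (m + 1). *)
Lemma expected_hitting_time_le :
  \int[P]_w hitting_time X L w <= (F (L ^+ 2) - F (x ^+ 2))%:E.
Proof.
have xL2 : (x ^+ 2 <= L ^+ 2)%R by rewrite lerXn2r// nnegrE// ltW.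
have [M M0 hM] := expected_exit _ xL2.
set u := (F (L ^+ 2) - F (x ^+ 2))%R in hM *.
pose g m w := limn_einf (fun n => (exit (L ^+ 2) m.+1%:R n w)%:E).
have g0 m w : 0 <= g m w.
  by apply: limn_einf_ge; exists 0%N => // n _; rewrite lee_fin exit_ge0.
have mg m : measurable_fun [set: T] (g m).
  by apply: measurable_fun_limn_einf => n; apply/measurable_EFinP; exact: measurable_exit.
have gle : {ae P, forall w, hitting_time X L w <= limn_einf (g ^~ w)}.
  have [_ _ cX eX] := hX.
  apply: filterS3 cX eX hX0' => w cXw eXw X0w.
  apply: lee_of_real_lt => [|s s0 sh].
    by apply: limn_einf_ge; exists 0%N => // n _.
  have rL := lt_hitting_time d X L w L_gt0 cXw s _ sh.
  rewrite X0w in rL; have {}rL := rL xL2.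
  (* Exit times are capped at the horizon, so only horizons beyond s can give the bound; the lower
     limit ignores the others. *)
  apply: limn_einf_ge; exists (Num.truncn s) => // m /= sm.
  have sm1 : (s < m.+1%:R)%R.
    by apply: lt_le_trans (truncnS_gt s) _; rewrite ler_nat.
  apply: limn_einf_ge.
  have [N _ hN] := discrete_exit_ge d B X theta sigma (L ^+ 2) w cXw eXw m.+1%:R s s0 sm1 rL.
  by exists N => // n /= Nn; rewrite lee_fin; apply: hN => /=; exact: leqW.
have gint m : \int[P]_w g m w <= (u + (4 * M ^+ 2 / m.+1%:R))%:E.
  apply/lee_addgt0Pr => eps eps0.
  apply: (le_trans (fatou P measurableT _ _)) => //.
  - by move=> n; apply/measurable_EFinP; exact: measurable_exit.
  - by move=> n w _; rewrite lee_fin exit_ge0.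
  apply: limn_einf_le.
  have [//|N _ hN] := hM m.+1%:R eps _ eps0.
  exists N => // n /= Nn.
  rewrite EFin_Rintegral; last exact: integrable_exit.
  rewrite -EFinD lee_fin; have := hN n Nn; rewrite ler_norml => /andP[_].
  by rewrite lerBlDl addrA.
apply: (@le_trans _ _ (\int[P]_w limn_einf (g ^~ w))).
  apply: ae_le_lower_integral_r => //.
  - by move=> w; exact: hitting_time_ge0.
  - by move=> w; apply: limn_einf_ge; exists 0%N => // n _.
  - exact: measurable_fun_limn_einf.
apply: (le_trans (fatou P measurableT _ _)) => //.
apply/lee_addgt0Pr => eps eps0; apply: limn_einf_le.
exists (Num.truncn (4 * M ^+ 2 / eps)) => // m /= mN.
apply: (le_trans (gint m)); rewrite -EFinD lee_fin lerD2l.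
rewrite ler_pdivrMr// [leRHS]mulrC -ler_pdivrMr//.
by apply: (le_trans (ltW (truncnS_gt _))); rewrite ler_nat.
Qed.

(** Chains are stopped at the smaller radius L'. Their exit times are capped at a fixed t, so
    Fatou's lemma applies to the nonnegative t - exit; paths with a hitting time beyond t are
    covered by the cap itself. *)
Lemma expected_hitting_time_ge_inner L' : (x <= L')%R -> (L' < L)%R ->
  (F (L' ^+ 2) - F (x ^+ 2))%:E <= \int[P]_w hitting_time X L w.
Proof.
move=> xL' L'L; have L'0 : (0 <= L')%R by exact: le_trans xL'.
have xL2 : (x ^+ 2 <= L' ^+ 2)%R by rewrite lerXn2r// nnegrE.
have LL2 : (L' ^+ 2 < L ^+ 2)%R by rewrite ltrXn2r// nnegrE ltW.
have [M M0 hM] := expected_exit _ xL2.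
set u := (F (L' ^+ 2) - F (x ^+ 2))%R in hM *.
apply/lee_addgt0Pr => eps eps0.
(* Large enough for the horizon error 4 M^2 / t to be at most eps / 2; the other half of eps is
   spent on the step size. *)
pose t : R := (4 * M ^+ 2 / (eps / 2) + 1)%R.
have t0 : (0 < t)%R by rewrite ltr_wpDl// divr_ge0 ?mulr_ge0 ?sqr_ge0// ltW// divr_gt0.
have eps20 : (0 < eps / 2)%R by rewrite divr_gt0.
have tM : (4 * M ^+ 2 / t <= eps / 2)%R.
  by rewrite ler_pdivrMr// [leRHS]mulrC -ler_pdivrMr// /t lerDl.
pose f n w := (t - exit (L' ^+ 2) t n w)%:E.
have f0 n w : 0 <= f n w by rewrite lee_fin subr_ge0 exit_le.
have ft n w : f n w <= t%:E by rewrite lee_fin gerBl exit_ge0.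
have mf n : measurable_fun [set: T] (f n).
  by apply/measurable_EFinP; apply: measurable_funB => //; exact: measurable_exit.
pose g w := limn_einf (f ^~ w).
have g0 w : 0 <= g w by apply: limn_einf_ge; exists 0%N => // n _; exact: f0.
have gt w : g w <= t%:E by apply: limn_einf_le; exists 0%N => // n _; exact: ft.
have mg : measurable_fun [set: T] g by exact: measurable_fun_limn_einf.
have gfin w : g w \is a fin_num by rewrite ge0_fin_numE// (le_lt_trans (gt w))// ltry.
have fineg w : (0 <= fine (g w) <= t)%R by rewrite -!lee_fin fineK// g0 gt.
(* The upper limit of the discrete exit times, written through the lower limit [g] of t - exit. *)
pose psi w := (t - fine (g w))%R.
have mfg : measurable_fun [set: T] (fine \o g).
  by apply: measurableT_comp.
have ifg : P.-integrable [set: T] (EFin \o (fine \o g)).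
  apply: (@bounded_integrableR _ _ _ _ _ t) => // w.
  by have /andP[? ?] := fineg w; rewrite /= ger0_norm.
have ict : P.-integrable [set: T] (EFin \o (fun=> t)).
  exact: (@bounded_integrableR _ _ _ _ _ `|t|%R).
have psi_le : {ae P, forall w, (psi w)%:E <= hitting_time X L w}.
  have [_ _ cX eX] := hX.
  apply: filterS2 cX eX => w cXw eXw.
  have [ht|ht] := leP t%:E (hitting_time X L w).
    apply: le_trans ht; rewrite lee_fin /psi gerBl.
    by have /andP[] := fineg w.
  have h0 := @hitting_time_ge0 _ T R d X L w.
  move: ht h0 (hitting_time_lt d X L w L_gt0); case: (hitting_time X L w) => [q| |]//.
  rewrite lte_fin lee_fin => qt q0 Hlt; rewrite lee_fin.
  apply/ler_addgt0Pr => e e0.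
  pose s := Num.min (q + e)%R t.
  have qs : (q < s)%R by rewrite lt_min qt ltrDl e0.
  have [v [v0 vs Xv]] := Hlt s qs.
  have Lv : (L' ^+ 2 < sqnorm (X v w))%R by rewrite Xv.
  have st : (s <= t)%R by rewrite ge_min lexx orbT.
  have [N _ hN] := discrete_exit_le d B X theta sigma (L' ^+ 2) w cXw eXw t s v st v0 vs Lv.
  have : (t - s)%:E <= g w.
    apply: limn_einf_ge; exists N => // n /= Nn; rewrite lee_fin lerD2l lerN2.
    by apply: hN => /=; exact: leqW.
  rewrite -(fineK (gfin w)) lee_fin /psi.
  have : (s <= q + e)%R by rewrite ge_min lexx.
  lra.
have psi0 w : 0 <= (psi w)%:E by rewrite lee_fin /psi subr_ge0; have /andP[] := fineg w.
have mpsi : measurable_fun [set: T] (fun w => (psi w)%:E).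
  by apply/measurable_EFinP; apply: measurable_funB.
have gint : \int[P]_w g w <= (t - u + (4 * M ^+ 2 / t + eps / 2))%:E.
  apply: (le_trans (fatou P measurableT _ _)) => //.
  apply: limn_einf_le; have [N _ hN] := hM t (eps / 2)%R t0 eps20.
  exists N => // n /= Nn.
  have iE := integrable_exit (L' ^+ 2) t n t0.
  have -> : \int[P]_w f n w = (t - \int[P]_w exit (L' ^+ 2) t n w)%:E.
    rewrite EFin_Rintegral; last exact: (integrable_subR P _ _ ict iE).
    by rewrite RintegralB// Rintegral_prob_cst.
  rewrite lee_fin; have := hN n Nn; rewrite ler_norml => /andP[+ _]; lra.
rewrite -leeBlDr//.
apply: le_trans (ae_le_lower_integral_l P _ _ psi0 (fun w => hitting_time_ge0 d X L w) mpsi psi_le).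
have -> : \int[P]_w (psi w)%:E = (t - \int[P]_w fine (g w))%:E.
  rewrite EFin_Rintegral; last exact: (integrable_subR P _ _ ict ifg).
  by rewrite RintegralB// Rintegral_prob_cst.
rewrite -EFinB lee_fin.
have : (\int[P]_w fine (g w))%:E <= (t - u + (4 * M ^+ 2 / t + eps / 2))%:E.
  apply: le_trans gint; rewrite -EFin_Rintegral//.
  by rewrite le_eqVlt; apply/orP; left; apply/eqP; apply: eq_integral => w _; rewrite /= fineK.
rewrite lee_fin; lra.
Qed.

(** The inner radius tends to L by continuity of [F]. The case x = L is apart since no radius lies
    in [x, L[; there the right side is 0. *)
Lemma expected_hitting_time :
  \int[P]_w hitting_time X L w = (F (L ^+ 2) - F (x ^+ 2))%:E.
Proof.
apply/eqP; rewrite eq_le expected_hitting_time_le/=.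
have [xL|Lx|->] := ltgtP x L; first last.
- by rewrite subrr; apply: integral_ge0 => w _; exact: hitting_time_ge0.
- by move: x_le; rewrite leNgt Lx.
apply/lee_addgt0Pr => eps eps0.
have cF : continuous (fun y : R => F (y ^+ 2)).
  move=> y; exact: (continuous_comp (@exprn_continuous _ 2 y) (is_derive_continuous _ _ dF _)).
have H : \forall y \near L^'-, (`|F (L ^+ 2) - F (y ^+ 2)| < eps)%R.
  have := cvg_at_left_filter (cF L); move=> /cvgrPdist_lt; exact.
near L^'- => y.
have xy : (x <= y)%R by near: y; exact: nbhs_left_ge.
have yL : (y < L)%R by near: y; exact: nbhs_left_lt.
have Fy : (`|F (L ^+ 2) - F (y ^+ 2)| < eps)%R by near: y.
apply: (@le_trans _ _ ((F (y ^+ 2) - F (x ^+ 2))%:E + eps%:E)); last first.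
  by rewrite leeD2r// expected_hitting_time_ge_inner.
by rewrite -EFinD lee_fin; move: Fy; rewrite ltr_norml => /andP[_]; lra.
Unshelve. all: by end_near. Qed.

End expected_hitting_time.

Theorem theorem4 (R : realType) (disp : measure_display)
    (T : measurableType disp) (P : probability T R)
    (d : nat) (hd : (1 <= d)%N) (sigma theta : R) (hsigma : 0 < sigma)
    (L x : R) (hL : 0 < L) (hx0 : 0 <= x) (hxL : x <= L)
    (B X : R -> T -> 'rV[R]_d)
    (hB : standard_brownian_motion P B)
    (hX : ornstein_uhlenbeck_solution P theta sigma B X)
    (hindep : independent_systems P
                (sigma_generated [set: unit] (fun=> X 0))
                (sigma_generated `[0, +oo[ B))
    (hX0 : {ae P, forall w, euclidean_norm (X 0 w) = x}) :
  let lambda : R := theta / sigma ^+ 2 in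
  (\int[P]_w hitting_time X L w)%E =
    ((2 / sigma ^+ 2)%:E *
     \int[lebesgue_measure]_(z in `[x, L])
       (z ^ (1 - d%:Z) * expR (lambda * z ^+ 2) *
        \int[lebesgue_measure]_(t in `[0%R, z])
          (t ^+ (d - 1) * expR (- (lambda * t ^+ 2))))%R%:E)%E
  /\
  (0 < lambda ->
   (\int[P]_w hitting_time X L w)%E =
     ((1 / (lambda `^ (d%:R / 2) * sigma ^+ 2))%:E *
      \int[lebesgue_measure]_(z in `[x, L])
        (z ^ (1 - d%:Z) * expR (lambda * z ^+ 2) *
         lower_incomplete_gamma (d%:R / 2) (lambda * z ^+ 2))%R%:E)%E).

Proof.
move=> lambda.
have [F [f1 [f2 [f3 [f4 [dF df1 df2 df3 ode]]]]]] := radial_solution d sigma theta hd hsigma.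
have -> := expected_hitting_time P d B X theta sigma F f1 f2 f3 f4 L x
  hB hX hindep hsigma dF df1 df2 df3 ode hL hx0 hxL hX0.
have radial := radial_integral sigma F f1 f2 dF df1.
have s0 : sigma != 0 by rewrite gt_eqF.
split=> [|l0].
  rewrite (radial 1 _ x L) => //.
    by rewrite -EFinM; congr EFin; field.
  by move=> z z0; rewrite mul1r -(radial_integrand d sigma theta f1 f2).
have la0 : lambda `^ (d%:R / 2) != 0 by rewrite gt_eqF// powR_gt0.
(* By [lower_incomplete_gamma_integral] this is the ratio of the Gamma factor to the inner integral
   of the first formula. *)
rewrite (radial (2 * lambda `^ (d%:R / 2)) _ x L) => //.
  rewrite -EFinM; congr EFin; field.
  by apply/andP.
move=> z z0; rewrite -(radial_integrand d sigma theta f1 f2)//.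
rewrite (lower_incomplete_gamma_integral d sigma theta f1 f2)//.
by rewrite -/lambda; ring.
Qed.
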